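(* Let $q>0$ and let $Q$ be the external field on $\mathbb S^2$ generated by a positive point charge of magnitude $q$ located at $(0,0,h)$, $h>0$: $$Q(x)=\frac{q}{|x-hp|},\qquad p=(0,0,1),\quad x\in\mathbb S^2.$$ Let $h_+$ be the unique real zero in $(1,\infty)$ of the equation $\frac1q=\frac{h+1}{(h-1)^2}-\frac1h$, let $h_-$ be the unique real zero in $(0,1)$ of the equation $\frac1q=\frac{h+1}{(1-h)^2}-1$, and suppose that $h_-<h<h_+$. Let $\alpha_0\in(0,\pi)$ be the unique solution of $$\frac{\pi}{\pi-\alpha+\sin\alpha}\left\{1+\frac{q(h+1)}{2h}\left(1-\frac{\alpha}{\pi}\right)-\frac{q(h-1)}{\pi h}\tan^{-1}\!\left(\cot\!\left(\frac{\alpha}{2}\right)\frac{h-1}{h+1}\right)\right\}=q\,\frac{h+1}{h^2+1-2h\cos\alpha}.$$ Set $$F(\varphi)=-\frac{q(h+1)}{2\pi^2}\left\{\frac{1}{1+h^2-2h\cos\varphi}\sqrt{\frac{1-\cos\alpha_0}{\cos\alpha_0-\cos\varphi}}+\frac{h-1}{(1+h^2-2h\cos\varphi)^{3/2}}\tan^{-1}\!\left(\frac{h-1}{\sqrt{1+h^2-2h\cos\varphi}}\sqrt{\frac{\cos\alpha_0-\cos\varphi}{1-\cos\alpha_0}}\right)\right\},$$ $$F_Q=\frac{\pi}{\pi-\alpha_0+\sin\alpha_0}\left\{1+\frac{q(h+1)}{2h}\left(1-\frac{\alpha_0}{\pi}\right)-\frac{q(h-1)}{\pi h}\tan^{-1}\!\left(\frac{h-1}{h+1}\cot\!\left(\frac{\alpha_0}{2}\right)\right)\right\}.$$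 Then the density $f$ of the equilibrium measure $\mu_Q$ (that is, $d\mu_Q=f(\varphi)\sin\varphi\,d\theta\,d\varphi$, with $\operatorname{supp}\mu_Q=C_{S,\alpha_0}$) is given by $$f(\varphi)=\frac{F_Q}{4\pi}\left\{1+\frac{2}{\pi}\left[\sqrt{\frac{1-\cos\alpha_0}{\cos\alpha_0-\cos\varphi}}-\tan^{-1}\sqrt{\frac{1-\cos\alpha_0}{\cos\alpha_0-\cos\varphi}}\,\right]\right\}+F(\varphi),\qquad\alpha_0\le\varphi\le\pi.$$
   Context: $\mathbb S^2=\{x\in\mathbb R^3:|x|=1\}$, with $|\cdot|$ the Euclidean norm. Spherical coordinates are $(r,\theta,\varphi)$ with $0\le\varphi\le\pi$ the polar angle measured from the positive $x_3$-axis and $0\le\theta\le2\pi$ the azimuthal angle. For $0<\alpha\le\pi$, $C_{S,\alpha}=\{(r,\theta,\varphi): r=1,\ \alpha\le\varphi\le\pi,\ 0\le\theta\le2\pi\}$. For a unit positive Borel measure $\mu$ on $\mathbb S^2$ put $I(\mu)=\iint\frac{1}{|x-y|}\,d\mu(x)\,d\mu(y)$ and $I_Q(\mu)=I(\mu)+2\int Q\,d\mu$. Let $V_Q$ be the infimum of $I_Q(\mu)$ over all unit positive Borel measures $\mu$ on $\mathbb S^2$. The extremal (equilibrium) measure $\mu_Q$ is the unit positive Borel measure on $\mathbb S^2$ with $I_Q(\mu_Q)=V_Q$. *)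

(* Defs.v *)
From mathcomp Require Export all_boot all_order all_algebra.
From mathcomp Require Export all_classical all_reals all_analysis.
Export Order.TTheory GRing.Theory Num.Theory.
Export numFieldNormedType.Exports.

Set Implicit Arguments.
Unset Strict Implicit.
Unset Printing Implicit Defensive.

Local Open Scope classical_set_scope.
Local Open Scope ring_scope.

(* The product sigma-algebra and the product topology that [R * R * R] carries
   are the Borel sigma-algebra and the usual topology of R^3; the norm of the
   product structure is however the sup norm, hence [enorm]. *)
Notation R3 R := (R * R * R)%type.

Definition enorm (R : realType) (x : R3 R) : R :=
  Num.sqrt (x.1.1 ^+ 2 + x.1.2 ^+ 2 + x.2 ^+ 2).

Definition sphere2 (R : realType) : set (R3 R) := [set x | enorm x = 1].

(* theta is the azimuthal angle, phi the polar angle from the x3-axis. *)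
Definition spherical (R : realType) (r theta phi : R) : R3 R :=
  (r * sin phi * cos theta, r * sin phi * sin theta, r * cos phi).

Definition spherical_cap (R : realType) (alpha : R) : set (R3 R) :=
  [set x | exists theta phi, [/\ 0 <= theta <= 2 * pi, alpha <= phi <= pi &
                                 x = spherical 1 theta phi]].

(* A measure on the sphere is a measure on R^3 concentrated on the sphere. *)
Definition unit_measure_on_sphere (R : realType) (mu : probability (R3 R) R) :
  Prop := mu (@sphere2 R) = 1%E.

(* The inverse is that of \bar R, so the kernel is +oo on the diagonal. *)
Definition energy (R : realType) (mu : probability (R3 R) R) : \bar R :=
  (\int[mu]_(x in @sphere2 R) \int[mu]_(y in @sphere2 R)
     ((enorm (x - y)%R)%:E)^-1)%E.

Definition weighted_energy (R : realType) (Q : R3 R -> \bar R)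
    (mu : probability (R3 R) R) : \bar R :=
  (energy mu + 2%:E * \int[mu]_(x in @sphere2 R) Q x)%E.

Definition minimal_energy (R : realType) (Q : R3 R -> \bar R) : \bar R :=
  ereal_inf [set weighted_energy Q mu
            | mu in [set mu | @unit_measure_on_sphere R mu]].

Definition is_equilibrium (R : realType) (Q : R3 R -> \bar R)
    (mu : probability (R3 R) R) : Prop :=
  unit_measure_on_sphere mu /\ weighted_energy Q mu = minimal_energy Q.

Definition measure_support (R : realType) (mu : probability (R3 R) R) :
    set (R3 R) :=
  [set x | forall U : set (R3 R), open U -> U x -> (0 < mu U)%E].

(* d mu = f(phi) sin phi dtheta dphi on the cap alpha <= phi <= pi. *)
Definition has_density_on_cap (R : realType) (mu : probability (R3 R) R)
    (alpha : R) (f : R -> R) : Prop :=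
  forall A : set (R3 R), measurable A ->
    mu A = (\int[lebesgue_measure]_(phi in `[alpha, pi]%classic)
              \int[lebesgue_measure]_(theta in `[0%R, (2 * pi)%R]%classic)
                (f phi * sin phi * \1_A (spherical 1 theta phi))%:E)%E.

(* +oo at (0, 0, h), which lies on the sphere when h = 1. *)
Definition point_charge_field (R : realType) (q h : R) (x : R3 R) : \bar R :=
  (q%:E / (enorm (x - (0, 0, h))%R)%:E)%E.

Definition is_h_plus (R : realType) (q t : R) : Prop :=
  1 < t /\ 1 / q = (t + 1) / (t - 1) ^+ 2 - 1 / t.

Definition is_h_minus (R : realType) (q t : R) : Prop :=
  0 < t < 1 /\ 1 / q = (t + 1) / (1 - t) ^+ 2 - 1.

Definition cot (R : realType) (x : R) : R := cos x / sin x.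

Definition F_Q (R : realType) (q h alpha : R) : R :=
  pi / (pi - alpha + sin alpha) *
  (1 + q * (h + 1) / (2 * h) * (1 - alpha / pi)
     - q * (h - 1) / (pi * h) * atan ((h - 1) / (h + 1) * cot (alpha / 2))).

Definition is_alpha0 (R : realType) (q h alpha : R) : Prop :=
  0 < alpha < pi /\
  F_Q q h alpha = q * ((h + 1) / (h ^+ 2 + 1 - 2 * h * cos alpha)).

Definition F_term (R : realType) (q h alpha0 phi : R) : R :=
  let D := 1 + h ^+ 2 - 2 * h * cos phi in
  - (q * (h + 1) / (2 * pi ^+ 2)) *
  (1 / D * Num.sqrt ((1 - cos alpha0) / (cos alpha0 - cos phi))
   + (h - 1) / D `^ (3 / 2) *
     atan ((h - 1) / Num.sqrt D *
           Num.sqrt ((cos alpha0 - cos phi) / (1 - cos alpha0)))).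

(* At phi = alpha0 the formula is undefined (division by zero); the value taken
   there does not affect the measure. *)
Definition equilibrium_density (R : realType) (q h alpha0 phi : R) : R :=
  let s := Num.sqrt ((1 - cos alpha0) / (cos alpha0 - cos phi)) in
  F_Q q h alpha0 / (4 * pi) * (1 + 2 / pi * (s - atan s))
  + F_term q h alpha0 phi.

(* Main.v *)
From HB Require Import structures.
Require Import Defs.
From mathcomp Require Import measurable_realfun measurable_fun_approximation ring lra.
Set Implicit Arguments. Unset Strict Implicit. Unset Printing Implicit Defensive.
Local Open Scope classical_set_scope.
Local Open Scope ring_scope.

(** The candidate for the equilibrium measure is written down and shown to solve
    the variational problem; uniqueness then identifies every equilibrium measure
    with it.

    Let [v = (1 - cos phi) / 2], which turns [sin phi dphi] into [2 dv], and put
    [D v = (h - 1)^2 + 4 h v], the squared distance from the charge.  Copson's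
    formula [circle_average] writes the potential of a circle of the sphere as the
    integral over [w] of [rsqrt w * rsqrt (1 - w) * rsqrt (w - v) * rsqrt (w - v')].
    The variables [v] and [v'] are separated in this product, so that the condition
    that potential plus field be a constant [F] on the cap [a <= v] splits into two
    Abel equations.  The second one is solved by the integrand
    [F - q (h + 1) / D w] (because the field is itself an Abel integral of
    [q (h + 1) / D w], see [Qint]); the first one then says that the Abel transform
    of the density is [sqrt w * (F - q (h + 1) / D w)] for [w > a] and zero for
    [w < a].  It is continuous at [a] exactly when [F = q (h + 1) / D a], the
    equation of [alpha0]; it is then increasing, so that its Abel inverse is positive,
    and it can be integrated in closed form ([is_derive_abel_prim_sqrt]), which gives
    the density of the statement.  That the total mass is one is the definition of
    [F_Q] ([integral_abel_density]).  The same comparison of integrands gives the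
    two conditions that characterise the solution: potential plus field is [F_Q]
    on the cap ([total_potential_eq]) and at least [F_Q] on the rest of the sphere
    ([total_potential_ge]).

    From these conditions minimality follows if the energy is positive definite.
    By [coulomb_mixture], [1 / |x - y|] is a mixture of kernels which on the sphere
    are geometric series in the scalar product of [x] and [y], hence sums of products
    [m x * m y] over the monomials [m], with positive coefficients.  So the energy of
    [mu - nu] dominates a positive multiple of the square of the integral of each
    monomial against [mu - nu] ([energy_ge]).  The weighted energy of any [mu] thus
    exceeds that of the candidate [nu], with equality only if all moments agree
    ([weighted_energy_ge]), and the moments of a measure on the sphere determine it
    ([moments_determine]).  The inequality is stated with mutual energies rather than
    with [mu - nu], so that no signed measure of infinite energy ever occurs.

    The threshold [h_plus] (or [h_minus], when [h < 1]) is what makes the equation of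
    [alpha0] solvable: once denominators are cleared, its two sides differ by a
    function increasing on [0, pi] with the value [pi] at [pi] ([is_derive_angle_eq]),
    and the bound on [h] says that it is negative near [0].  *)

(** * Images of weighted measures, and changes of variable *)

Section weighted_pushforward.
Local Open Scope ereal_scope.
Context d1 d2 (X : measurableType d1) (Y : measurableType d2) (R : realType).
Variables (mu : {measure set X -> \bar R}) (w : X -> R) (T : X -> Y).

(** The image under [T] of the measure with density [w] with respect to [mu].  The
    proofs are arguments so that the measure structure can be attached to the
    constant itself. *)
Definition weighted_image of (forall x, (0 <= w x)%R) & @measurable_fun _ _ X R setT w &
  @measurable_fun _ _ X Y setT T := fun A : set Y => \int[mu]_x ((w x)%:E * (\1_A (T x))%:E).

Hypotheses (w0 : forall x, (0 <= w x)%R) (mw : measurable_fun [set: X] w)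
  (mT : measurable_fun [set: X] T).

Let mw1 A : measurable A -> measurable_fun [set: X] (fun x => (w x)%:E * (\1_A (T x))%:E : \bar R).
Proof.
move=> mA; apply: emeasurable_funM; apply/measurable_EFinP => //.
by apply: measurableT_comp => //; exact: measurable_indic.
Qed.

Let weighted_image0 : weighted_image w0 mw mT set0 = 0.
Proof.
rewrite /weighted_image; under eq_integral do rewrite indic0 mule0.
by rewrite integral0.
Qed.

Let weighted_image_ge0 A : 0 <= weighted_image w0 mw mT A.
Proof. by apply: integral_ge0 => x _; rewrite mule_ge0 ?lee_fin. Qed.

Let weighted_image_sigma_additive : semi_sigma_additive (weighted_image w0 mw mT).
Proof.
move=> F mF tF mUF; rewrite /weighted_image.
have -> : \int[mu]_x ((w x)%:E * (\1_(\bigcup_n F n) (T x))%:E) =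
   \sum_(n <oo) \int[mu]_x ((w x)%:E * (\1_(F n) (T x))%:E).
  rewrite -integral_nneseries//=.
  - apply: eq_integral => x _.
    rewrite indic_bigcup//= nneseriesZl//.
  - by move=> n; exact: mw1.
  - by move=> n x _; rewrite mule_ge0 ?lee_fin.
apply: is_cvg_ereal_nneg_natsum => n _.
by apply: integral_ge0 => x _; rewrite mule_ge0 ?lee_fin.
Qed.

HB.instance Definition _ := isMeasure.Build _ _ _ (weighted_image w0 mw mT)
  weighted_image0 weighted_image_ge0 weighted_image_sigma_additive.

End weighted_pushforward.

Section weighted_integral.
Local Open Scope ereal_scope.
Context d1 d2 (X : measurableType d1) (Y : measurableType d2) (R : realType).
Variables (mu : {measure set X -> \bar R}) (w : X -> R) (T : X -> Y).
Hypotheses (w0 : forall x, (0 <= w x)%R) (mw : measurable_fun [set: X] w)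
  (mT : measurable_fun [set: X] T).
Import HBNNSimple.

(** The two sides agree on indicators by definition, hence on simple functions, and monotone
    convergence along simple approximations of [g] does the rest. *)
Lemma integral_weighted_image (g : Y -> \bar R) : (forall y, 0 <= g y) ->
  measurable_fun setT g ->
  \int[weighted_image mu w0 mw mT]_y g y = \int[mu]_x ((w x)%:E * g (T x)).
Proof.
move=> g0 mg; pose m : {measure set Y -> \bar R} := weighted_image mu w0 mw mT.
have : forall A, measurable A -> m A = \int[mu]_x ((w x)%:E * (\1_A (T x))%:E) by [].
rewrite -[weighted_image _ _ _ _]/(m : set Y -> \bar R); move: m => nu nuE.
pose g_ := nnsfun_approx measurableT mg.
have Hs (f : {nnsfun Y >-> R}) : \int[nu]_y (f y)%:E = \int[mu]_x ((w x)%:E * (f (T x))%:E).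
  under eq_integral do rewrite fimfunE -fsumEFin//.
  rewrite ge0_integral_fsum//; last 2 first.
    by move=> r; exact/measurable_EFinP/measurableT_comp.
    by move=> r x _; rewrite nnfun_muleindic_ge0.
  under [RHS]eq_integral.
    move=> x _; rewrite fimfunE -fsumEFin// ge0_mule_fsumr; last first.
      by move=> r; rewrite nnfun_muleindic_ge0.
    over.
  rewrite [RHS]ge0_integral_fsum//; last 2 first.
  - move=> r; apply: emeasurable_funM; apply/measurable_EFinP => //.
    apply: measurable_funM => //.
    by apply: measurableT_comp => //; exact: measurable_indic.
  - move=> r x _; apply: mule_ge0; first by rewrite lee_fin.
    by rewrite EFinM nnfun_muleindic_ge0.
  apply: eq_fsbigr => r _.
  rewrite integralZl_indic_nnsfun// integral_indic// setIT nuE//.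
  have [r0|r0] := leP 0%R r; last first.
    rewrite preimage_nnfun0//; under eq_integral do rewrite indic0 mule0.
    rewrite integral0 mule0.
    by under [RHS]eq_integral do rewrite indic0 mulr0 mule0; rewrite integral0.
  rewrite -ge0_integralZl//.
  - by apply: eq_integral => x _; rewrite EFinM muleCA.
  - apply: emeasurable_funM; apply/measurable_EFinP => //.
    by apply: measurableT_comp => //; exact: measurable_indic.
  - by move=> x _; rewrite mule_ge0 ?lee_fin.
have Hc y : limn (EFin \o g_ ^~ y) = g y.
  by apply/cvg_lim => //; apply: cvg_nnsfun_approx.
transitivity (limn (fun n => \int[nu]_y (g_ n y)%:E)).
  rewrite -monotone_convergence//.
  - by apply: eq_integral => x _; rewrite Hc.
  - by move=> n; exact/measurable_EFinP.
  - by move=> *; rewrite lee_fin.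
  - by move=> x _ m n mn; rewrite lee_fin; exact/lefP/nd_nnsfun_approx.
under eq_fun do rewrite Hs.
rewrite -monotone_convergence//.
- apply: eq_integral => x _; rewrite -Hc.
  rewrite Hc; apply/cvg_lim => //.
  apply: cvgeZl => //; exact: cvg_nnsfun_approx.
- move=> n; apply: emeasurable_funM; apply/measurable_EFinP => //.
  exact: measurableT_comp.
- by move=> n x _; rewrite mule_ge0 ?lee_fin.
- move=> x _ m n mn; apply: lee_wpmul2l; rewrite lee_fin//; exact/lefP/nd_nnsfun_approx.
Qed.
End weighted_integral.

Section change_of_variables.
Context (R : realType).
Local Notation leb := (@lebesgue_measure R).
Variables (F F' : R -> R).

Let cvpt (a b : R) (n : nat) : a < b -> 0 < (b - a) / (n%:R + 3) < (b-a)/2.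
Proof.
move=> ab.
have n0 : 0 <= n%:R :> R by [].
have ba : 0 < b - a by rewrite subr_gt0.
apply/andP; split; first by rewrite divr_gt0//; lra.
rewrite ltr_pM2l// ltf_pV2 ?posrE//; lra.
Qed.

Let e (a b : R) n := (b - a) / (n%:R + 3).

Let eN (a b : R) m n : a < b -> (m <= n)%N -> e a b n <= e a b m.
Proof.
move=> ab mn; rewrite /e ler_pM2l ?subr_gt0//.
have ? : 0 <= m%:R :> R by [].
have ? : m%:R <= n%:R :> R by rewrite ler_nat.
rewrite lef_pV2 ?posrE//; lra.
Qed.

Let bigcup_cc (a b : R) : a < b ->
  \bigcup_n `[a + e a b n, b - e a b n]%classic = `]a, b[%classic.
Proof.
move=> ab; apply/seteqP; split => [x [n _]|x]/=; rewrite !in_itv/=.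
  have := cvpt n ab; rewrite -/(e a b n); lra.
move=> /andP[ax xb].
set d := Num.min (x - a) (b - x).
have d0 : 0 < d by rewrite /d lt_min !subr_gt0 ax.
pose n := Num.truncn ((b - a) / d).
exists n => //=; rewrite in_itv/=.
have : e a b n <= d.
  rewrite /e ler_pdivrMr; last by have : 0 <= n%:R :> R by []; lra.
  rewrite mulrC -ler_pdivrMr//.
  have := real_truncnS_gt (num_real ((b-a)/d)).
  rewrite -/n -natr1; lra.
rewrite /d le_min; lra.
Qed.

Let e_cvg (a b : R) : a < b -> e a b n @[n --> \oo] --> 0.
Proof.
move=> ab; rewrite -(mulr0 (b - a)); apply: cvgM; first exact: cvg_cst.
apply/gtr0_cvgV0; first by apply: nearW => n; have : 0 <= n%:R :> R by []; lra.
apply/cvgryPge => A; have /cvgryPge /(_ A) := @cvgr_idn R.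
by apply: filterS => n /= An; lra.
Qed.

(** Only the open interval carries the derivative: in the substitutions below [F'] blows
    up or vanishes at an end of the interval. *)
Definition smooth_change (a b : R) := [/\ {within `[a, b], continuous F},
 (forall x, x \in `]a, b[ -> is_derive x (1:R) F (F' x)),
 (forall x, x \in `]a, b[ -> 0 < F' x) &
 (forall x, x \in `]a, b[ -> {for x, continuous F'})].

Lemma smooth_change_sub (a b c d : R) : a <= c -> d <= b -> smooth_change a b ->
  smooth_change c d.
Proof.
move=> ac db [cF dF F'0 cF'].
have sub z : z \in `]c, d[ -> z \in `]a, b[ by rewrite !in_itv/=; lra.
split=> [|z /sub|z /sub|z /sub]; [|exact: dF|exact: F'0|exact: cF'].
by apply: continuous_subspaceW cF; apply: subset_itv; rewrite bnd_simp.
Qed.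

Lemma smooth_change_lt (x y : R) : smooth_change x y -> x < y -> F x < F y.
Proof.
move=> [cF dF F'0 _] xy.
have [c cxy FE] := @MVT _ F F' x y xy dF cF.
by rewrite -subr_gt0 FE mulr_gt0 ?F'0// subr_gt0.
Qed.

(** The fundamental theorem of calculus on closed intervals that exhaust the open one;
    positivity of [F'] lets the integrals converge monotonically, even if [F'] is
    unbounded at the ends. *)
Lemma integral_derivative_oo (a b : R) : a <= b -> smooth_change a b ->
  (\int[leb]_(x in `]a, b[) (F' x)%:E = (F b - F a)%:E)%E.
Proof.
rewrite le_eqVlt => /predU1P[<- _|ab [cF dF F'0 cF']].
  by rewrite set_itvoo0 integral_set0 subrr.
have sub n z : z \in `[a + e a b n, b - e a b n] -> z \in `]a, b[.
  by have := cvpt n ab; rewrite -/(e a b n) !in_itv/=; lra.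
have mF' : measurable_fun `]a, b[ F'.
  apply: open_continuous_measurable_fun => //.
  by move=> x /set_mem; exact: cF'.
have [_ Fa Fb] := (continuous_within_itvP F ab).1 cF.
have H1 : (\int[leb]_(x in `[(a + e a b n)%R, (b - e a b n)%R]) (F' x)%:E @[n --> \oo] -->
   \int[leb]_(x in `]a, b[) (F' x)%:E)%E.
  rewrite -[X in (_ --> \int[_]_(x in X) _)%E](bigcup_cc ab).
  apply: ge0_nondecreasing_set_cvg_integral => //.
  - move=> m n mn; apply/subsetPset; apply: subset_itv; rewrite bnd_simp.
      by rewrite lerD2l eN.
    by rewrite lerD2l lerN2 eN.
  - move=> n; apply/measurable_EFinP; apply: measurable_funS mF' => //.
    by move=> x/= /sub.
  - by move=> n x /sub /F'0 /ltW; rewrite lee_fin.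
have H2 : ((F (b - e a b n) - F (a + e a b n))%:E @[n --> \oo] --> (F b - F a)%:E)%E.
  apply: cvg_EFin; first exact: nearW.
  apply: cvgB.
  - apply: ((cvg_at_leftP _ _ _).1 Fb); split.
      by move=> n; have := cvpt n ab; rewrite -/(e a b n); lra.
    by rewrite -[X in _ --> X]subr0; apply: cvgB; [exact: cvg_cst|exact: e_cvg].
  - apply: ((cvg_at_rightP _ _ _).1 Fa); split.
      by move=> n; have := cvpt n ab; rewrite -/(e a b n); lra.
    by rewrite -[X in _ --> X]addr0; apply: cvgD; [exact: cvg_cst|exact: e_cvg].
have E n : (\int[leb]_(x in `[(a + e a b n)%R, (b - e a b n)%R]) (F' x)%:E =
    (F (b - e a b n) - F (a + e a b n))%:E)%E.
  have lt : a + e a b n < b - e a b n.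
    by have := cvpt n ab; rewrite -/(e a b n); lra.
  rewrite (continuous_FTC2 (F := F) lt)//.
  - apply: continuous_in_subspaceT => x /set_mem /sub; exact: cF'.
  - have cFx z : z \in `[a + e a b n, b - e a b n] -> {for z, continuous F}.
      move=> /sub/dF zd; apply/differentiable_continuous/derivable1_diffP; exact: ex_derive.
    split => [x /subset_itv_oo_cc/sub/dF xd||].
    + exact: ex_derive.
    + by apply: cvg_at_right_filter; apply: cFx; rewrite in_itv/= lexx ltW.
    + by apply: cvg_at_left_filter; apply: cFx; rewrite in_itv/= lexx ltW.
  - move=> x /subset_itv_oo_cc/sub/dF xd; rewrite derive1E; exact: derive_val.
rewrite -(funext E) in H2.
by rewrite -(cvg_lim _ H1)// (cvg_lim _ H2).
Qed.

(** Lebesgue measure on [F a, F b] and the image under [F] of the measure of density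
    [F'] coincide on half-lines, where this is the fundamental theorem of calculus, hence
    on Borel sets.  So [G] may be any nonnegative Borel function, such as the singular
    kernels met below. *)
Lemma integral_change_of_variables (a b : R) (G : R -> \bar R) :
  a < b -> smooth_change a b -> measurable_fun [set: R] F ->
  (forall y, 0 <= G y)%E -> measurable_fun [set: R] G ->
  (\int[leb]_(y in `]F a, F b[) G y = \int[leb]_(x in `]a, b[) ((F' x)%:E * G (F x)))%E.
Proof.
move=> ab gc mF G0 mG; have [cF dF F'0 cF'] := gc.
have mF' : measurable_fun `]a, b[ F'.
  apply: open_continuous_measurable_fun => //.
  by move=> x /set_mem; exact: cF'.
pose w1 := \1_(`]F a, F b[%classic) : R -> R.
pose w2 := F' \_ `]a, b[%classic.
have w10 x : 0 <= w1 x by [].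
have w20 x : 0 <= w2 x.
  by rewrite /w2 patchE; case: ifPn => // /set_mem/F'0/ltW.
have mw1 : measurable_fun [set: R] w1 by exact: measurable_indic.
have mw2 : measurable_fun [set: R] w2 by apply/(measurable_restrictT F').
have mid : measurable_fun [set: R] (@id R) by exact: measurable_id.
pose m1 : {measure set R -> \bar R} := weighted_image leb w10 mw1 mid.
pose m2 : {measure set R -> \bar R} := weighted_image leb w20 mw2 mF.
have m1E (A : set R) : measurable A -> m1 A = leb (A `&` `]F a, F b[).
  move=> mA; rewrite /m1 /weighted_image.
  transitivity (\int[leb]_x (\1_(A `&` `]F a, F b[) x)%:E)%E.
    by apply: eq_integral => x _; rewrite -EFinM indicI/= mulrC.
  by rewrite integral_indic// ?setIT//; exact: measurableI.
have m2E (A : set R) : m2 A =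
    (\int[leb]_(x in `]a, b[ `&` F @^-1` A) (F' x)%:E)%E.
  rewrite [RHS]integral_mkcondr [RHS]integral_mkcond /m2 /weighted_image.
  apply: eq_integral => x _; rewrite /w2 !patchE.
  case: ifPn => xab; last by rewrite mul0e.
  have -> : (x \in F @^-1` A) = (F x \in A) by apply/idP/idP; rewrite !inE.
  by rewrite indicE; case: (_ \in A); rewrite ?mule1 ?mule0.
have m12 A : measurable A -> m1 A = m2 A.
  apply: (measure_unique (@RGenInftyO.G R) (fun n => `]-oo, n%:R[%classic) _ _ _ _ m1 m2).
  - exact: RGenInftyO.measurableE.
  - move=> _ _ [x ->] [y ->]; exists (Num.min x y).
    by apply/seteqP; split => z/=; rewrite !in_itv/= lt_min => /andP.
  - by move=> i; exists i%:R.
  - apply/seteqP; split => // x _.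
    exists (Num.truncn x).+1 => //=; rewrite in_itv/=.
    exact: real_truncnS_gt (num_real x).
  - move=> _ [c ->].
    have [x0 /andP[ax0 x0b] H] : exists2 x0, a <= x0 <= b &
       `]-oo, c[%classic `&` `]F a, F b[ = `]F a, F x0[%classic /\
       `]a, b[%classic `&` F @^-1` `]-oo, c[%classic = `]a, x0[%classic.
      have [cFa|Fac] := leP c (F a).
        exists a; first by rewrite lexx ltW.
        rewrite !set_itvoo0; split; apply/seteqP; split => // x/=.
          by rewrite !in_itv/=; lra.
        rewrite !in_itv/= => -[/andP[ax xb] Fxc].
        have := smooth_change_lt (smooth_change_sub (lexx a) (ltW xb) gc) ax; lra.
      have [Fbc|cFb] := leP (F b) c.
        exists b; first by rewrite lexx ltW.
        split; apply/seteqP; split => x/=; rewrite !in_itv/=; try lra.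
        move=> /andP[ax xb].
        have := smooth_change_lt (smooth_change_sub (ltW ax) (lexx b) gc) xb; lra.
      have cE : Num.min (F a) (F b) <= c <= Num.max (F a) (F b).
        by rewrite minEle maxEle (ltW (lt_trans Fac cFb)) !ltW.
      have [x0] := IVT (ltW ab) cF cE.
      rewrite in_itv/= => /andP[ax0 x0b] Fx0.
      exists x0; first by rewrite ax0.
      split; apply/seteqP; split => x/=; rewrite !in_itv/= -?Fx0.
      + lra.
      + have := cFb; rewrite -Fx0; lra.
      + move=> [/andP[ax xb] Fxc]; rewrite ax/= ltNge; apply/negP.
        rewrite le_eqVlt => /predU1P[xx0|x0x]; first by rewrite xx0 ltxx in Fxc.
        have := smooth_change_lt (smooth_change_sub ax0 (ltW xb) gc) x0x; lra.
      + move=> /andP[ax xx0].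
        have := smooth_change_lt (smooth_change_sub (ltW ax) x0b gc) xx0; lra.
    rewrite m1E// m2E H.1 H.2 integral_derivative_oo//; last exact: smooth_change_sub gc.
    rewrite lebesgue_measure_itv/= lte_fin; case: ltP => //= Fx0.
    suff -> : x0 = a by rewrite subrr.
    apply/eqP; rewrite eq_le ax0 andbT leNgt; apply/negP => ax0'.
    have := smooth_change_lt (smooth_change_sub (lexx a) x0b gc) ax0'; lra.
  - move=> k; rewrite m1E//.
    rewrite (@le_lt_trans _ _ (leb `]F a, F b[))//.
      by apply: le_measure => //; rewrite inE//; exact: measurableI.
    by rewrite lebesgue_measure_itv/=; case: ifP => _; rewrite ltry.
transitivity (\int[m1]_x G x)%E.
  rewrite integral_weighted_image// [LHS]integral_mkcond.
  apply: eq_integral => x _; rewrite patchE /w1 indicE.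
  by case: ifPn => ?; rewrite ?mul1e ?mul0e.
rewrite (eq_measure_integral m2); last by move=> A mA _; exact: m12.
rewrite integral_weighted_image// [RHS]integral_mkcond.
apply: eq_integral => x _; rewrite patchE /w2 patchE.
by case: ifPn => ?; rewrite ?mul0e.
Qed.
End change_of_variables.

Section reflection.
Context (R : realType).
Local Notation leb := (@lebesgue_measure R).
Local Open Scope ereal_scope.

Lemma integral_oppr (f : R -> \bar R) : measurable_fun [set: R] f ->
  (forall r, 0 <= f r) -> \int[leb]_x f (- x)%R = \int[leb]_x f x.
Proof.
move=> mf f0.
transitivity (\int[leb]_(x in (-%R : _ -> measurableTypeR R) @^-1` setT) f (- x)%R).
  by rewrite preimage_setT.
rewrite -ge0_integral_pushforward//=.
by apply: eq_measure_integral => //= A mA _; exact: lebesgue_measureN.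
Qed.

Lemma integral_translate (a b c : R) (G : R -> \bar R) : (a < b)%R ->
  measurable_fun [set: R] G ->
  (forall r, 0 <= G r) ->
  \int[leb]_(x in `]a, b[) G (x + c)%R = \int[leb]_(x in `](a + c)%R, (b + c)%R[) G x.
Proof.
move=> ab mG G0.
rewrite (@integral_change_of_variables R (fun x => x + c)%R (cst 1%R) a b G)//.
- by apply: eq_integral => x _; rewrite mul1e.
- split=> //.
  + apply: continuous_subspaceT => x; apply: cvgD; [exact: cvg_id|exact: cvg_cst].
  + by move=> x _; apply: is_derive_eq; rewrite addr0.
  + by move=> x _; exact: cvg_cst.
- exact: measurable_funD.
Qed.
Lemma integral_reflect (a b c : R) (G : R -> \bar R) : measurable_fun [set: R] G ->
  (forall r, 0 <= G r) ->
  \int[leb]_(x in `]a, b[) G (c - x)%R = \int[leb]_(x in `](c - b)%R, (c - a)%R[) G x.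
Proof.
move=> mG G0; have [ba|ab] := leP b a.
  by rewrite !set_itv_ge ?integral_set0// bnd_simp -leNgt// lerD2l lerN2.
pose D : set R := `](- b)%R, (- a)%R[%classic.
pose g (x : R) : \bar R := G (x + c)%R.
pose f : R -> \bar R := g \_ D.
have mf : measurable_fun [set: R] f.
  apply: (measurable_restrictT g _).1; first exact: measurable_itv.
  have mc : measurable_fun [set: R] (fun x : R => x + c)%R by exact: measurable_funD.
  by apply: measurable_funTS; exact: (measurableT_comp mG mc).
transitivity (\int[leb]_x f (- x)%R).
  rewrite integral_mkcond; apply: eq_integral => x _.
  rewrite /f /g /D !patchE !mem_setE !in_itv/= !ltrN2 andbC [(- x + c)%R]addrC.
  by case: ifP.
rewrite integral_oppr//; last first.
  by move=> r; rewrite /f patchE; case: ifP => _; [exact: G0|].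
rewrite /f -integral_mkcond integral_translate ?ltrN2//.
by rewrite ![(- _ + c)%R]addrC.
Qed.

End reflection.

(** * Reciprocal square roots and the Abel kernel *)

Section rsqrt.
Context (R : realType).
Implicit Types x y : R.

(** Zero on the negative half-line: the Abel integrals can be taken over the whole line,
    and [rsqrt_eq0] recovers their bounds. *)
Definition rsqrt (x : R) : R := (Num.sqrt x)^-1.

Lemma rsqrt_ge0 x : 0 <= rsqrt x. Proof. by rewrite /rsqrt invr_ge0 sqrtr_ge0. Qed.
Lemma rsqrt_gt0 x : 0 < x -> 0 < rsqrt x. Proof. by move=> x0; rewrite /rsqrt invr_gt0 sqrtr_gt0. Qed.
Lemma rsqrt_eq0 x : x <= 0 -> rsqrt x = 0. Proof. by move=> x0; rewrite /rsqrt ler0_sqrtr// invr0. Qed.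
Lemma rsqrtM x y : 0 <= x -> rsqrt (x * y) = rsqrt x * rsqrt y.
Proof. by move=> x0; rewrite /rsqrt sqrtrM// invfM. Qed.
Lemma rsqrt_sqr x : 0 <= x -> rsqrt (x ^+ 2) = x^-1.
Proof. by move=> x0; rewrite /rsqrt sqrtr_sqr ger0_norm. Qed.
Lemma rsqrt_continuous x : 0 < x -> {for x, continuous rsqrt}.
Proof.
move=> x0; apply: cvgV; first by rewrite gt_eqF ?sqrtr_gt0.
exact: sqrt_continuous.
Qed.
Lemma measurable_rsqrt : measurable_fun [set: R] rsqrt.
Proof.
have -> : rsqrt = rsqrt \_ `]0, +oo[%classic.
  apply/funext => x; rewrite patchE; case: ifPn => // x0; rewrite rsqrt_eq0//.
  move: x0; rewrite notin_setE/= in_itv/= andbT; lra.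
apply/(measurable_restrictT rsqrt) => //.
apply: open_continuous_measurable_fun; first exact: interval_open.
by move=> x /set_mem/=; rewrite in_itv/= andbT; exact: rsqrt_continuous.
Qed.

(** Derives measurability of the inverse, and then of the square root, from that of [rsqrt]. *)
Lemma invE_rsqrt x : x^-1 = x * (rsqrt (x ^+ 2) * rsqrt (x ^+ 2)).
Proof.
have [->|x0] := eqVneq x 0; first by rewrite invr0 mul0r.
by rewrite /rsqrt sqrtr_sqr -invfM -expr2 -normrX ger0_norm ?sqr_ge0//; field.
Qed.

Context d (T : measurableType d) (D : set T).
Implicit Types f g : T -> R.

Lemma measurable_fun_rsqrt f : measurable_fun D f -> measurable_fun D (fun t => rsqrt (f t)).
Proof. by move=> mf; exact: (measurableT_comp measurable_rsqrt mf). Qed.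

Lemma measurable_fun_inv f : measurable_fun D f -> measurable_fun D (fun t => (f t)^-1).
Proof.
move=> mf; under eq_fun do rewrite invE_rsqrt.
by apply: measurable_funM => //; apply: measurable_funM; apply: measurable_fun_rsqrt; exact: measurable_funX.
Qed.

Lemma measurable_fun_sqrt f : measurable_fun D f -> measurable_fun D (fun t => Num.sqrt (f t)).
Proof.
move=> mf; rewrite (_ : (fun t => _) = fun t => (rsqrt (f t))^-1); last by apply/funext => t; rewrite /rsqrt invrK.
by apply: measurable_fun_inv; exact: measurable_fun_rsqrt.
Qed.
End rsqrt.

Section abel.
Context (R : realType).
Local Notation leb := (@lebesgue_measure R).
Implicit Types x y a b t : R.

Lemma cos_gt0_pi2 t : t \in `]0, pi / 2[ -> 0 < cos t.
Proof. by rewrite in_itv/= => t0; apply: cos_gt0_pihalf; lra. Qed.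
Lemma sin_gt0_pi2 t : t \in `]0, pi / 2[ -> 0 < sin t.
Proof. rewrite in_itv/= => t0; apply: sin_gt0_pi; have := @pi_gt0 R; lra. Qed.

Lemma continuous_measurable (f : R -> R) : continuous f -> measurable_fun [set: R] f.
Proof. exact: continuous_measurable_fun. Qed.

Lemma measurable_cos : measurable_fun [set: R] (@cos R).
Proof. by apply: continuous_measurable; exact: continuous_cos. Qed.

Lemma measurable_sin : measurable_fun [set: R] (@sin R).
Proof. by apply: continuous_measurable; exact: continuous_sin. Qed.

Lemma is_derive_continuous (f : R -> R) x d :
  is_derive x (1:R) f d -> {for x, continuous f}.
Proof.
by move=> dx; apply/differentiable_continuous/derivable1_diffP; exact: (@ex_derive _ _ _ _ _ _ _ dx).
Qed.

Lemma smooth_changeT (F F' : R -> R) a b :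
  (forall x, is_derive x (1:R) F (F' x)) ->
  (forall x, x \in `]a, b[ -> 0 < F' x) -> continuous F' ->
  smooth_change F F' a b.
Proof.
move=> dF F'0 cF'; split => //.
  apply: continuous_subspaceT => x.
  exact: is_derive_continuous (dF x).
by move=> x _; exact: cF'.
Qed.

Let cs1 t : cos t ^+ 2 = 1 - sin t ^+ 2 :> R.
Proof. by rewrite cos2sin2. Qed.

Lemma convex_pos p r t : 0 < p -> 0 < r -> 0 < p * cos t ^+ 2 + r * sin t ^+ 2.
Proof.
move=> p0 r0; have := cos2Dsin2 t; have := sqr_ge0 (sin t); have := sqr_ge0 (cos t).
move: (cos t ^+ 2) (sin t ^+ 2) => C S C0 S0 CS.
have [C1|C1] := leP (1/2) C.
  have : 0 < p * C by apply: mulr_gt0 => //; lra.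
  have : 0 <= r * S by apply: mulr_ge0 => //; lra.
  lra.
have : 0 <= p * C by apply: mulr_ge0 => //; lra.
have : 0 < r * S by apply: mulr_gt0 => //; lra.
lra.
Qed.

(** A primitive is [atan ((r / p) tan t)]; its form [A] is smooth at [pi / 2] as well. *)
Lemma integral_trig p r : 0 < p -> 0 < r ->
  (\int[leb]_(t in `]0%R, (pi / 2)%R[)
    ((p * r) / (p ^+ 2 * cos t ^+ 2 + r ^+ 2 * sin t ^+ 2))%:E = (pi / 2)%:E)%E.
Proof.
move=> p0 r0.
have pos1 t := convex_pos t p0 r0.
have pos2 t : 0 < p ^+ 2 * cos t ^+ 2 + r ^+ 2 * sin t ^+ 2.
  by apply: convex_pos; rewrite exprn_gt0.
pose A t := t + atan ((r - p) * sin t * cos t / (p * cos t ^+ 2 + r * sin t ^+ 2)).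
rewrite (@integral_derivative_oo R A); last first.
- apply: smooth_changeT.
  + move=> x; have H := lt0r_neq0 (pos1 x); have H2 := lt0r_neq0 (pos2 x).
    apply: is_derive_eq; rewrite /GRing.scale/=.
    have := cs1 x; move: H H2; set c := cos x; set s := sin x => H H2 cs.
    have H3 : 1 + ((r - p) * s * c / (p * c ^+ 2 + r * s ^+ 2)) ^+ 2 = (p ^+ 2 * c ^+ 2 +
      r ^+ 2 * s ^+ 2) / (p * c ^+ 2 + r * s ^+ 2) ^+ 2.
      field : cs => //.
    rewrite H3; by field : cs; rewrite !exprMn H2 H.
  + move=> x _; apply: divr_gt0; rewrite ?pos2//; exact: mulr_gt0.
  + move=> x; have H2 := lt0r_neq0 (pos2 x); apply: is_derive_continuous.
- by have := @pi_gt0 R; lra.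
rewrite /A sin0 cos_pihalf !mulr0 !mul0r atan0; congr EFin; lra.
Qed.

Lemma integral_supp (a b : R) (f : R -> \bar R) :
  (forall x, x <= a \/ b <= x -> f x = 0%E) ->
  (\int[leb]_x f x = \int[leb]_(x in `]a, b[) f x)%E.
Proof.
move=> f0; rewrite [RHS]integral_mkcond; apply: eq_integral => x _.
rewrite patchE; case: ifPn => //; rewrite notin_setE/= in_itv/= => h.
by apply: f0; case: (ltP a x) h => ax; [case: (ltP x b) => ? ?//; right|left].
Qed.

Lemma rsqrt_sqrM x y : 0 < x -> 0 < y -> rsqrt (x * y ^+ 2) = rsqrt x / y.
Proof. by move=> x0 y0; rewrite rsqrtM ?ltW// rsqrt_sqr ?ltW. Qed.

Lemma rsqrt_rsqrt x : 0 <= x -> rsqrt x * rsqrt x = x^-1.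
Proof. by move=> x0; rewrite /rsqrt -invfM -expr2 sqr_sqrtr. Qed.

(** The substitution [w = x + (y - x) sin^2 t] clears the square roots and leaves the
    integral [integral_trig]. *)
Lemma abel_kernel_integral A B x y : x < y -> 0 < A + B * x -> 0 < A + B * y ->
  (\int[leb]_w (rsqrt (y - w) * rsqrt (w - x) / (A + B * w))%:E =
   (pi * rsqrt (A + B * x) * rsqrt (A + B * y))%:E)%E.
Proof.
move=> xy Dx Dy.
pose G w := (rsqrt (y - w) * rsqrt (w - x) / (A + B * w))%:E.
have Dw w : x < w < y -> 0 < A + B * w.
  move=> /andP[xw wy].
  have -> : A + B * w = ((A + B * x) * (y - w) + (A + B * y) * (w - x)) / (y - x).
    by field; lra.
  by apply: divr_gt0; [apply: addr_gt0; apply: mulr_gt0|]; lra.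
have Gout w : w <= x \/ y <= w -> G w = 0%E.
  rewrite /G => -[h|h]; first by rewrite (@rsqrt_eq0 _ (w - x)) ?mulr0 ?mul0r//; lra.
  by rewrite (@rsqrt_eq0 _ (y - w)) ?mul0r//; lra.
have G0 w : (0 <= G w)%E.
  have [h|xw] := leP w x; first by rewrite Gout//; left.
  have [h|wy] := leP y w; first by rewrite Gout//; right.
  by rewrite lee_fin !mulr_ge0 ?rsqrt_ge0// invr_ge0 ltW// Dw// xw.
have mG : measurable_fun [set: R] G.
  apply/measurable_EFinP.
  apply: measurable_funM; first apply: measurable_funM; try apply: measurable_fun_rsqrt;
    try apply: measurable_fun_inv.
  - exact: measurable_funB.
  - exact: measurable_funB.
  - by apply: measurable_funD => //; exact: measurable_funM.
rewrite (integral_supp Gout).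
pose F t := x + (y - x) * sin t ^+ 2.
pose F' t := 2 * (y - x) * sin t * cos t.
have dF t : is_derive t (1:R) F (F' t).
  by apply: is_derive_eq; rewrite /GRing.scale/= /F'; ring.
have F0 : F 0 = x by rewrite /F sin0 expr0n/= mulr0 addr0.
have F1 : F (pi / 2) = y by rewrite /F sin_pihalf expr1n mulr1 addrC subrK.
rewrite -{1}F0 -{1}F1 (@integral_change_of_variables R F F'); last 5 first.
- by have := @pi_gt0 R; lra.
- apply: smooth_changeT => //.
    by move=> t t0; rewrite /F' !mulr_gt0 ?subr_gt0// ?sin_gt0_pi2// cos_gt0_pi2.
  by move=> t; apply: is_derive_continuous.
- by apply: continuous_measurable => t; exact: is_derive_continuous (dF t).
- by [].
- by [].
set p := Num.sqrt (A + B * x); set r := Num.sqrt (A + B * y).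
have p0 : 0 < p by rewrite sqrtr_gt0.
have r0 : 0 < r by rewrite sqrtr_gt0.
transitivity (\int[leb]_(t in `]0%R, (pi / 2)%R[) ((2 / (p * r))%:E *
    ((p * r) / (p ^+ 2 * cos t ^+ 2 + r ^+ 2 * sin t ^+ 2))%:E))%E.
  apply: eq_integral => t /set_mem/= t0; rewrite /G -!EFinM; congr EFin.
  have c0 := cos_gt0_pi2 t0; have s0 := sin_gt0_pi2 t0.
  have -> : rsqrt (y - F t) * rsqrt (F t - x) = (y - x)^-1 / (cos t * sin t).
    have -> : y - F t = (y - x) * cos t ^+ 2 by rewrite /F cs1; ring.
    have -> : F t - x = (y - x) * sin t ^+ 2 by rewrite /F; ring.
    by rewrite !rsqrt_sqrM ?subr_gt0// mulrACA rsqrt_rsqrt ?subr_ge0 ?ltW// invfM.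
  have -> : A + B * F t = p ^+ 2 * cos t ^+ 2 + r ^+ 2 * sin t ^+ 2.
    rewrite !sqr_sqrtr ?ltW// /F; have := cs1 t; nra.
  have H := lt0r_neq0 (convex_pos t (exprn_gt0 2 p0) (exprn_gt0 2 r0)).
  rewrite /F'; field; rewrite -!exprMn in H *.
  by rewrite H !lt0r_neq0 ?subr_gt0.
rewrite ge0_integralZl_EFin//=.
- rewrite integral_trig// -EFinM; congr EFin; rewrite /rsqrt -/p -/r; field.
  by rewrite !lt0r_neq0.
- move=> t _; rewrite lee_fin divr_ge0 ?mulr_ge0 ?ltW//.
  exact (convex_pos t (exprn_gt0 2 p0) (exprn_gt0 2 r0)).
- apply/measurable_EFinP; apply: measurable_funTS; apply: continuous_measurable => t.
  have H := lt0r_neq0 (convex_pos t (exprn_gt0 2 p0) (exprn_gt0 2 r0)).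
  by apply: is_derive_continuous.
- by rewrite divr_ge0 ?mulr_ge0 ?ltW.
Qed.
End abel.

(** * The potential of a circle *)

Section circle_average.
Context (R : realType).
Local Notation leb := (@lebesgue_measure R).
Implicit Types x y a b t : R.

Lemma integral_split_oo (a b c : R) (f : R -> \bar R) : a <= b -> b <= c ->
  (forall x, 0 <= f x)%E -> measurable_fun [set: R] f ->
  (\int[leb]_(x in `]a, c[) f x =
   \int[leb]_(x in `]a, b[) f x + \int[leb]_(x in `]b, c[) f x)%E.
Proof.
rewrite le_eqVlt => /predU1P[<- _ _ _|ab]; first by rewrite set_itvoo0 integral_set0 add0e.
rewrite le_eqVlt => /predU1P[<- _ _|bc f0 mf]; first by rewrite set_itvoo0 integral_set0 adde0.
rewrite [X in (_ = _ + X)%E]integral_itv_obnd_cbnd; last exact: measurable_funTS.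
rewrite -ge0_integral_setU//=.
- by rewrite -itv_bndbnd_setU ?bnd_simp ?ltW.
- exact: measurable_funTS.
- apply/disj_setPS => x [] /=; rewrite !in_itv/=; lra.
Qed.

Lemma mule2E (x : \bar R) : (2%:E * x = x + x)%E.
Proof. by rewrite -mule2n muleC -mule_natl muleC. Qed.

Lemma integral_cos_periodic (h : R -> \bar R) t : 0 <= t <= 2 * pi ->
  (forall x, 0 <= h x)%E -> measurable_fun [set: R] h ->
  (\int[leb]_(x in `]0%R, (2 * pi)%R[) h (cos (x - t)) =
   2%:E * \int[leb]_(x in `]0%R, pi[) h (cos x))%E.
Proof.
move=> /andP[t0 t2] h0 mh.
have pi0 := @pi_gt0 R.
have mcos := @measurable_cos R.
have mhc : measurable_fun [set: R] (h \o cos) by exact: measurableT_comp.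
have msub : measurable_fun [set: R] (fun x : R => x - t) by exact: measurable_funB.
have cos2 x : cos (2 * pi - x) = cos x.
  by rewrite mulr_natl -[RHS]cosN addrC cosD2pi.
have reflect2 a b : (\int[leb]_(x in `]a, b[) (h \o cos) x =
    \int[leb]_(x in `](2 * pi - b)%R, (2 * pi - a)%R[) (h \o cos) x)%E.
  rewrite -integral_reflect//; last by move=> r; exact: h0.
  by apply: eq_integral => x _; rewrite /= cos2.
have -> : (\int[leb]_(x in `]0%R, (2 * pi)%R[) h (cos (x - t)) =
   \int[leb]_(x in `]0%R, (2 * pi)%R[) (h \o cos) x)%E.
  rewrite !(@integral_split_oo 0 t (2 * pi))//; last first.
    exact: (measurableT_comp mhc msub).
    by move=> x; exact: h0.
  congr (_ + _)%E.
    have := @integral_reflect R 0 t t (h \o cos) mhc (fun r => h0 _).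
    rewrite subrr subr0 => <-; apply: eq_integral => x _.
    by rewrite /= -cosN opprB.
  have [->|t2'] := eqVneq t (2 * pi); first by rewrite set_itvoo0 !integral_set0.
  have lt2 : t < 2 * pi by rewrite lt_neqAle t2'.
  rewrite (@integral_translate R t (2 * pi) (- t) (h \o cos))//; last first.
    by move=> r; exact: h0.
  by rewrite subrr [LHS]reflect2 subr0 opprB addrCA subrr addr0.
rewrite (@integral_split_oo 0 pi (2 * pi))//; last 3 first.
- by rewrite ltW.
- by lra.
- by move=> x; exact: h0.
rewrite [X in (_ + X)%E]reflect2 subrr (_ : 2 * pi - pi = pi); last by ring.
by rewrite mule2E.
Qed.

Lemma integral_sin_fold (h : R -> \bar R) :
  (forall x, 0 <= h x)%E -> measurable_fun [set: R] h ->
  (\int[leb]_(x in `]0%R, pi[) h (sin x) =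
   2%:E * \int[leb]_(x in `]0%R, (pi / 2)%R[) h (cos x))%E.
Proof.
move=> h0 mh; have pi0 := @pi_gt0 R.
have mcos := @measurable_cos R.
have msin := @measurable_sin R.
have mhc : measurable_fun [set: R] (h \o cos) by exact: measurableT_comp.
have mhs : measurable_fun [set: R] (h \o sin) by exact: measurableT_comp.
rewrite (@integral_split_oo 0 (pi / 2) pi (h \o sin))//; last 3 first.
- by lra.
- by lra.
- by move=> x; exact: h0.
rewrite mule2E; congr (_ + _)%E.
  have := @integral_reflect R 0 (pi / 2) (pi / 2) (h \o cos) mhc (fun r => h0 _).
  rewrite subrr subr0 => <-; apply: eq_integral => x _.
  by rewrite /= -cosN opprB cosBpihalf.
have := @integral_translate R 0 (pi / 2) (pi / 2) (h \o sin) _ mhs (fun r => h0 _).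
rewrite add0r -splitr => <-; last by lra.
by apply: eq_integral => x _; rewrite /= sinDpihalf.
Qed.

Lemma asin0 : asin 0 = 0 :> R.
Proof.
by rewrite -[X in asin X]sin0 sinK// in_itv/=; have := @pi_gt0 R; lra.
Qed.

(** With [k = p / P], the substitution [x = t - asin (k sin t)] makes the distance
    [P (q t - k cos t)], where [q t = sqrt (1 - k^2 sin^2 t)]: in a triangle with sides
    [P] and [p] it expresses the angle between them by an exterior angle.
    The derivative of the substitution is [(q t - k cos t) / q t], so that the distance
    cancels and [1 / (P q t)] remains. *)
Lemma integral_law_of_cosines P p : 0 <= p -> p < P ->
  (\int[leb]_(x in `]0%R, pi[) (rsqrt (P ^+ 2 + p ^+ 2 - 2 * P * p * cos x))%:E =
   \int[leb]_(x in `]0%R, pi[) (rsqrt (P ^+ 2 - p ^+ 2 * sin x ^+ 2))%:E)%E.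
Proof.
move=> p0 pP; have P0 : 0 < P by lra.
have pi0 := @pi_gt0 R.
pose k := p / P.
have pE : p = k * P by rewrite /k divfK// gt_eqF.
have k0 : 0 <= k by rewrite divr_ge0// ltW.
have k1 : k < 1 by rewrite ltr_pdivrMr// mul1r.
clearbody k.
have cs2 x := cos2Dsin2 x.
have k2s x : (k * sin x) ^+ 2 < 1.
  rewrite exprMn; have := cs2 x; have := sqr_ge0 (sin x); have := sqr_ge0 (cos x).
  move: (cos x ^+ 2) (sin x ^+ 2) => C S ? ? ?; nra.
have ks x : -1 < k * sin x < 1.
  have := k2s x; move: (k * sin x) => z z2; nra.
pose q x := Num.sqrt (1 - (k * sin x) ^+ 2).
have q0 x : 0 < q x by rewrite sqrtr_gt0 subr_gt0.
have q2 x : q x ^+ 2 = 1 - (k * sin x) ^+ 2 by rewrite sqr_sqrtr// subr_ge0 ltW.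
have kcq x : k * cos x < q x.
  have : (k * cos x) ^+ 2 < q x ^+ 2.
    rewrite q2 !exprMn; have := cs2 x; move: (cos x ^+ 2) (sin x ^+ 2) => C S CS.
    have : k ^+ 2 * C + k ^+ 2 * S < 1 by rewrite -mulrDr CS mulr1 expr_lt1.
    lra.
  have := q0 x; move: (q x) (k * cos x) => a b a0 ab.
  rewrite ltNge; apply/negP => ba.
  have : a ^+ 2 <= b ^+ 2 by rewrite lerXn2r ?nnegrE; lra.
  lra.
pose F x := x - asin (k * sin x).
pose F' x := 1 - (k * cos x) / q x.
have dq x : is_derive x (1:R) q (- (2 * (k * sin x) * (k * cos x)) / (2 * q x)).
  have H : 0 < 1 - (k * sin x) ^+ 2 by rewrite subr_gt0.
  have H2 := is_derive1_sqrt H.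
  apply: is_derive_eq; rewrite /GRing.scale/= -/(q x).
  by field; rewrite gt_eqF.
have dF x : is_derive x (1:R) F (F' x).
  have H2 := is_derive1_asin (ks x).
  apply: is_derive_eq; rewrite /GRing.scale/= -/(q x) /F'.
  by rewrite mulrC.
have F0 : F 0 = 0 by rewrite /F sin0 mulr0 asin0 subr0.
have Fpi : F pi = pi by rewrite /F sinpi mulr0 asin0 subr0.
pose G x := (rsqrt (P ^+ 2 + p ^+ 2 - 2 * P * p * cos x))%:E.
have mG : measurable_fun [set: R] G.
  apply/measurable_EFinP; apply: measurable_fun_rsqrt; apply: continuous_measurable => x.
  by apply: is_derive_continuous.
rewrite -{1}F0 -{1}Fpi (@integral_change_of_variables R F F' 0 pi G)//; last 3 first.
- apply: smooth_changeT => //.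
  + by move=> x _; rewrite /F' subr_gt0 ltr_pdivrMr// mul1r.
  + move=> x; have H := dq x; have H2 := lt0r_neq0 (q0 x).
    by apply: is_derive_continuous.
- by apply: continuous_measurable => t; exact: is_derive_continuous (dF t).
- by move=> x; rewrite lee_fin rsqrt_ge0.
apply: eq_integral => x _; rewrite /G -EFinM; congr EFin.
have cosF : cos (F x) = cos x * q x + sin x * (k * sin x).
  rewrite /F cosB asinK; last by rewrite in_itv/=; have := ks x; lra.
  by rewrite cos_asin//; have := ks x; lra.
have -> : P ^+ 2 + p ^+ 2 - 2 * P * p * cos (F x) = (P * (q x - k * cos x)) ^+ 2.
  rewrite cosF pE; have := q2 x; have := cs2 x.
  move: (q x) (cos x) (sin x) => Q c s e1 e2.
  have {}e1 : s ^+ 2 = 1 - c ^+ 2 by lra.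
  have {}e2 : Q ^+ 2 = 1 - k ^+ 2 * (1 - c ^+ 2) by rewrite e2 exprMn e1.
  ring : e1 e2.
have -> : P ^+ 2 - p ^+ 2 * sin x ^+ 2 = (P * q x) ^+ 2.
  by rewrite exprMn q2 pE; ring.
have H1 := kcq x; have H2 := q0 x.
rewrite !rsqrt_sqr ?mulr_ge0 ?subr_ge0 ?ltW// /F'; field.
by rewrite !gt_eqF ?subr_gt0.
Qed.

(** The substitution [w = v / (v + (1 - v) cos^2 x)] makes [w - v] and [1 - w] squares up to
    its denominator, and [w - v'] the radicand on the left up to this denominator. *)
Lemma integral_circle_to_abel v v' : 0 <= v' -> v' < v -> v < 1 ->
  (2%:E * \int[leb]_(x in `]0%R, (pi / 2)%R[)
      (rsqrt (v * (1 - v') - v' * (1 - v) * cos x ^+ 2))%:E =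
   \int[leb]_w (rsqrt w * rsqrt (1 - w) * rsqrt (w - v) * rsqrt (w - v'))%:E)%E.
Proof.
move=> v'0 v'v v1; have v0 : 0 < v by lra.
have pi0 := @pi_gt0 R.
have cs2 x := cos2Dsin2 x.
pose E x := v + (1 - v) * cos x ^+ 2.
have E0 x : 0 < E x.
  have := sqr_ge0 (cos x); rewrite /E => ?.
  have : 0 <= (1 - v) * cos x ^+ 2 by apply: mulr_ge0 => //; lra.
  lra.
pose F x := v / E x.
pose F' x := 2 * v * (1 - v) * (sin x * cos x) / E x ^+ 2.
have dF x : is_derive x (1:R) F (F' x).
  have H := lt0r_neq0 (E0 x); rewrite /E in H.
  apply: is_derive_eq; rewrite /GRing.scale/= /F' /E.
  by field.
pose G w := (rsqrt w * rsqrt (1 - w) * rsqrt (w - v) * rsqrt (w - v'))%:E.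
have mid : measurable_fun [set: R] (@id R) by exact: measurable_id.
have mG : measurable_fun [set: R] G.
  apply/measurable_EFinP; do 3?apply: measurable_funM; apply: measurable_fun_rsqrt => //;
  exact: measurable_funB.
have G0 w : (0 <= G w)%E by rewrite lee_fin !mulr_ge0 ?rsqrt_ge0.
rewrite (@integral_supp R v 1 G); last first.
  move=> w [h|h]; rewrite /G; first by rewrite (@rsqrt_eq0 _ (w - v)) ?mulr0 ?mul0r//; lra.
  by rewrite (@rsqrt_eq0 _ (1 - w)) ?mulr0 ?mul0r//; lra.
have F0 : F 0 = v by rewrite /F /E cos0 expr1n mulr1 addrC subrK divr1.
have F1 : F (pi / 2) = 1 by rewrite /F /E cos_pihalf expr0n/= mulr0 addr0 divff// gt_eqF.
transitivity (\int[leb]_(x in `](F 0%R), (F (pi / 2)%R)[) G x)%E; last by rewrite F0 F1.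
rewrite (@integral_change_of_variables R F F' 0 (pi / 2) G)//; last 3 first.
- by lra.
- apply: smooth_changeT => //.
  + move=> x x0; rewrite /F' divr_gt0 ?exprn_gt0// !mulr_gt0 ?subr_gt0//.
      exact: sin_gt0_pi2.
    exact: cos_gt0_pi2.
  + move=> x; have H : (v + (1 - v) * cos x ^+ 2) ^+ 2 != 0.
      by rewrite expf_neq0// gt_eqF//; exact: E0.
    by apply: is_derive_continuous.
- by apply: continuous_measurable => t; exact: is_derive_continuous (dF t).
rewrite -ge0_integralZl_EFin//; last 2 first.
- by move=> x _; rewrite lee_fin rsqrt_ge0.
- apply/measurable_EFinP; apply: measurable_fun_rsqrt; apply: measurable_funTS.
  by apply: continuous_measurable => x; apply: is_derive_continuous.
apply: eq_integral => x /set_mem/= x0; rewrite /G -!EFinM; congr EFin.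
have c0 := cos_gt0_pi2 x0; have s0 := sin_gt0_pi2 x0; have Ex := E0 x.
set Z := v * (1 - v') - _.
have E1 : 1 - E x = (1 - v) * sin x ^+ 2 by rewrite /E cos2sin2; ring.
have -> : F x - v' = Z / E x by rewrite /F /Z /E; field; rewrite gt_eqF//; exact: Ex.
have -> : F x - v = v * (1 - v) * (sin x ^+ 2 / E x).
  by rewrite /F /E cos2sin2; field; rewrite gt_eqF// -cos2sin2; exact: Ex.
have -> : 1 - F x = (1 - v) * (cos x ^+ 2 / E x).
  by rewrite /F /E; field; rewrite gt_eqF//; exact: Ex.
have Z0 : 0 < Z.
  have : 0 <= v' * (1 - v) * (1 - cos x ^+ 2).
    by rewrite -sin2cos2 mulr_ge0 ?sqr_ge0// mulr_ge0//; lra.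
  rewrite /Z; lra.
rewrite /F [rsqrt (Z / _)]rsqrtM 1?ltW// [rsqrt (v / _)]rsqrtM 1?ltW//.
rewrite [rsqrt (_ * (cos x ^+ 2 / _))]rsqrtM; last by lra.
rewrite [rsqrt (_ * (sin x ^+ 2 / _))]rsqrtM; last by rewrite mulr_ge0; lra.
rewrite [rsqrt (cos x ^+ 2 / _)]rsqrtM ?sqr_ge0// [rsqrt (sin x ^+ 2 / _)]rsqrtM ?sqr_ge0//.
rewrite !rsqrt_sqr ?ltW//  [rsqrt (v * _)]rsqrtM ?ltW//.
transitivity (rsqrt Z * (F' x * (rsqrt v * rsqrt v) * (rsqrt (1 - v) * rsqrt (1 - v)) *
  ((cos x)^-1 * (sin x)^-1) * ((rsqrt (E x)^-1 * rsqrt (E x)^-1) *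
  (rsqrt (E x)^-1 * rsqrt (E x)^-1)))); last by ring.
rewrite !rsqrt_rsqrt ?invr_ge0 ?subr_ge0 ?ltW// invrK /F'; field.
by rewrite !gt_eqF// subr_gt0.
Qed.

(** Copson's formula.  The left side is, up to the radius, the potential of a uniformly
    charged circle of the sphere at a point of the sphere; on the right side the heights
    [v] and [v'] of the circle and the point occur in separate factors. *)
Lemma circle_average (v v' t : R) : 0 <= v < 1 -> 0 <= v' < 1 -> v != v' ->
  0 <= t <= 2 * pi ->
  (\int[leb]_(x in `]0%R, (2 * pi)%R[)
     (rsqrt (4 * (v * (1 - v') + v' * (1 - v)
       - 2 * Num.sqrt (v * (1 - v')) * Num.sqrt (v' * (1 - v)) * cos (x - t))))%:E =
   \int[leb]_w (rsqrt w * rsqrt (1 - w) * rsqrt (w - v) * rsqrt (w - v'))%:E)%E.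
Proof.
wlog vv : v v' / v' < v.
  move=> H v01 v'01; rewrite neq_lt => /orP[vv'|v'v] t2.
    have := H v' v vv' v'01 v01 _ t2; rewrite gt_eqF// => /(_ erefl) {}H.
    transitivity (\int[leb]_w (rsqrt w * rsqrt (1 - w) * rsqrt (w - v') * rsqrt (w - v))%:E)%E; last first.
      by apply: eq_integral => w _; rewrite mulrAC.
    rewrite -H; apply: eq_integral => x _.
    by rewrite [v' * (1 - v) + _]addrC [2 * _ * Num.sqrt (v * _)]mulrAC.
  by apply: H => //; rewrite gt_eqF.
move=> /andP[v0 v1] /andP[v'0 v'1] _ t2.
set P := Num.sqrt (v * (1 - v')); set p := Num.sqrt (v' * (1 - v)).
have P2 : P ^+ 2 = v * (1 - v') by rewrite sqr_sqrtr// mulr_ge0//; lra.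
have p2 : p ^+ 2 = v' * (1 - v) by rewrite sqr_sqrtr// mulr_ge0//; lra.
have p0 : 0 <= p by exact: sqrtr_ge0.
have pP : p < P by rewrite ltr_sqrt; nra.
rewrite -P2 -p2.
pose h (c : R) := (rsqrt (4 * (P ^+ 2 + p ^+ 2 - 2 * P * p * c)))%:E.
have mh : measurable_fun [set: R] h.
  apply/measurable_EFinP; apply: measurable_fun_rsqrt; apply: continuous_measurable => x.
  by apply: is_derive_continuous.
have h0 x : (0 <= h x)%E by rewrite lee_fin rsqrt_ge0.
rewrite (@integral_cos_periodic h)//.
have rs4 x : rsqrt (4 * x) = rsqrt x / 2 :> R.
  rewrite mulrC (_ : 4 = 2 ^+ 2); last by ring.
  have [x0|x0] := leP x 0; first by rewrite !rsqrt_eq0 ?mul0r// pmulr_lle0.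
  by rewrite rsqrt_sqrM.
transitivity (\int[leb]_(x in `]0%R, pi[) (rsqrt (P ^+ 2 + p ^+ 2 - 2 * P * p * cos x))%:E)%E.
  rewrite -ge0_integralZl_EFin//.
  - by apply: eq_integral => x _; rewrite /h -EFinM rs4; congr EFin; field.
  - apply: measurable_funTS; apply: measurableT_comp => //.
    exact: measurable_cos.
rewrite integral_law_of_cosines//.
rewrite (@integral_sin_fold (fun s => (rsqrt (P ^+ 2 - p ^+ 2 * s ^+ 2))%:E)).
- by rewrite P2 p2 integral_circle_to_abel.
- by move=> x; rewrite lee_fin rsqrt_ge0.
- apply/measurable_EFinP; apply: measurable_fun_rsqrt; apply: continuous_measurable => x.
  by apply: is_derive_continuous.
Qed.
End circle_average.

(** * The thresholds for the position of the charge *)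

Section parameters.
Context (R : realType).
Variables (q : R) (hq : 0 < q).
Implicit Types s t h : R.

Lemma poly_root_between (f : R -> R) (a b : R) : a < b -> continuous f ->
  f a < 0 -> 0 < f b -> exists2 c, a < c < b & f c = 0.
Proof.
move=> ab cf fa fb.
have cE : Num.min (f a) (f b) <= 0 <= Num.max (f a) (f b).
  by rewrite minEle maxEle (ltW (lt_trans fa fb)) !ltW.
have [c] := IVT (ltW ab) (continuous_subspaceT cf) cE.
rewrite in_itv/= => /andP[ac cb] fc; exists c => //.
rewrite !lt_neqAle ac cb !andbT; apply/andP; split; apply/eqP => E.
  by move: fa; rewrite E fc ltxx.
by move: fb; rewrite -E fc ltxx.
Qed.

Lemma invr_eq_div (X Y : R) : Y != 0 -> q^-1 = X / Y <-> Y = q * X.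
Proof.
move=> Y0; have q0 : q != 0 by rewrite gt_eqF.
split=> E; first by apply: (mulfI (invr_neq0 q0)); rewrite mulKf// E divfK.
by apply: (mulIf Y0); rewrite divfK// [in LHS]E mulKf.
Qed.

Lemma is_h_plusP t : 1 < t -> 1 / q = (t + 1) / (t - 1) ^+ 2 - 1 / t <->
  t * (t - 1) ^+ 2 = q * (3 * t - 1).
Proof.
move=> t1; have h0 : t != 0 by rewrite gt_eqF//; lra.
have h1 : t - 1 != 0 by rewrite gt_eqF//; lra.
have -> : (t + 1) / (t - 1) ^+ 2 - 1 / t = (3 * t - 1) / (t * (t - 1) ^+ 2).
  by field; rewrite h0 h1.
by rewrite div1r; apply: invr_eq_div; rewrite mulf_neq0 ?expf_neq0.
Qed.

(** Cross-multiplied form of the strict monotonicity of [t (t - 1)^2 / (3 t - 1)] on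
    [t > 1].  After the factor [t - s] is removed, the difference is a polynomial in
    [s - 1] and [t - 1] with nonnegative coefficients. *)
Lemma h_plus_mono s t : 1 < s -> s < t ->
  s * (s - 1) ^+ 2 * (3 * t - 1) < t * (t - 1) ^+ 2 * (3 * s - 1).
Proof.
move=> s1 st; rewrite -subr_gt0.
have -> : t * (t - 1) ^+ 2 * (3 * s - 1) - s * (s - 1) ^+ 2 * (3 * t - 1) =
  (t - s) * (3 * (s - 1) * (t - 1) * (s + t - 2) + 2 * ((t - 1) ^+ 2 + (t - 1) * (s - 1) + (s - 1) ^+ 2)
   + 3 * (s - 1) * (t - 1) + 2 * (s + t - 2)) by ring.
apply: mulr_gt0; first by rewrite subr_gt0.
have a0 : 0 < s - 1 by lra.
have b0 : 0 < t - 1 by lra.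
have ab : 0 < (s - 1) * (t - 1) by exact: mulr_gt0.
have abc : 0 < (s - 1) * (t - 1) * (s + t - 2) by apply: mulr_gt0 => //; lra.
have := sqr_ge0 (t - 1); have := sqr_ge0 (s - 1); lra.
Qed.

Lemma exists_unique_h_plus : exists! h_plus : R, is_h_plus q h_plus.
Proof.
have q0 := hq.
pose f (t : R) : R := t * (t - 1) ^+ 2 - q * (3 * t - 1).
have f1 : f 1 < 0 by rewrite /f subrr expr0n/= mulr0; lra.
have fb : 0 < f (2 + 3 * q).
  (* any point far enough to the right would do; here the value is a polynomial in q
     with positive coefficients *)
  have -> : f (2 + 3 * q) = 27 * q ^+ 3 + 27 * q ^+ 2 + 10 * q + 2 by rewrite /f; ring.
  have := exprn_gt0 3 hq; have := exprn_gt0 2 hq; lra.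
have lt12 : 1 < 2 + 3 * q by lra.
have cf : continuous f by move=> x; apply: is_derive_continuous.
have [t /andP[t1 _] ft] := poly_root_between lt12 cf f1 fb.
have tE : t * (t - 1) ^+ 2 = q * (3 * t - 1) by apply/eqP; rewrite -subr_eq0 -/(f t) ft.
exists t; split; first by split=> //; apply/is_h_plusP.
move=> s [s1 /(is_h_plusP s1) sE].
have [st|ts|//] := ltgtP s t.
  have := h_plus_mono s1 st; rewrite tE sE; lra.
have := h_plus_mono t1 ts; rewrite tE sE; lra.
Qed.

(** Multiplied by [pi], the two sides are the limits at angle [0] of [F_Q_num] and of the
    field term, so that the equation of [alpha0] has a solution.  The same holds for
    [gt_h_minus] when the charge is inside the sphere. *)
Lemma lt_h_plus t h : is_h_plus q t -> 1 < h -> h < t ->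
  1 + q / h < q * (h + 1) / (h - 1) ^+ 2.
Proof.
have q0 := hq.
move=> [t1 /(is_h_plusP t1) tE] h1 ht.
have := h_plus_mono h1 ht; rewrite tE => E.
have h10 : 0 < h - 1 by lra.
have : h * (h - 1) ^+ 2 < q * (3 * h - 1).
  by rewrite -(@ltr_pM2r _ (3 * t - 1)) ?[_ * (3 * h - 1) * _]mulrAC//; lra.
move=> H; rewrite -subr_gt0.
have -> : q * (h + 1) / (h - 1) ^+ 2 - (1 + q / h) =
  (q * (3 * h - 1) - h * (h - 1) ^+ 2) / (h * (h - 1) ^+ 2).
  by field; rewrite !gt_eqF//; lra.
apply: divr_gt0; first by rewrite subr_gt0.
by rewrite mulr_gt0 ?exprn_gt0//; lra.
Qed.

Lemma is_h_minusP t : 0 < t < 1 -> 1 / q = (t + 1) / (1 - t) ^+ 2 - 1 <->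
  (1 - t) ^+ 2 = q * (t * (3 - t)).
Proof.
move=> /andP[t0 t1].
have h1 : 1 - t != 0 by rewrite gt_eqF//; lra.
have -> : (t + 1) / (1 - t) ^+ 2 - 1 = (t * (3 - t)) / (1 - t) ^+ 2 by field.
by rewrite div1r; apply: invr_eq_div; rewrite expf_neq0.
Qed.

Lemma h_minus_mono s t : 0 < s -> s < t -> t < 1 ->
  (1 - t) ^+ 2 * (s * (3 - s)) < (1 - s) ^+ 2 * (t * (3 - t)).
Proof.
move=> s0 st t1; apply: ltr_pM.
- exact: sqr_ge0.
- by apply: mulr_ge0; lra.
- by rewrite ltrXn2r// ?nnegrE; lra.
- have : 0 < (t - s) * (3 - t - s) by apply: mulr_gt0; lra.
  lra.
Qed.

Lemma exists_unique_h_minus : exists! h_minus : R, is_h_minus q h_minus.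
Proof.
have q0 := hq.
pose f (t : R) : R := q * (t * (3 - t)) - (1 - t) ^+ 2.
have f0 : f 0 < 0 by rewrite /f mul0r mulr0 subr0 expr1n; lra.
have f1 : 0 < f 1 by rewrite /f subrr expr0n/= mul1r subr0 mulr_gt0//; lra.
have cf : continuous f by move=> x; apply: is_derive_continuous.
have [t t01 ft] := poly_root_between (@ltr01 R) cf f0 f1.
have tE : (1 - t) ^+ 2 = q * (t * (3 - t)) by apply/esym/eqP; rewrite -subr_eq0 -/(f t) ft.
exists t; split; first by split=> //; apply/is_h_minusP.
move=> s [s01 /(is_h_minusP s01) sE].
move: (s01) (t01) => /andP[s0 s1] /andP[t0 t1].
have [st|ts|//] := ltgtP s t.
  have := h_minus_mono s0 st t1; rewrite tE sE; lra.
have := h_minus_mono t0 ts s1; rewrite tE sE; lra.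
Qed.

Lemma gt_h_minus t h : is_h_minus q t -> t < h -> h < 1 ->
  1 + q < q * (h + 1) / (1 - h) ^+ 2.
Proof.
have q0 := hq.
move=> [t01 /(is_h_minusP t01) tE] th h1.
move: (t01) => /andP[t0 t1].
have := h_minus_mono t0 th h1; rewrite tE => E.
have h10 : 0 < 1 - h by lra.
have : (1 - h) ^+ 2 < q * (h * (3 - h)).
  rewrite -(@ltr_pM2r _ (t * (3 - t))); last by rewrite mulr_gt0//; lra.
  by rewrite [X in _ < X]mulrAC.
move=> H; rewrite -subr_gt0.
have -> : q * (h + 1) / (1 - h) ^+ 2 - (1 + q) =
  (q * (h * (3 - h)) - (1 - h) ^+ 2) / (1 - h) ^+ 2.
  by field; rewrite gt_eqF.
by apply: divr_gt0; rewrite ?subr_gt0// exprn_gt0.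
Qed.
End parameters.

(** * The critical angle *)

Section critical_angle.
Context (R : realType).
Implicit Types q h al : R.

(** The numerator of [F_Q] once the denominator is [pi - al + sin al]. *)
Definition F_Q_num q h al : R :=
  pi + q * (h + 1) / (2 * h) * (pi - al)
  - q * (h - 1) / h * atan ((h - 1) / (h + 1) * cot (al / 2)).

(** The equation of [alpha0] with denominators cleared. *)
Definition angle_eq q h al : R :=
  F_Q_num q h al - q * ((h + 1) / (h ^+ 2 + 1 - 2 * h * cos al)) * (pi - al + sin al).

Lemma F_Q_numE q h al : h != 0 -> F_Q q h al = F_Q_num q h al / (pi - al + sin al).
Proof.
move=> h0; rewrite /F_Q /F_Q_num; have pi0 := lt0r_neq0 (@pi_gt0 R).
rewrite [pi / _ * _]mulrAC; congr (_ / _).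
move: (atan _) (@pi R) pi0 => T p p0; field; by rewrite h0 p0.
Qed.

Lemma dist2_gt0 h al : 0 < h -> 0 < al -> al <= pi -> 0 < h ^+ 2 + 1 - 2 * h * cos al.
Proof.
move=> h0 a0 api.
have c1 : cos al < 1.
  by rewrite -cos0 ltr_cos// in_itv/= ?lexx ?pi_ge0// ltW.
have : 0 < 2 * h * (1 - cos al) by rewrite !mulr_gt0// subr_gt0.
have := sqr_ge0 (h - 1); lra.
Qed.

Lemma pi_sub_add_sin_gt0 al : 0 < al < pi -> 0 < pi - al + sin al.
Proof. by move=> a; have := sin_gt0_pi a; lra. Qed.

Lemma is_alpha0P q h al : 0 < h ->
  is_alpha0 q h al <-> 0 < al < pi /\ angle_eq q h al = 0.
Proof.
move=> h0; rewrite /is_alpha0 F_Q_numE ?gt_eqF// /angle_eq.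
split=> -[a H]; split=> //; have D0 := lt0r_neq0 (pi_sub_add_sin_gt0 a).
  by rewrite -H divfK// subrr.
by apply: (mulIf D0); rewrite divfK//; apply/eqP; rewrite -subr_eq0 H.
Qed.

Lemma cos_half al : cos al = 1 - 2 * sin (al / 2) ^+ 2 :> R.
Proof.
rewrite {1}(_ : al = al / 2 + al / 2); last by lra.
by rewrite cosD -!expr2 cos2sin2; ring.
Qed.

Lemma sin_half al : sin al = 2 * sin (al / 2) * cos (al / 2) :> R.
Proof.
rewrite {1}(_ : al = al / 2 + al / 2); last by lra.
by rewrite sinD; ring.
Qed.

Lemma sin_half_gt0 al : 0 < al <= pi -> 0 < sin (al / 2).
Proof. by move=> a; apply: sin_gt0_pi; have := @pi_gt0 R; lra. Qed.

Lemma is_derive_cot x : sin x != 0 -> is_derive x (1:R) (@cot R) (- (sin x ^- 2)).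
Proof.
move=> s0; rewrite /cot; apply: is_derive_eq; rewrite /GRing.scale/=.
have c2 : cos x ^+ 2 = 1 - sin x ^+ 2 by rewrite cos2sin2.
by field : c2.
Qed.

(** The derivative is minus the field term times [1 - cos al], that is, the field term
    times the derivative of [pi - al + sin al]. *)
Lemma is_derive_F_Q_num q h al : 0 < h -> 0 < al <= pi ->
  is_derive al (1:R) (F_Q_num q h)
    (- (q * (h + 1) * (1 - cos al) / (h ^+ 2 + 1 - 2 * h * cos al))).
Proof.
move=> h0 a; have s0 := sin_half_gt0 a.
have sn0 := lt0r_neq0 s0.
have E0 : 0 < h ^+ 2 + 1 - 2 * h * cos al by apply: dist2_gt0; lra.
have En0 := lt0r_neq0 E0.
have dcot := is_derive_cot sn0.
apply: is_derive_eq; rewrite /GRing.scale/= /cot.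
move: En0; rewrite cos_half.
have := cos2sin2 (al / 2); move: (cos (al / 2)) (sin (al / 2)) sn0 => c s s0' c2 En0.
have H : 1 + ((h - 1) / (h + 1) * (c / s)) ^+ 2 =
   (h ^+ 2 + 1 - 2 * h * (1 - 2 * s ^+ 2)) / ((h + 1) ^+ 2 * s ^+ 2).
  field : c2; rewrite s0'/=; lra.
rewrite H; field.
by rewrite En0 s0' !gt_eqF//; lra.
Qed.

(** By [is_derive_F_Q_num] the derivatives of [F_Q_num] and of the factor
    [pi - al + sin al] cancel; what remains is minus the derivative of the field term,
    and the field decreases with the angle. *)
Lemma is_derive_angle_eq q h al : 0 < h -> 0 < al <= pi ->
  is_derive al (1:R) (angle_eq q h)
    (q * (h + 1) * (2 * h * sin al) / (h ^+ 2 + 1 - 2 * h * cos al) ^+ 2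
     * (pi - al + sin al)).
Proof.
move=> h0 a.
have En0 : h ^+ 2 + 1 - 2 * h * cos al != 0.
  by rewrite gt_eqF// dist2_gt0//; lra.
have dN := is_derive_F_Q_num q h0 a.
apply: is_derive_eq; rewrite /GRing.scale/=.
by field.
Qed.

Lemma angle_eq_lt q h x y : 0 < q -> 0 < h -> 0 < x -> x < y -> y <= pi ->
  angle_eq q h x < angle_eq q h y.
Proof.
move=> q0 h0 x0 xy ypi.
have dH z : z \in `]x, y[ -> is_derive z (1:R) (angle_eq q h)
    (q * (h + 1) * (2 * h * sin z) / (h ^+ 2 + 1 - 2 * h * cos z) ^+ 2 * (pi - z + sin z)).
  by rewrite in_itv/= => zxy; apply: is_derive_angle_eq => //; lra.
have cH : {within `[x, y], continuous (angle_eq q h)}.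
  apply: continuous_in_subspaceT => z /set_mem/=; rewrite in_itv/= => zxy.
  by apply: (is_derive_continuous (is_derive_angle_eq q h0 _)); lra.
have [c cxy E] := MVT xy dH cH.
rewrite -subr_gt0 E; move: cxy; rewrite in_itv/= => cxy.
have c0 : 0 < c < pi by lra.
apply: mulr_gt0; last by lra.
apply: mulr_gt0; last exact: pi_sub_add_sin_gt0.
apply: divr_gt0; last by rewrite exprn_gt0// dist2_gt0//; lra.
by rewrite !mulr_gt0 ?sin_gt0_pi//; lra.
Qed.

Lemma angle_eq_pi q h : angle_eq q h pi = pi.
Proof. by rewrite /angle_eq /F_Q_num /cot cos_pihalf mul0r mulr0 atan0 sinpi subrr addr0 !mulr0 addr0 !subr0. Qed.

Lemma angle_eq_root q h x : 0 < q -> 0 < h -> 0 < x < pi -> angle_eq q h x < 0 ->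
  exists! al, is_alpha0 q h al.
Proof.
move=> q0 h0 /andP[x0 xpi] Hx.
have cH : {within `[x, pi], continuous (angle_eq q h)}.
  apply: continuous_in_subspaceT => z /set_mem/=; rewrite in_itv/= => zx.
  by apply: (is_derive_continuous (is_derive_angle_eq q h0 _)); lra.
have Hpi : 0 < angle_eq q h pi by rewrite angle_eq_pi pi_gt0.
have cE : Num.min (angle_eq q h x) (angle_eq q h pi) <= 0 <= Num.max (angle_eq q h x) (angle_eq q h pi).
  by rewrite minEle maxEle (ltW (lt_trans Hx Hpi)) !ltW.
have [c] := IVT (ltW xpi) cH cE.
rewrite in_itv/= => /andP[xc cpi] Hc.
have c0 : 0 < c < pi.
  rewrite (lt_le_trans x0 xc)/= lt_neqAle cpi andbT; apply/eqP => E.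
  by move: Hpi; rewrite -E Hc ltxx.
exists c; split; first exact/is_alpha0P.
move=> d /(is_alpha0P _ _ h0)[d0 Hd].
have [cd|dc|//] := ltgtP c d.
  have : angle_eq q h c < angle_eq q h d by apply: angle_eq_lt => //; lra.
  by rewrite Hc Hd ltxx.
have : angle_eq q h d < angle_eq q h c by apply: angle_eq_lt => //; lra.
by rewrite Hc Hd ltxx.
Qed.

(** The function [atan (k * cot (al / 2))] written so that it is smooth up to [al = 0],
    where [cot] is not defined. *)
Let T k al : R := (pi - al) / 2 +
  atan ((k - 1) * sin (al / 2) * cos (al / 2) / (sin (al / 2) ^+ 2 + k * cos (al / 2) ^+ 2)).

Let den_gt0 (k : R) al : 0 < k -> 0 < sin (al / 2) ^+ 2 + k * cos (al / 2) ^+ 2.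
Proof.
by move=> k0; rewrite -[_ ^+ 2]mul1r addrC; exact: convex_pos.
Qed.

Let dT (k : R) al : 0 < k ->
  is_derive al (1:R) (T k) (- (k / 2 / (sin (al / 2) ^+ 2 + k ^+ 2 * cos (al / 2) ^+ 2))).
Proof.
move=> k0; have D0 := lt0r_neq0 (den_gt0 al k0).
have D2 : sin (al / 2) ^+ 2 + k ^+ 2 * cos (al / 2) ^+ 2 != 0.
  by rewrite gt_eqF// den_gt0// exprn_gt0.
apply: is_derive_eq; rewrite /GRing.scale/=.
have := cos2sin2 (al / 2); move: (cos (al / 2)) (sin (al / 2)) D0 D2 => c s D0 D2 c2.
have H : 1 + ((k - 1) * s * c / (s ^+ 2 + k * c ^+ 2)) ^+ 2 =
   (s ^+ 2 + k ^+ 2 * c ^+ 2) / (s ^+ 2 + k * c ^+ 2) ^+ 2.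
  by field : c2.
rewrite H; field : c2.
by rewrite exprMn D0 D2.
Qed.

(** Both sides have the same derivative and vanish at [pi]. *)
Let TE (k : R) al : 0 < k -> 0 < al <= pi -> T k al = atan (k * cot (al / 2)).
Proof.
move=> k0 /andP[a0]; rewrite le_eqVlt => /predU1P[->|api].
  by rewrite /T /cot cos_pihalf subrr !(mul0r, mulr0, atan0, addr0).
pose f x := T k x - atan (k * cot (x / 2)).
have df x : al <= x <= pi -> is_derive x (1:R) f 0.
  move=> xa; have a1 : 0 < x <= pi by lra.
  have s0 := lt0r_neq0 (sin_half_gt0 a1); have d1 := dT x k0.
  have dcot := is_derive_cot s0.
  have D2 : sin (x / 2) ^+ 2 + k ^+ 2 * cos (x / 2) ^+ 2 != 0.
    by rewrite gt_eqF// den_gt0// exprn_gt0.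
  apply: is_derive_eq; rewrite /GRing.scale/= /cot.
  have := cos2sin2 (x / 2); move: (cos (x / 2)) (sin (x / 2)) s0 D2 => c s s0 D2 c2.
  have H : 1 + (k * (c / s)) ^+ 2 = (s ^+ 2 + k ^+ 2 * c ^+ 2) / s ^+ 2.
    by field.
  rewrite H; field.
  by rewrite ?exprMn D2 s0.
have df1 x : x \in `]al, pi[ -> is_derive x (1:R) f 0.
  by rewrite in_itv/= => xa; apply: df; lra.
have cf : {within `[al, pi], continuous f}.
  apply: continuous_in_subspaceT => z /set_mem/=; rewrite in_itv/= => za.
  by apply: is_derive_continuous (df _ _).
have [c cxy] := MVT api df1 cf.
rewrite mul0r /f {1}/T /cot cos_pihalf subrr !(mul0r, mulr0, atan0, addr0) subrr.
lra.
Qed.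

(** Written with [T], the function [angle_eq] extends smoothly to [0], and the hypothesis
    says that the value there is negative. *)
Lemma angle_eq_neg_neq1 q h : 0 < q -> 0 < h -> h != 1 ->
  pi * (1 + q * (h + 1) / (2 * h) - q * `|h - 1| / (2 * h)) < pi * (q * (h + 1) / (h - 1) ^+ 2) ->
  exists2 x, 0 < x < pi & angle_eq q h x < 0.
Proof.
move=> q0 h0 h1 H.
have h10 : h - 1 != 0 by rewrite subr_eq0.
pose k := `|h - 1| / (h + 1).
have k0 : 0 < k by rewrite divr_gt0 ?normr_gt0//; lra.
pose f x := pi + q * (h + 1) / (2 * h) * (pi - x) - q * `|h - 1| / h * T k x
  - q * ((h + 1) / (h ^+ 2 + 1 - 2 * h * cos x)) * (pi - x + sin x).
have f0 : f 0 < 0.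
  rewrite /f /T mul0r sin0 cos0 !(mulr0, mul0r, atan0, addr0, subr0, mulr1).
  have -> : h ^+ 2 + 1 - 2 * h = (h - 1) ^+ 2 by ring.
  move: H; rewrite -subr_gt0 => H; rewrite -oppr_gt0.
  by apply: (lt_le_trans H); rewrite le_eqVlt; apply/orP; left; apply/eqP; field; rewrite h10 gt_eqF.
have fE (x : R) : 0 < x <= pi -> f x = angle_eq q h x.
  move=> x0; rewrite /f /angle_eq /F_Q_num TE//; congr (_ - _ - _).
  rewrite /k; have [hp|hn] := leP 0 (h - 1); first by rewrite ger0_norm.
  by rewrite ltr0_norm// mulNr [- (_ / _) * _]mulNr atanN; field; rewrite gt_eqF.
have cf : {for 0, continuous f}.
  have d1 := dT 0 k0.
  have E0 : h ^+ 2 + 1 - 2 * h * cos 0 != 0.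
    by rewrite cos0 (_ : _ - _ = (h - 1) ^+ 2) ?expf_neq0//; ring.
  by apply: is_derive_continuous.
have pi0 := @pi_gt0 R.
have [e /= e0 He] := cvgr_lt _ cf 0 f0.
exists (Num.min (e / 2) (pi / 2)).
  by rewrite lt_min gt_min !divr_gt0//=; apply/orP; right; lra.
rewrite -fE; last first.
  by rewrite lt_min ge_min !divr_gt0//=; apply/orP; right; lra.
apply: He; rewrite /= sub0r normrN ger0_norm; first by rewrite gt_min; apply/orP; left; lra.
by rewrite le_min !divr_ge0// ltW.
Qed.

(** When the charge is on the sphere the field term is unbounded near [0].  The angle with
    [1 - cos x = q / (2 (1 + q))] makes it equal to [2 (1 + q)], which beats the other
    terms. *)
Lemma angle_eq_neg_eq1 q : 0 < q -> exists2 x, 0 < x < pi & angle_eq q 1 x < 0.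
Proof.
move=> q0; have pi0 := @pi_gt0 R.
pose d := q / (2 * (1 + q)).
have d0 : 0 < d by rewrite divr_gt0//; lra.
have d1 : d < 1 by rewrite ltr_pdivrMr; lra.
have I : -1 <= 1 - d <= 1 by lra.
pose x := acos (1 - d).
have cx : cos x = 1 - d by rewrite acosK.
have x0 : 0 < x by apply: acos_gt0; lra.
have x1 : x < pi / 2.
  rewrite ltNge; apply/negP => h.
  have : cos x <= 0.
    have xpi : x <= pi by exact: acos_lepi.
    have xi : x \in `[0, pi] by rewrite in_itv/=; lra.
    have pi2 : pi / 2 \in `[0, (@pi R)] by rewrite in_itv/=; lra.
    by rewrite -cos_pihalf leNgt ltr_cos// -leNgt.
  by rewrite cx; lra.
exists x; first by lra.
rewrite /angle_eq /F_Q_num subrr !mulr0 !mul0r subr0 cx.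
have -> : 1 ^+ 2 + 1 - 2 * 1 * (1 - d) = 2 * d :> R by ring.
have -> : q * ((1 + 1) / (2 * d)) = 2 * (1 + q).
  by rewrite /d; field; rewrite !gt_eqF//; lra.
have sx : 0 < sin x by apply: sin_gt0_pi; lra.
have -> : q * (1 + 1) / (2 * 1) = q by field.
have : 0 < q * (pi - x) by rewrite mulr_gt0//; lra.
have : 0 < q * sin x by rewrite mulr_gt0.
lra.
Qed.

Lemma exists_unique_alpha0 q hp hm h : 0 < q -> is_h_plus q hp -> is_h_minus q hm ->
  0 < h -> hm < h < hp -> exists! al, is_alpha0 q h al.
Proof.
move=> q0 Hp Hm h0 /andP[hmh hhp].
suff [x x0 Hx] : exists2 x, 0 < x < pi & angle_eq q h x < 0 by exact: angle_eq_root x0 Hx.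
have pi0 := @pi_gt0 R.
have [->|h1] := eqVneq h 1; first exact: angle_eq_neg_eq1.
apply: angle_eq_neg_neq1 => //; rewrite ltr_pM2l//.
have [h1'|h1'] := ltP 1 h.
  have := lt_h_plus q0 Hp h1' hhp; rewrite gtr0_norm ?subr_gt0//.
  by congr (_ < _); field; rewrite gt_eqF.
have {}h1 : h < 1 by rewrite lt_neqAle h1.
have := gt_h_minus q0 Hm hmh h1; rewrite ltr0_norm ?subr_lt0//.
have -> : (h - 1) ^+ 2 = (1 - h) ^+ 2 by ring.
by congr (_ < _); field; rewrite gt_eqF.
Qed.
End critical_angle.

(** * The Abel equation of the equilibrium density *)

Section equilibrium_abel.
Context (R : realType).
Local Notation leb := (@lebesgue_measure R).
Variables (q h a : R).
Hypothesis hyp : [/\ 0 < q, 0 < h, 0 < a & a < 1].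
Implicit Types u v w : R.

(** The squared distance from the charge to the points of the sphere at which
    [(1 - cos phi) / 2 = w]. *)
Definition cdist2 w : R := (h - 1) ^+ 2 + 4 * h * w.

(** The value of [F_Q] given by the equation of [alpha0], where [a = (1 - cos alpha0) / 2]. *)
Definition cap_const : R := q * (h + 1) / cdist2 a.

(** The Abel transform that the density must have for the total potential to be constant
    on the cap. *)
Definition abel_density w : R := Num.sqrt w * (cap_const - q * (h + 1) / cdist2 w).
Definition abel_density' w : R :=
  (cap_const - q * (h + 1) / cdist2 w) / (2 * Num.sqrt w) +
  Num.sqrt w * (q * (h + 1)) * (4 * h) / cdist2 w ^+ 2.

(** The derivative of the Abel transform, extended by zero. *)
Definition abel_source w : R := if a < w then abel_density' w else 0.

(** The inverse Abel transform of [abel_density], up to a constant factor; extended real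
    so that no integrability has to be known in advance.  It is [2 pi^2] times the
    equilibrium density. *)
Definition abel_sol v : \bar R := (\int[leb]_u (abel_source u * rsqrt (v - u))%:E)%E.

Lemma cdist2_gt0 w : 0 < w -> 0 < cdist2 w.
Proof.
have [_ h0 _ _] := hyp; move=> w0; rewrite /cdist2.
have := sqr_ge0 (h - 1); have : 0 < 4 * h * w by rewrite !mulr_gt0.
lra.
Qed.

Lemma cdist2_1 : cdist2 1 = (h + 1) ^+ 2. Proof. by rewrite /cdist2; ring. Qed.

Lemma cap_const_gt0 : 0 < cap_const.
Proof.
have [q0 h0 a0 _] := hyp; rewrite /cap_const divr_gt0 ?cdist2_gt0// mulr_gt0//; lra.
Qed.

Lemma cap_const_sub w : a < w -> 0 < cap_const - q * (h + 1) / cdist2 w.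
Proof.
have [q0 h0 a0 _] := hyp; move=> aw; rewrite subr_gt0 /cap_const.
rewrite ltr_pM2l; last by rewrite mulr_gt0//; lra.
rewrite ltf_pV2 ?posrE ?cdist2_gt0//; last by lra.
by rewrite /cdist2 ltrD2l ltr_pM2l ?mulr_gt0.
Qed.

Lemma cap_const_sub_le w : 0 < cdist2 w -> w <= a -> cap_const - q * (h + 1) / cdist2 w <= 0.
Proof.
have [q0 h0 a0 _] := hyp; move=> Dw aw; rewrite subr_le0 /cap_const.
rewrite ler_pM2l; last by rewrite mulr_gt0//; lra.
have Da := cdist2_gt0 a0.
rewrite lef_pV2 ?posrE//.
by rewrite /cdist2 lerD2l ler_pM2l ?mulr_gt0.
Qed.

Lemma abel_density'_gt0 w : a < w -> 0 < abel_density' w.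
Proof.
have [q0 h0 a0 _] := hyp; move=> aw; have w0 : 0 < w by lra.
have sw : 0 < Num.sqrt w by rewrite sqrtr_gt0.
rewrite /abel_density' addr_gt0//.
  by rewrite divr_gt0 ?cap_const_sub// mulr_gt0.
by rewrite divr_gt0 ?exprn_gt0 ?cdist2_gt0// !mulr_gt0//; lra.
Qed.

Lemma abel_source_ge0 w : 0 <= abel_source w.
Proof. by rewrite /abel_source; case: ifPn => // /abel_density'_gt0/ltW. Qed.

Lemma is_derive_abel_density w : 0 < w ->
  is_derive w (1:R) abel_density (abel_density' w).
Proof.
move=> w0; have D0 := lt0r_neq0 (cdist2_gt0 w0).
have ds := is_derive1_sqrt w0.
have s0 : Num.sqrt w != 0 by rewrite gt_eqF// sqrtr_gt0.
rewrite /cdist2 in D0.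
apply: is_derive_eq; rewrite /GRing.scale/= /abel_density' /cdist2.
by field; rewrite D0 s0.
Qed.

Lemma continuous_abel_density' w : 0 < w -> {for w, continuous abel_density'}.
Proof.
move=> w0; have D0 := lt0r_neq0 (cdist2_gt0 w0).
have ds := is_derive1_sqrt w0.
have s0 : 2 * Num.sqrt w != 0 by rewrite gt_eqF// mulr_gt0// sqrtr_gt0.
rewrite /cdist2 in D0.
have D2 : ((h - 1) ^+ 2 + 4 * h * w) ^+ 2 != 0 by rewrite expf_neq0.
by apply: is_derive_continuous.
Qed.

Lemma measurable_abel_source : measurable_fun [set: R] abel_source.
Proof.
have [_ _ a0 _] := hyp.
have -> : abel_source = abel_density' \_ `]a, +oo[%classic.
  apply/funext => w; rewrite patchE /abel_source mem_setE in_itv/= andbT //.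
apply: (measurable_restrictT abel_density' _).1; first exact: measurable_itv.
apply: open_continuous_measurable_fun; first exact: interval_open.
move=> x /set_mem/=; rewrite in_itv/= andbT => ax.
by apply: continuous_abel_density'; lra.
Qed.

Lemma integral_abel_source w : a <= w -> (\int[leb]_(u in `]a, w[) (abel_source u)%:E = (abel_density w)%:E)%E.
Proof.
have [_ _ a0 _] := hyp; move=> aw.
have Pa : abel_density a = 0 by rewrite /abel_density /cap_const subrr mulr0.
transitivity (\int[leb]_(u in `]a, w[) (abel_density' u)%:E)%E.
  apply: eq_integral => u /set_mem/=; rewrite in_itv/= => /andP[au _].
  by rewrite /abel_source au.
rewrite (@integral_derivative_oo _ abel_density)// ?Pa ?subr0//.
split.
- apply: continuous_in_subspaceT => u /set_mem/=; rewrite in_itv/= => uw.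
  by apply: (is_derive_continuous (is_derive_abel_density _)); lra.
- by move=> u; rewrite in_itv/= => uw; apply: is_derive_abel_density; lra.
- by move=> u; rewrite in_itv/= => /andP[? _]; exact: abel_density'_gt0.
- by move=> u; rewrite in_itv/= => uw; apply: continuous_abel_density'; lra.
Qed.

Lemma abel_kernel_pi u w : (\int[leb]_v (rsqrt (v - u) * rsqrt (w - v))%:E =
   (if u < w then pi else 0)%:E)%E.
Proof.
case: ifPn => uw; last first.
  rewrite integral0_eq// => v _; rewrite -leNgt in uw.
  have [uv|uv] := leP v u; first by rewrite rsqrt_eq0 ?mul0r// subr_le0.
  by rewrite (@rsqrt_eq0 _ (w - v)) ?mulr0//; lra.
have := @abel_kernel_integral R 1 0 u w uw.
rewrite !mul0r addr0 /rsqrt sqrtr1 invr1 !mulr1 => <- //.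
by apply: eq_integral => v _; rewrite mul0r addr0 divr1 mulrC.
Qed.

Lemma abel_sol_ge0 v : (0 <= abel_sol v)%E.
Proof. by apply: integral_ge0 => u _; rewrite lee_fin mulr_ge0 ?abel_source_ge0 ?rsqrt_ge0. Qed.

Let sub1 : measurable_fun [set: R * R] (fun z : R * R => z.1 - z.2).
Proof. by apply: measurable_funB. Qed.

Lemma measurable_abel_sol : measurable_fun [set: R] abel_sol.
Proof.
apply: (@measurable_fun_fubini_tonelli_F _ _ _ _ _ leb (fun z : R * R => (abel_source z.2 * rsqrt (z.1 - z.2))%:E)).
- apply/measurable_EFinP; apply: measurable_funM; last exact: measurable_fun_rsqrt.
  by apply: (measurableT_comp measurable_abel_source); exact: measurable_snd.
- by move=> z; rewrite lee_fin mulr_ge0 ?abel_source_ge0 ?rsqrt_ge0.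
Qed.

(** After exchanging the integrals, the inner one is [pi] by [abel_kernel_pi], and the
    integral of [abel_source] remains.  The transform vanishes at [a], so there is no
    boundary term: this is the equation of [alpha0]. *)
Lemma abel_equation w :
  (\int[leb]_v (abel_sol v * (rsqrt (w - v))%:E) = (if a < w then pi * abel_density w else 0)%:E)%E.
Proof.
pose k (z : R * R) := (abel_source z.2 * (rsqrt (z.1 - z.2) * rsqrt (w - z.1)))%:E.
have k0 z : (0 <= k z)%E by rewrite lee_fin !mulr_ge0 ?abel_source_ge0 ?rsqrt_ge0.
have mk : measurable_fun [set: R * R] k.
  apply/measurable_EFinP; apply: measurable_funM.
    by apply: (measurableT_comp measurable_abel_source); exact: measurable_snd.
  apply: measurable_funM; apply: measurable_fun_rsqrt => //.
  by apply: measurable_funB => //; exact: measurable_fst.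
transitivity (\int[leb]_v \int[leb]_u k (v, u))%E.
  apply: eq_integral => v _; rewrite /abel_sol -ge0_integralZr//.
  - by apply: eq_integral => u _; rewrite -EFinM /k/= mulrA.
  - apply/measurable_EFinP; apply: measurable_funM; first exact: measurable_abel_source.
    by apply: measurable_fun_rsqrt; exact: measurable_funB.
  - by move=> u _; rewrite lee_fin mulr_ge0 ?abel_source_ge0 ?rsqrt_ge0.
  - by rewrite lee_fin rsqrt_ge0.
rewrite fubini_tonelli//.
transitivity (\int[leb]_u ((abel_source u)%:E * (if u < w then pi else 0)%:E))%E.
  apply: eq_integral => u _.
  under eq_integral do rewrite /k /= EFinM.
  rewrite ge0_integralZl ?abel_kernel_pi//.
  - apply/measurable_EFinP; apply: measurable_funM; apply: measurable_fun_rsqrt;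
    exact: measurable_funB.
  - by move=> v _; rewrite lee_fin mulr_ge0 ?rsqrt_ge0.
  - by rewrite lee_fin abel_source_ge0.
case: ifPn => aw; last first.
  rewrite integral0_eq// => u _; rewrite /abel_source.
  case: ifPn => au; last by rewrite mul0e.
  by rewrite ifF ?mule0//; apply/negbTE; rewrite -leNgt; move: aw au; rewrite -leNgt; lra.
rewrite (@integral_supp R a w); last first.
  move=> u [ua|wu]; first by rewrite /abel_source ltNge ua mul0e.
  by rewrite [u < w]ltNge wu mule0.
transitivity (\int[leb]_(u in `]a, w[) (pi%:E * (abel_source u)%:E))%E.
  by apply: eq_integral => u /set_mem/=; rewrite in_itv/= => /andP[_ ->]; rewrite muleC.
rewrite ge0_integralZl_EFin//; last 3 first.
- by move=> u _; rewrite lee_fin abel_source_ge0.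
- by apply/measurable_EFinP; apply: measurable_funTS; exact: measurable_abel_source.
- by rewrite ltW// pi_gt0.
by rewrite integral_abel_source// ltW.
Qed.

Lemma is_derive_sub_div v u : u != 0 ->
  is_derive u (1:R) (fun u => (v - u) / u) (- v / u ^+ 2).
Proof.
move=> un0.
have dinv : is_derive u (1:R) (fun u : R => u^-1) (- u ^- 2).
  apply: (is_derive_eq (is_deriveV (f := id) un0 (is_derive_id u 1))).
  by rewrite /GRing.scale/= mulr1.
by apply: is_derive_eq; rewrite /GRing.scale/=; field.
Qed.

(** A primitive, up to sign, of [abel_density' u * rsqrt (v - u)] as a function of [u], in
    terms of [z = sqrt ((v - u) / u)]. *)
Definition abel_prim v (z : R) : R :=
  cap_const * atan z - q * (h + 1) * ((h - 1) / Num.sqrt (cdist2 v) ^+ 3 * atan ((h - 1) * z / Num.sqrt (cdist2 v))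
    - 4 * h * v / cdist2 v * (z / (cdist2 v + (h - 1) ^+ 2 * z ^+ 2))).

Lemma is_derive_abel_prim v z : 0 < v ->
  is_derive z (1:R) (abel_prim v)
    (cap_const / (1 + z ^+ 2) - q * (h + 1) * ((h - 1) ^+ 2 / (cdist2 v * (cdist2 v + (h - 1) ^+ 2 * z ^+ 2))
     - 4 * h * v / cdist2 v * ((cdist2 v - (h - 1) ^+ 2 * z ^+ 2) / (cdist2 v + (h - 1) ^+ 2 * z ^+ 2) ^+ 2))).
Proof.
have [_ h0 _ _] := hyp; move=> v0; have Dv := cdist2_gt0 v0.
set r := Num.sqrt (cdist2 v).
have r2 : cdist2 v = r ^+ 2 by rewrite sqr_sqrtr// ltW.
have r0 : r != 0 by rewrite gt_eqF// sqrtr_gt0.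
have D1 : 0 < cdist2 v + (h - 1) ^+ 2 * z ^+ 2.
  by rewrite ltr_wpDr// mulr_ge0// sqr_ge0.
have D1' := lt0r_neq0 D1.
have z1 : 1 + z ^+ 2 != 0 by rewrite gt_eqF// ltr_wpDr// sqr_ge0.
rewrite /abel_prim -/r; move: D1'; rewrite r2 => D1'.
apply: is_derive_eq; rewrite /GRing.scale/=.
have -> : 1 + ((h - 1) * z / r) ^+ 2 = (r ^+ 2 + (h - 1) ^+ 2 * z ^+ 2) / r ^+ 2.
  by field.
field.
by rewrite -?exprMn in D1' *; rewrite ?D1' ?r0 ?z1.
Qed.

(** With [u = y^2] and [v = y^2 (1 + z^2)] both sides are rational functions, because
    [D v + (h - 1)^2 z^2 = (1 + z^2) D u]. *)
Lemma is_derive_abel_prim_sqrt v u : a <= u -> u < v ->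
  is_derive u (1:R) (fun u => - abel_prim v (Num.sqrt ((v - u) / u))) (abel_density' u * rsqrt (v - u)).
Proof.
have [q0 h0 a0 a1] := hyp; move=> au uv.
have u0 : 0 < u by lra.
have v0 : 0 < v by lra.
have x0 : 0 < (v - u) / u by rewrite divr_gt0// subr_gt0.
set z := Num.sqrt ((v - u) / u).
have z0 : 0 < z by rewrite sqrtr_gt0.
have dz : is_derive u (1:R) (fun u => Num.sqrt ((v - u) / u)) (- v / (2 * z * u ^+ 2)).
  have ds := is_derive1_sqrt x0.
  have un0 : u != 0 by rewrite gt_eqF.
  have dx := is_derive_sub_div v un0.
  apply: (is_derive_eq (@is_derive1_comp _ (@Num.sqrt R) (fun u => (v - u) / u) u _ _ ds dx)).
  rewrite -/z; field.
  by rewrite un0 gt_eqF.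
have dp := is_derive_abel_prim z v0.
have dc : is_derive u (1:R) (fun u => abel_prim v (Num.sqrt ((v - u) / u))) _ :=
  @is_derive1_comp _ (abel_prim v) (fun u => Num.sqrt ((v - u) / u)) u _ _ dp dz.
apply: is_derive_eq.
pose y := Num.sqrt u.
have y0 : 0 < y by rewrite sqrtr_gt0.
have uE : u = y ^+ 2 by rewrite sqr_sqrtr// ltW.
have z2 : z ^+ 2 = (v - u) / u by rewrite sqr_sqrtr// ltW.
have vE : v = y ^+ 2 * (1 + z ^+ 2) by rewrite z2 -uE; field; rewrite gt_eqF.
have -> : rsqrt (v - u) = (y * z)^-1.
  by rewrite vE uE (_ : _ - _ = (y * z) ^+ 2) ?rsqrt_sqr ?mulr_ge0 ?ltW//; ring.
have Du := cdist2_gt0 u0; have Dv := cdist2_gt0 v0.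
have DE : cdist2 v + (h - 1) ^+ 2 * z ^+ 2 = (1 + z ^+ 2) * cdist2 u.
  by rewrite {1}/cdist2 vE /cdist2 uE; ring.
have z1 : 1 + z ^+ 2 != 0 by rewrite gt_eqF// ltr_wpDr// sqr_ge0.
rewrite DE /abel_density' -/y.
have DvE : cdist2 v = (h - 1) ^+ 2 + 4 * h * (y ^+ 2 * (1 + z ^+ 2)) by rewrite {1}/cdist2 {1}vE.
have DuE : cdist2 u = (h - 1) ^+ 2 + 4 * h * y ^+ 2 by rewrite {1}/cdist2 uE.
move: cap_const => F0; move: Du Dv; rewrite DvE DuE => /lt0r_neq0 Du /lt0r_neq0 Dv.
rewrite vE uE.
have yn0 := lt0r_neq0 y0; have zn0 := lt0r_neq0 z0.
clearbody y z; clear - yn0 zn0 Du Dv z1.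
field.
by rewrite zn0 yn0 z1 Du Dv.
Qed.

Lemma smooth_change_abel_prim v : a < v ->
  smooth_change (fun u => - abel_prim v (Num.sqrt ((v - u) / u)))
    (fun u => abel_density' u * rsqrt (v - u)) a v.
Proof.
have [q0 h0 a0 a1] := hyp; move=> av; have v0 : 0 < v by lra.
split.
- apply: continuous_in_subspaceT => u /set_mem/=; rewrite in_itv/= => uv.
  have u0 : u != 0 by rewrite gt_eqF//; lra.
  apply: cvgN.
  apply: (@continuous_comp _ _ _ (fun u => Num.sqrt ((v - u) / u)) (abel_prim v)).
    apply: (@continuous_comp _ _ _ (fun u => (v - u) / u) (@Num.sqrt R)).
      exact: is_derive_continuous (is_derive_sub_div v u0).
    exact: sqrt_continuous.
  exact: is_derive_continuous (is_derive_abel_prim _ v0).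
- by move=> u; rewrite in_itv/= => uv; apply: is_derive_abel_prim_sqrt; lra.
- move=> u; rewrite in_itv/= => /andP[au uv].
  by rewrite mulr_gt0 ?abel_density'_gt0// rsqrt_gt0// subr_gt0.
- move=> u; rewrite in_itv/= => uv.
  apply: cvgM; first by apply: continuous_abel_density'; lra.
  apply: (@continuous_comp _ _ _ (fun u => v - u) (@rsqrt R)).
    by apply: is_derive_continuous.
  by apply: rsqrt_continuous; rewrite subr_gt0; lra.
Qed.

Let abel_primE v : abel_prim v (Num.sqrt ((v - a) / a)) =
  - abel_prim v (Num.sqrt ((v - v) / v)) - - abel_prim v (Num.sqrt ((v - a) / a)).
Proof.
have prim0 : abel_prim v 0 = 0 by rewrite /abel_prim !(mulr0, mul0r, atan0, subr0).
by rewrite subrr mul0r sqrtr0 prim0 oppr0 opprK add0r.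
Qed.

Lemma abel_prim_gt0 v : a < v -> 0 < abel_prim v (Num.sqrt ((v - a) / a)).
Proof. by move=> av; rewrite abel_primE subr_gt0; exact: (smooth_change_lt (smooth_change_abel_prim av)). Qed.

Lemma abel_solE v : a < v -> abel_sol v = (abel_prim v (Num.sqrt ((v - a) / a)))%:E.
Proof.
have [q0 h0 a0 a1] := hyp; move=> av; have v0 : 0 < v by lra.
rewrite /abel_sol (@integral_supp R a v); last first.
  move=> u [ua|vu]; first by rewrite /abel_source ltNge ua mul0r.
  by rewrite rsqrt_eq0 ?mulr0// subr_le0.
transitivity (\int[leb]_(u in `]a, v[) (abel_density' u * rsqrt (v - u))%:E)%E.
  apply: eq_integral => u /set_mem/=; rewrite in_itv/= => /andP[au _].
  by rewrite /abel_source au.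
rewrite [in RHS]abel_primE.
exact: (integral_derivative_oo (ltW av) (smooth_change_abel_prim av)).
Qed.

Lemma abel_sol_eq0 v : v <= a -> abel_sol v = 0%E.
Proof.
move=> va; rewrite /abel_sol integral0_eq// => u _; rewrite /abel_source.
case: ifPn => au; last by rewrite mul0r.
by rewrite rsqrt_eq0 ?mulr0//; lra.
Qed.
End equilibrium_abel.

(** * The potential in the variable of the Abel equation *)

Section equilibrium_potential.
Context (R : realType).
Local Notation leb := (@lebesgue_measure R).
Variables (q h a : R).
Hypothesis hyp : [/\ 0 < q, 0 < h, 0 < a & a < 1].
Implicit Types u v w : R.
Local Notation abel_sol := (abel_sol q h a).
Local Notation cap_const := (cap_const q h a).
Local Notation cdist2 := (cdist2 h).

(** Fubini, with the Abel equation for the inner integral. *)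
Lemma integral_abel_sol_kernel (k : R -> R) : (forall w, 0 <= k w) ->
  measurable_fun [set: R] k ->
  (\int[leb]_v (abel_sol v * \int[leb]_w (rsqrt (w - v) * k w)%:E) =
   \int[leb]_(w in `]a, +oo[) (pi * abel_density q h a w * k w)%:E)%E.
Proof.
move=> k0 mk.
pose k2 (z : R * R) := (abel_sol z.1 * (rsqrt (z.2 - z.1) * k z.2)%:E)%E.
have k20 z : (0 <= k2 z)%E by rewrite mule_ge0 ?(abel_sol_ge0 hyp)// lee_fin mulr_ge0 ?rsqrt_ge0.
have mk1 : measurable_fun [set: R * R] (fun z : R * R => k z.2).
  by apply: (measurableT_comp mk); exact: measurable_snd.
have mk2 : measurable_fun [set: R * R] k2.
  apply: emeasurable_funM.
    by apply: (measurableT_comp (measurable_abel_sol hyp)); exact: measurable_fst.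
  apply/measurable_EFinP; apply: measurable_funM => //.
  apply: measurable_fun_rsqrt; apply: measurable_funB; [exact: measurable_snd|exact: measurable_fst].
transitivity (\int[leb]_v \int[leb]_w k2 (v, w))%E.
  apply: eq_integral => v _; rewrite /k2/= ge0_integralZl ?(abel_sol_ge0 hyp)//.
  - apply/measurable_EFinP; apply: measurable_funM => //.
    by apply: measurable_fun_rsqrt; exact: measurable_funB.
  - by move=> w _; rewrite lee_fin mulr_ge0 ?rsqrt_ge0.
rewrite fubini_tonelli// [RHS]integral_mkcond.
apply: eq_integral => w _; rewrite /k2/= patchE mem_setE in_itv/= andbT.
transitivity (\int[leb]_v (abel_sol v * (rsqrt (w - v))%:E * (k w)%:E))%E.
  by apply: eq_integral => v _; rewrite -muleA -EFinM.
rewrite ge0_integralZr//.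
- by rewrite (abel_equation hyp) -EFinM; case: ifP => //; rewrite mul0r.
- apply: emeasurable_funM; first exact: measurable_abel_sol.
  by apply/measurable_EFinP; apply: measurable_fun_rsqrt; exact: measurable_funB.
- by move=> v _; rewrite mule_ge0 ?(abel_sol_ge0 hyp)// lee_fin rsqrt_ge0.
- by rewrite lee_fin.
Qed.

(** The potential of a circle, as given by [circle_average]. *)
Definition kernel v v' : \bar R :=
  (\int[leb]_w (rsqrt w * rsqrt (1 - w) * rsqrt (w - v) * rsqrt (w - v'))%:E)%E.

Let mB (b : R) : measurable_fun [set: R] (fun w : R => w - b).
Proof. exact: measurable_funB. Qed.
Let mB' (b : R) : measurable_fun [set: R] (fun w : R => b - w).
Proof. exact: measurable_funB. Qed.
Let mrs1 (b : R) : measurable_fun [set: R] (fun w : R => rsqrt (w - b)).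
Proof. exact: measurable_fun_rsqrt. Qed.
Let mrs2 (b : R) : measurable_fun [set: R] (fun w : R => rsqrt (b - w)).
Proof. exact: measurable_fun_rsqrt. Qed.

Let mrr (b : R) : measurable_fun [set: R] (fun w : R => rsqrt (1 - w) * rsqrt (w - b)).
Proof. by apply: measurable_funM; [exact: mrs2|exact: mrs1]. Qed.

Let mDV : measurable_fun [set: R] (fun w : R => (q * (h + 1) / cdist2 w)).
Proof.
apply: measurable_funM => //; apply: measurable_fun_inv.
by apply: measurable_funD => //; exact: measurable_funM.
Qed.

Lemma potential_kernel v' : (\int[leb]_v (abel_sol v * kernel v v') =
  \int[leb]_(w in `]a, +oo[) (pi * (cap_const - q * (h + 1) / cdist2 w) * (rsqrt (1 - w) * rsqrt (w - v')))%:E)%E.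
Proof.
have [_ _ a0 _] := hyp.
transitivity (\int[leb]_v (abel_sol v * \int[leb]_w (rsqrt (w - v) * (rsqrt w * rsqrt (1 - w) * rsqrt (w -
  v')))%:E))%E.
  apply: eq_integral => v _; congr (_ * _)%E; apply: eq_integral => w _; congr EFin; ring.
rewrite integral_abel_sol_kernel.
- apply: eq_integral => w /set_mem/=; rewrite in_itv/= andbT => aw.
  have sw : Num.sqrt w != 0 by rewrite gt_eqF// sqrtr_gt0; lra.
  by rewrite /abel_density {1}/rsqrt; congr EFin; set X := cap_const - _; field.
- by move=> w; rewrite !mulr_ge0 ?rsqrt_ge0.
- apply: measurable_funM; last exact: mrs1.
  by apply: measurable_funM; [exact: measurable_rsqrt|exact: mrs2].
Qed.

(** The field of the charge is an Abel integral with the same kernel as the potential; it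
    is computed by [abel_kernel_integral]. *)
Let Qint v' : 0 <= v' < 1 -> 0 < cdist2 v' ->
  (\int[leb]_w (pi * (q * (h + 1) / cdist2 w) * (rsqrt (1 - w) * rsqrt (w - v')))%:E =
   (pi ^+ 2 * (q * rsqrt (cdist2 v')))%:E)%E.
Proof.
have [q0 h0 a0 _] := hyp; move=> /andP[v'0 v'1] D0.
have D1 : 0 < cdist2 1 by rewrite cdist2_1 exprn_gt0//; lra.
transitivity (\int[leb]_w ((pi * (q * (h + 1)))%:E * (rsqrt (1 - w) * rsqrt (w - v') / (cdist2 w))%:E))%E.
  by apply: eq_integral => w _; rewrite -EFinM; congr EFin; ring.
have c0 : 0 <= pi * (q * (h + 1)) by rewrite !mulr_ge0 ?pi_ge0//; lra.
rewrite ge0_integralZl_EFin//.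
- have := @abel_kernel_integral R ((h - 1) ^+ 2) (4 * h) v' 1 v'1 D0 D1.
  rewrite -/(cdist2 1) -/(cdist2 v') => ->; rewrite -EFinM; congr EFin.
  rewrite cdist2_1 rsqrt_sqr; last by lra.
  by move: (@pi R) => p; field; rewrite gt_eqF//; lra.
- move=> w _; rewrite lee_fin.
  have [w0|w0] := leP w v'; first by rewrite (@rsqrt_eq0 _ (w - v')) ?mulr0 ?mul0r// subr_le0.
  by rewrite divr_ge0 ?mulr_ge0 ?rsqrt_ge0// ltW// (cdist2_gt0 hyp)//; lra.
- apply/measurable_EFinP; apply: measurable_funM; first exact: mrr.
  apply: measurable_fun_inv; apply: measurable_funD => //; exact: measurable_funM.
Qed.

(** So is a constant. *)
Let Fint v' : v' < 1 ->
  (\int[leb]_w (pi * cap_const * (rsqrt (1 - w) * rsqrt (w - v')))%:E = (pi ^+ 2 * cap_const)%:E)%E.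
Proof.
move=> v'1; have FQ0 := cap_const_gt0 hyp.
under eq_integral do rewrite EFinM.
rewrite ge0_integralZl_EFin//.
- under eq_integral do rewrite mulrC.
  by rewrite abel_kernel_pi v'1 -EFinM; congr EFin; ring.
- by move=> w _; rewrite lee_fin mulr_ge0 ?rsqrt_ge0.
- by apply/measurable_EFinP; exact: mrr.
- by rewrite mulr_ge0 ?pi_ge0// ltW.
Qed.

Let P v' w := (if a < w then pi * (cap_const - q * (h + 1) / cdist2 w) else 0) * (rsqrt (1 - w) * rsqrt (w - v')).

Let P_ge0 v' w : 0 <= P v' w.
Proof.
rewrite /P mulr_ge0 ?mulr_ge0 ?rsqrt_ge0//; case: ifPn => // aw.
by rewrite mulr_ge0 ?pi_ge0// ltW// (cap_const_sub hyp).
Qed.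

Let mP v' : measurable_fun [set: R] (P v').
Proof.
apply: measurable_funM; last exact: mrr.
rewrite (_ : (fun w => _) = (fun w => pi * (cap_const - q * (h + 1) / cdist2 w)) \_ `]a, +oo[%classic); last first.
  by apply/funext => w; rewrite patchE mem_setE in_itv/= andbT.
apply: (measurable_restrictT (fun w => pi * (cap_const - q * (h + 1) / cdist2 w)) _).1; first exact: measurable_itv.
apply: measurable_funTS; apply: measurable_funM => //.
by apply: measurable_funB => //; exact: mDV.
Qed.

Let potE v' : (\int[leb]_v (abel_sol v * kernel v v') = \int[leb]_w (P v' w)%:E)%E.
Proof.
rewrite potential_kernel integral_mkcond; apply: eq_integral => w _.
by rewrite patchE mem_setE in_itv/= andbT /P; case: ifP => // _; rewrite mul0r.
Qed.

Let Qk v' w := pi * (q * (h + 1) / cdist2 w) * (rsqrt (1 - w) * rsqrt (w - v')).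

Let Qk_ge0 v' w : 0 <= v' -> 0 <= Qk v' w.
Proof.
have [q0 h0 a0 _] := hyp; move=> v'0.
have [w0|w0] := leP w v'; first by rewrite /Qk (@rsqrt_eq0 _ (w - v')) ?mulr0// subr_le0.
have Dw : 0 < cdist2 w by rewrite (cdist2_gt0 hyp)//; lra.
by rewrite /Qk !mulr_ge0 ?rsqrt_ge0 ?pi_ge0 ?invr_ge0//; lra.
Qed.

Let mQk v' : measurable_fun [set: R] (Qk v').
Proof.
apply: measurable_funM; last exact: mrr.
by apply: measurable_funM => //; exact: mDV.
Qed.

(** Potential, field and constant are integrals against the same nonnegative kernel, so
    their integrands can be compared: those of potential and field add up to that of the
    constant for [w > a]; for [w <= a] the potential contributes nothing and the field
    term is at least the constant one. *)
Lemma potential_ge v' : 0 <= v' < 1 -> 0 < cdist2 v' ->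
  ((pi ^+ 2 * cap_const)%:E <= \int[leb]_v (abel_sol v * kernel v v') + (pi ^+ 2 * (q * rsqrt (cdist2 v')))%:E)%E.
Proof.
have [q0 h0 a0 _] := hyp; move=> v'01 D0; have /andP[v'0 v'1] := v'01.
rewrite potE -(Qint v'01 D0) -(Fint v'1) -ge0_integralD//; last 4 first.
- by move=> w _; rewrite lee_fin.
- apply/measurable_EFinP; exact: mP.
- by move=> w _; rewrite lee_fin Qk_ge0.
- apply/measurable_EFinP; exact: mQk.
have FQ0 := cap_const_gt0 hyp.
apply: ge0_le_integral => //.
- move=> w _; rewrite lee_fin; apply: mulr_ge0; last by rewrite mulr_ge0 ?rsqrt_ge0.
  by apply: mulr_ge0; [exact: pi_ge0|exact: ltW].
- by apply/measurable_EFinP; apply: measurable_funM => //; exact: mrr.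
- by apply: emeasurable_funD; apply/measurable_EFinP; [exact: mP|exact: mQk].
move=> w _; rewrite -EFinD lee_fin -mulrDl.
have [w0|w0] := leP w v'; first by rewrite (@rsqrt_eq0 _ (w - v')) ?mulr0// subr_le0.
rewrite ler_wpM2r ?mulr_ge0 ?rsqrt_ge0//.
case: ifPn => aw; first by rewrite -mulrDr subrK.
rewrite add0r ler_wpM2l ?pi_ge0// -subr_le0.
by apply: (cap_const_sub_le hyp); [apply: (cdist2_gt0 hyp); lra|rewrite leNgt].
Qed.

(** If [a <= v'] the kernel vanishes on [w <= a], where the integrands in [potential_ge]
    differ. *)
Lemma potential_eq v' : a <= v' < 1 ->
  (\int[leb]_v (abel_sol v * kernel v v') + (pi ^+ 2 * (q * rsqrt (cdist2 v')))%:E = (pi ^+ 2 * cap_const)%:E)%E.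
Proof.
have [q0 h0 a0 _] := hyp; move=> /andP[av' v'1].
have v'01 : 0 <= v' < 1 by lra.
have D0 : 0 < cdist2 v' by apply: (cdist2_gt0 hyp); lra.
rewrite potE -(Qint v'01 D0) -(Fint v'1) -ge0_integralD//; last 4 first.
- by move=> w _; rewrite lee_fin.
- apply/measurable_EFinP; exact: mP.
- by move=> w _; rewrite lee_fin Qk_ge0//; lra.
- apply/measurable_EFinP; exact: mQk.
apply: eq_integral => w _; rewrite -EFinD -mulrDl; congr EFin.
have [w0|w0] := leP w v'; first by rewrite (@rsqrt_eq0 _ (w - v')) ?mulr0 ?mul0r ?mulr0// subr_le0.
by congr (_ * _); rewrite (le_lt_trans av' w0) -mulrDr subrK.
Qed.

(** The case of the point opposite to the charge ([v' = 1]), which has constant distance from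
    the points of each circle of latitude; this distance replaces [kernel]. *)
Lemma potential_eq1 :
  (\int[leb]_v (abel_sol v * (pi * rsqrt (1 - v))%:E) + (pi ^+ 2 * (q * rsqrt (cdist2 1)))%:E =
    (pi ^+ 2 * cap_const)%:E)%E.
Proof.
have [q0 h0 a0 a1] := hyp.
transitivity (pi%:E * \int[leb]_v (abel_sol v * (rsqrt (1 - v))%:E) + (pi ^+ 2 * (q * rsqrt (cdist2 1)))%:E)%E.
  congr (_ + _)%E; rewrite -ge0_integralZl_EFin ?pi_ge0//.
  - by apply: eq_integral => v _; rewrite EFinM muleCA.
  - by move=> v _; rewrite mule_ge0 ?(abel_sol_ge0 hyp)// lee_fin rsqrt_ge0.
  - by apply: emeasurable_funM; [exact: measurable_abel_sol|apply/measurable_EFinP; exact: mrs2].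
rewrite (abel_equation hyp) a1 -EFinM -EFinD; congr EFin.
rewrite /abel_density sqrtr1 cdist2_1 rsqrt_sqr; last by lra.
by move: cap_const (@pi R) => F p; field; rewrite gt_eqF//; lra.
Qed.

Lemma integral_abel_sol : (\int[leb]_(v in `]a, 1%R[) abel_sol v =
  \int[leb]_(w in `]a, 1%R[) (abel_density q h a w * rsqrt (1 - w))%:E)%E.
Proof.
have [q0 h0 a0 a1] := hyp; have pi0 := @pi_gt0 R.
have H := @integral_abel_sol_kernel (fun w => rsqrt (1 - w)) (fun w => rsqrt_ge0 _) (mrs2 1).
have L : (\int[leb]_v (abel_sol v * \int[leb]_w (rsqrt (w - v) * rsqrt (1 - w))%:E) =
    pi%:E * \int[leb]_(v in `]a, 1%R[) abel_sol v)%E.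
  transitivity (\int[leb]_(v in `]a, 1%R[) (pi%:E * abel_sol v))%E.
    rewrite [RHS]integral_mkcond; apply: eq_integral => v _.
    rewrite abel_kernel_pi patchE mem_setE in_itv/=.
    have [va|va] := leP v a; first by rewrite abel_sol_eq0// mul0e.
    by case: ifP => _; rewrite ?mule0// muleC.
  apply: ge0_integralZl_EFin => //.
  - by move=> v _; exact: (abel_sol_ge0 hyp).
  - by apply: measurable_funTS; exact: measurable_abel_sol.
  - exact: pi_ge0.
have L2 : (\int[leb]_(w in `]a, +oo[) (pi * abel_density q h a w * rsqrt (1 - w))%:E =
   pi%:E * \int[leb]_(w in `]a, 1%R[) (abel_density q h a w * rsqrt (1 - w))%:E)%E.
  transitivity (\int[leb]_(w in `]a, 1%R[) (pi%:E * (abel_density q h a w * rsqrt (1 - w))%:E))%E.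
    rewrite [LHS]integral_mkcond [RHS]integral_mkcond; apply: eq_integral => w _.
    rewrite !patchE !mem_setE !in_itv/= andbT.
    case: (a < w) => //=; case: ltP => w1; first by rewrite -EFinM -mulrA.
    by rewrite rsqrt_eq0 ?mulr0// subr_le0.
  apply: ge0_integralZl_EFin => //; last exact: pi_ge0.
  - move=> w; rewrite /= in_itv/= => /andP[aw _]; rewrite lee_fin.
    apply: mulr_ge0; last exact: rsqrt_ge0.
    by apply: mulr_ge0; [exact: sqrtr_ge0|exact/ltW/(cap_const_sub hyp)].
  - apply/measurable_EFinP; apply: measurable_funTS; apply: measurable_funM; last exact: mrs2.
    apply: measurable_funM; first by apply: measurable_fun_sqrt; exact: measurable_id.
    by apply: measurable_funB => //; exact: mDV.
move: H; rewrite L L2 => /(congr1 (fun x => pi^-1%:E * x)%E).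
have pn0 : pi != 0 :> R by rewrite gt_eqF.
by rewrite [LHS]muleA [RHS]muleA -EFinM mulVf// !mul1e.
Qed.

End equilibrium_potential.

(** * The density in the polar angle *)

Section density.
Context (R : realType).
Local Notation leb := (@lebesgue_measure R).
Implicit Types q h al phi : R.

Definition hav (phi : R) : R := (1 - cos phi) / 2.

Lemma hav_gt0 phi : 0 < phi <= pi -> 0 < hav phi.
Proof.
move=> /andP[p0 ppi]; rewrite /hav divr_gt0// subr_gt0 -cos0 ltr_cos// in_itv/= ?lexx ?pi_ge0//.
by rewrite ltW.
Qed.

Lemma hav_lt x y : 0 <= x -> x < y -> y <= pi -> hav x < hav y.
Proof.
move=> x0 xy ypi; rewrite /hav ltr_pM2r ?invr_gt0// ltrD2l ltrN2 ltr_cos//.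
  by rewrite in_itv/= x0 (le_trans (ltW xy)).
by rewrite in_itv/= ypi (le_trans x0 (ltW xy)).
Qed.

Lemma hav_pi : hav pi = 1.
Proof. by rewrite /hav cospi opprK -[1 + 1]/(2 : R) divff. Qed.

Lemma hav_cos phi : cos phi = 1 - 2 * hav phi.
Proof. by rewrite /hav; lra. Qed.

Lemma cdist2_hav h phi : cdist2 h (hav phi) = h ^+ 2 + 1 - 2 * h * cos phi.
Proof. by rewrite hav_cos /cdist2; ring. Qed.

Lemma F_Q_cap_const q h al : is_alpha0 q h al -> F_Q q h al = cap_const q h (hav al).
Proof. by move=> [_ ->]; rewrite /cap_const cdist2_hav mulrA. Qed.

Lemma hyp_of_alpha0 q h al : 0 < q -> 0 < h -> is_alpha0 q h al ->
  [/\ 0 < q, 0 < h, 0 < hav al & hav al < 1].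
Proof.
move=> q0 h0 [/andP[a0 api] _]; split=> //; first by apply: hav_gt0; rewrite a0 ltW.
by rewrite -hav_pi hav_lt// ltW.
Qed.

Lemma atan_inv (x : R) : 0 < x -> atan x^-1 = pi / 2 - atan x.
Proof.
move=> x0; have a0 : 0 < atan x by rewrite -atan0 lt_atan.
have a1 := atan_ltpi2 x.
have -> : x^-1 = tan (pi / 2 - atan x).
  rewrite -{1}[x]atanK /tan sinB cosB sin_pihalf cos_pihalf !mul1r !mul0r subr0 add0r.
  by rewrite invf_div.
by rewrite tanK// in_itv/=; lra.
Qed.

Lemma powR32 (x : R) : 0 < x -> x `^ (3 / 2) = Num.sqrt x ^+ 3.
Proof.
move=> x0; rewrite -(powR12_sqrt (ltW x0)) -powR_mulrn ?powR_ge0// -powRrM.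
by congr (_ `^ _); field.
Qed.

(** Once [atan] of a reciprocal is turned around by [atan_inv], both sides are the same
    combination of two arctangents with rational coefficients. *)
Lemma equilibrium_density_abel_prim q h al phi : 0 < q -> 0 < h -> is_alpha0 q h al ->
  al < phi <= pi ->
  equilibrium_density q h al phi =
  abel_prim q h (hav al) (hav phi) (Num.sqrt ((hav phi - hav al) / hav al)) / (2 * pi ^+ 2).
Proof.
move=> q0 h0 Hal /andP[aphi phipi].
have [_ _ a0 a1] := hyp_of_alpha0 q0 h0 Hal.
have [/andP[al0 alpi] _] := Hal.
rewrite /equilibrium_density /F_term (F_Q_cap_const Hal).
have av : hav al < hav phi by apply: hav_lt => //; exact: ltW.
have -> : 1 + h ^+ 2 - 2 * h * cos phi = cdist2 h (hav phi) by rewrite cdist2_hav; ring.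
have -> : (1 - cos al) / (cos al - cos phi) = ((hav phi - hav al) / hav al)^-1.
  by rewrite !hav_cos; field; rewrite !gt_eqF//; lra.
have -> : (cos al - cos phi) / (1 - cos al) = (hav phi - hav al) / hav al.
  by rewrite !hav_cos; field; rewrite !gt_eqF//; lra.
move: (hav al) (hav phi) a0 a1 av => a v a0 a1 av.
have x0 : 0 < (v - a) / a by rewrite divr_gt0// subr_gt0.
rewrite sqrtrV ?ltW//.
set z := Num.sqrt ((v - a) / a).
have z0 : 0 < z by rewrite sqrtr_gt0.
have z2 : z ^+ 2 = (v - a) / a by rewrite sqr_sqrtr// ltW.
have hyp : [/\ 0 < q, 0 < h, 0 < a & a < 1] by [].
have v0 : 0 < v by lra.
have Dv := cdist2_gt0 hyp v0; have Da := cdist2_gt0 hyp a0.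
have vE : v = a * (1 + z ^+ 2) by rewrite z2; field; rewrite gt_eqF.
rewrite powR32// atan_inv// /abel_prim [(h - 1) / _ * z]mulrAC.
set r := Num.sqrt (cdist2 h v).
have r0 : 0 < r by rewrite sqrtr_gt0.
set T := atan ((h - 1) * z / r).
have DE : cdist2 h v + (h - 1) ^+ 2 * z ^+ 2 = (1 + z ^+ 2) * cdist2 h a.
  by rewrite {1}/cdist2 vE /cdist2; ring.
have z1 : 1 + z ^+ 2 != 0 by rewrite gt_eqF// ltr_wpDr// sqr_ge0.
rewrite DE /cap_const.
have DvE : cdist2 h v = (h - 1) ^+ 2 + 4 * h * (a * (1 + z ^+ 2)) by rewrite {1}/cdist2 {1}vE.
have DaE : cdist2 h a = (h - 1) ^+ 2 + 4 * h * a by [].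
move: Da Dv; rewrite DvE DaE => /lt0r_neq0 Da /lt0r_neq0 Dv.
rewrite vE.
have zn0 := lt0r_neq0 z0; have rn0 := lt0r_neq0 r0; have an0 := lt0r_neq0 a0.
have := lt0r_neq0 (@pi_gt0 R); move: (@pi R) => p p0.
move: (atan z) T => A T.
clearbody z r; clear - zn0 rn0 an0 Da Dv z1 p0.
field.
by rewrite zn0 rn0 z1 Da Dv p0.
Qed.

Lemma is_derive_hav phi : is_derive phi (1:R) hav (sin phi / 2).
Proof.
by rewrite /hav; apply: is_derive_eq; rewrite /GRing.scale/=; field.
Qed.

Lemma smooth_change_hav (x y : R) : 0 <= x -> y <= pi ->
  smooth_change hav (fun phi => sin phi / 2) x y.
Proof.
move=> x0 ypi; apply: smooth_changeT.
- exact: is_derive_hav.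
- by move=> z; rewrite in_itv/= => zxy; rewrite divr_gt0// sin_gt0_pi//; lra.
- by move=> z; apply: is_derive_continuous.
Qed.

Lemma measurable_hav : measurable_fun [set: R] hav.
Proof. by apply: continuous_measurable => z; exact: is_derive_continuous (is_derive_hav z). Qed.

(** In the polar angle the integrand is the derivative of [Psi], by [is_derive_F_Q_num],
    and the increment of [Psi] is [pi / 2] by the definition of [F_Q].  This is the place
    where the total mass one enters. *)
Lemma integral_abel_density q h al : 0 < q -> 0 < h -> is_alpha0 q h al ->
  (\int[leb]_(w in `]hav al, 1%R[) (abel_density q h (hav al) w * rsqrt (1 - w))%:E =
  (pi / 2)%:E)%E.
Proof.
move=> q0 h0 Hal.
have hyp := hyp_of_alpha0 q0 h0 Hal; have [_ _ a0 a1] := hyp.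
have [/andP[al0 alpi] _] := Hal; have pi0 := @pi_gt0 R.
set a := hav al.
(* the integrand may be negative outside of ]a, 1[, and the change of variables asks for a
   nonnegative function on the whole line *)
pose G w := (Num.max 0 (abel_density q h a w * rsqrt (1 - w)))%:E.
have G0 w : (0 <= G w)%E by rewrite lee_fin le_max lexx.
have mG : measurable_fun [set: R] G.
  apply/measurable_EFinP; apply: measurable_maxr => //.
  apply: measurable_funM; last by apply: measurable_fun_rsqrt; exact: measurable_funB.
  apply: measurable_funM; first by apply: measurable_fun_sqrt; exact: measurable_id.
  apply: measurable_funB => //; apply: measurable_funM => //; apply: measurable_fun_inv.
  by apply: measurable_funD => //; exact: measurable_funM.
transitivity (\int[leb]_(w in `]hav al, hav pi[) G w)%E.
  rewrite hav_pi; apply: eq_integral => w /set_mem/=; rewrite in_itv/= => /andP[aw _].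
  rewrite /G max_r// !mulr_ge0 ?rsqrt_ge0 ?sqrtr_ge0// ltW// (cap_const_sub hyp)//.
rewrite (@integral_change_of_variables R hav (fun phi => sin phi / 2) al pi G)//; last 2 first.
- by apply: smooth_change_hav => //; exact: ltW.
- exact: measurable_hav.
pose Psi t := (cap_const q h a * (t - sin t) + F_Q_num q h t) / 2.
pose Psi' t := (cap_const q h a - q * (h + 1) / (h ^+ 2 + 1 - 2 * h * cos t)) * (1 - cos t) / 2.
transitivity (\int[leb]_(t in `]al, pi[) (Psi' t)%:E)%E.
  apply: eq_integral => t /set_mem/=; rewrite in_itv/= => /andP[at0 tpi].
  rewrite /G -EFinM; congr EFin.
  have t0 : 0 < t by lra.
  have av : a < hav t by apply: hav_lt => //; exact: ltW.
  have F0 := cap_const_sub hyp av.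
  rewrite max_r; last by rewrite !mulr_ge0 ?rsqrt_ge0 ?sqrtr_ge0// ltW.
  rewrite /abel_density cdist2_hav /Psi'.
  have s0 : 0 < sin (t / 2) by apply: sin_half_gt0; lra.
  have c0 : 0 < cos (t / 2) by apply: cos_gt0_pihalf; lra.
  have -> : Num.sqrt (hav t) = sin (t / 2).
    by rewrite /hav cos_half (_ : _ / 2 = sin (t / 2) ^+ 2) ?sqrtr_sqr ?gtr0_norm//; field.
  have -> : rsqrt (1 - hav t) = (cos (t / 2))^-1.
    rewrite /hav cos_half (_ : 1 - _ = cos (t / 2) ^+ 2) ?rsqrt_sqr// ?ltW//.
    by rewrite cos2sin2; field.
  set X := cap_const _ _ _ - _.
  rewrite [sin t]sin_half [X in _ = _ * (1 - X) / 2]cos_half; field; rewrite gt_eqF//.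
have -> : pi / 2 = Psi pi - Psi al.
  rewrite /Psi sinpi.
  have Npi : F_Q_num q h pi = pi.
    have := angle_eq_pi q h; rewrite /angle_eq sinpi subrr addr0 mulr0 subr0 //.
  have := F_Q_numE q al (lt0r_neq0 h0); rewrite (F_Q_cap_const Hal) -/a => ->.
  rewrite Npi; have : 0 < pi - al + sin al by apply: pi_sub_add_sin_gt0; lra.
  by move: (@pi R) (sin al) (F_Q_num q h al) => p s N D0; field; rewrite gt_eqF.
apply: (@integral_derivative_oo R Psi Psi' al pi (ltW alpi)).
have dPsi t : 0 < t <= pi -> is_derive t (1:R) Psi (Psi' t).
  move=> t0; have dN := is_derive_F_Q_num q h0 t0.
  have E0 : h ^+ 2 + 1 - 2 * h * cos t != 0 by rewrite gt_eqF// dist2_gt0//; lra.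
  apply: is_derive_eq; rewrite /GRing.scale/= /Psi'.
  by field.
split.
- apply: continuous_in_subspaceT => u /set_mem/=; rewrite in_itv/= => uw.
  by apply: (is_derive_continuous (dPsi _ _)); lra.
- by move=> u; rewrite in_itv/= => uw; apply: dPsi; lra.
- move=> t; rewrite in_itv/= => /andP[at0 tpi].
  have av : a < hav t by apply: hav_lt => //; exact: ltW.
  have := cap_const_sub hyp av; rewrite cdist2_hav => F0.
  have v0 : 0 < hav t by apply: hav_gt0; lra.
  rewrite /Psi' divr_gt0// mulr_gt0//; move: v0; rewrite /hav; lra.
- move=> t; rewrite in_itv/= => tt.
  have E0 : h ^+ 2 + 1 - 2 * h * cos t != 0 by rewrite gt_eqF// dist2_gt0//; lra.
  by rewrite /Psi'; apply: is_derive_continuous.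
Qed.
End density.

(** * The sphere and the Coulomb kernel *)

Section sphere_geometry.
Context (R : realType).
Local Notation leb := (@lebesgue_measure R).
Implicit Types (x y : R3 R) (t phi r : R).

Definition norm2 x : R := x.1.1 ^+ 2 + x.1.2 ^+ 2 + x.2 ^+ 2.

Lemma enormE x : enorm x = Num.sqrt (norm2 x). Proof. by []. Qed.
Lemma norm2_ge0 x : 0 <= norm2 x.
Proof. by rewrite !addr_ge0 ?sqr_ge0. Qed.

Lemma sphere2P x : sphere2 x <-> norm2 x = 1.
Proof.
rewrite /sphere2/= enormE; split=> [e|->]; last by rewrite sqrtr1.
by rewrite -(sqr_sqrtr (norm2_ge0 x)) e expr1n.
Qed.

Lemma norm2_spherical t phi : norm2 (spherical 1 t phi) = 1.
Proof.
rewrite /norm2 /spherical/= !mul1r !exprMn.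
have := cos2Dsin2 t; have := cos2Dsin2 phi => h1 h2.
by rewrite -mulrDr h2 mulr1 addrC.
Qed.

Lemma sphere2_spherical t phi : sphere2 (spherical 1 t phi).
Proof. by apply/sphere2P; exact: norm2_spherical. Qed.

Lemma circle_param (c s : R) : c ^+ 2 + s ^+ 2 = 1 ->
  exists2 t, 0 <= t <= 2 * pi & c = cos t /\ s = sin t.
Proof.
move=> cs; have pi0 := @pi_gt0 R.
have c1 : -1 <= c <= 1.
  have : c ^+ 2 <= 1 by have := sqr_ge0 s; lra.
  by move=> H; apply/andP; split; nra.
have ac0 := acos_ge0 c1; have ac1 := acos_lepi c1.
have cK : cos (acos c) = c by rewrite acosK.
have sK := sin_acos c1.
have s2 : 1 - c ^+ 2 = s ^+ 2 by lra.
rewrite s2 sqrtr_sqr in sK.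
have [s0|s0] := leP 0 s.
  by exists (acos c); [lra|rewrite sK ger0_norm].
exists (2 * pi - acos c); first by lra.
have -> : 2 * pi - acos c = - acos c + pi *+ 2 by rewrite addrC mulr_natl.
by rewrite cosD2pi sinD2pi cosN sinN cK sK ltr0_norm// opprK.
Qed.

Lemma spherical_param x : sphere2 x -> exists t phi,
  [/\ 0 <= t <= 2 * pi, 0 <= phi <= pi & x = spherical 1 t phi].
Proof.
move=> /sphere2P; case: x => [[x1 x2] x3]; rewrite /norm2/= => n1.
have x31 : -1 <= x3 <= 1.
  have : x3 ^+ 2 <= 1 by have := sqr_ge0 x1; have := sqr_ge0 x2; lra.
  by move=> H; apply/andP; split; nra.
have pi0 := @pi_gt0 R.
pose phi := acos x3.
have cK : cos phi = x3 by rewrite acosK.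
have s0 : 0 <= sin phi by rewrite sin_acos// sqrtr_ge0.
have s2 : sin phi ^+ 2 = x1 ^+ 2 + x2 ^+ 2 by rewrite sin2cos2 cK; lra.
have ph : 0 <= phi <= pi by rewrite acos_ge0// acos_lepi.
have [sz|sn] := eqVneq (sin phi) 0.
  exists 0, phi; split=> //; first by lra.
  move: s2; rewrite sz expr0n/= => /esym/eqP; rewrite paddr_eq0 ?sqr_ge0// !sqrf_eq0.
  by move=> /andP[/eqP -> /eqP ->]; rewrite /spherical sz cK !mulr0 !mul0r mul1r.
have [|t t2 [ct st]] := @circle_param (x1 / sin phi) (x2 / sin phi).
  by rewrite !expr_div_n -mulrDl -s2 divff// sqrf_eq0.
exists t, phi; split=> //; rewrite /spherical !mul1r cK -ct -st.
by congr (_, _, _); field.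
Qed.

Lemma sin_hav phi : 0 <= phi <= pi -> sin phi = 2 * Num.sqrt (hav phi * (1 - hav phi)).
Proof.
move=> /andP[p0 ppi]; have s0 : 0 <= sin phi by apply: sin_ge0_pi; rewrite p0.
have -> : hav phi * (1 - hav phi) = (sin phi / 2) ^+ 2.
  by rewrite expr_div_n sin2cos2 /hav; field.
by rewrite sqrtr_sqr ger0_norm ?divr_ge0//; field.
Qed.

Lemma hav_01 phi : 0 <= hav phi <= 1.
Proof. by rewrite /hav; have := cos_le1 phi; have := cos_geN1 phi; lra. Qed.

(** This form of the squared distance is the one to which [circle_average] applies. *)
Lemma norm2_spherical_sub t phi t' phi' : 0 <= phi <= pi -> 0 <= phi' <= pi ->
  norm2 (spherical 1 t phi - spherical 1 t' phi') =
  4 * (hav phi' * (1 - hav phi) + hav phi * (1 - hav phi') -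
    2 * Num.sqrt (hav phi' * (1 - hav phi)) * Num.sqrt (hav phi * (1 - hav phi')) * cos (t' - t)).
Proof.
move=> p p'; have := hav_01 phi; have := hav_01 phi' => v01' v01.
have -> : norm2 (spherical 1 t phi - spherical 1 t' phi') =
   2 - 2 * (sin phi * sin phi') * cos (t' - t) - 2 * (cos phi * cos phi').
  rewrite /norm2 /spherical/= !mul1r cosB.
  have c1 := cos2sin2 t; have c2 := cos2sin2 t'; have c3 := cos2sin2 phi; have c4 := cos2sin2 phi'.
  by ring : c1 c2 c3 c4.
have -> : sin phi * sin phi' = 4 * (Num.sqrt (hav phi' * (1 - hav phi)) * Num.sqrt (hav phi * (1 - hav phi'))).
  rewrite !sin_hav// -sqrtrM; last by rewrite mulr_ge0//; lra.
  rewrite mulrACA -sqrtrM; last by rewrite mulr_ge0//; lra.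
  by rewrite -natrM; congr (_ * Num.sqrt _); ring.
by rewrite !hav_cos; set X := Num.sqrt _; set Y := Num.sqrt _; ring.
Qed.

Lemma measurable_norm2_sub : measurable_fun [set: R3 R * R3 R] (fun z => norm2 (z.1 - z.2)).
Proof.
have mf d1 d2 (X : measurableType d1) (Y : measurableType d2) :
  measurable_fun [set: X * Y] fst by exact: measurable_fst.
have ms d1 d2 (X : measurableType d1) (Y : measurableType d2) :
  measurable_fun [set: X * Y] snd by exact: measurable_snd.
have m11 : measurable_fun [set: R3 R * R3 R] (fun z => z.1.1.1 - z.2.1.1).
  apply: measurable_funB.
    exact: (measurableT_comp (mf _ _ _ _) (measurableT_comp (mf _ _ _ _) (mf _ _ _ _))).
  exact: (measurableT_comp (mf _ _ _ _) (measurableT_comp (mf _ _ _ _) (ms _ _ _ _))).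
have m12 : measurable_fun [set: R3 R * R3 R] (fun z => z.1.1.2 - z.2.1.2).
  apply: measurable_funB.
    exact: (measurableT_comp (ms _ _ _ _) (measurableT_comp (mf _ _ _ _) (mf _ _ _ _))).
  exact: (measurableT_comp (ms _ _ _ _) (measurableT_comp (mf _ _ _ _) (ms _ _ _ _))).
have m2 : measurable_fun [set: R3 R * R3 R] (fun z => z.1.2 - z.2.2).
  apply: measurable_funB.
    exact: (measurableT_comp (ms _ _ _ _) (mf _ _ _ _)).
  exact: (measurableT_comp (ms _ _ _ _) (ms _ _ _ _)).
by apply: measurable_funD; [apply: measurable_funD|]; exact: measurable_funX.
Qed.

Definition coulomb x y : \bar R := ((enorm (x - y))%:E)^-1%E.

Lemma coulomb_neq0 x y : norm2 (x - y) != 0 -> coulomb x y = (rsqrt (norm2 (x - y)))%:E.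
Proof. by move=> n0; rewrite /coulomb inver enormE sqrtr_eq0 leNgt lt_neqAle eq_sym n0 norm2_ge0. Qed.

Lemma coulombE x y : coulomb x y = if norm2 (x - y) == 0 then +oo%E else (rsqrt (norm2 (x - y)))%:E.
Proof.
case: ifPn => [/eqP e|]; last exact: coulomb_neq0.
by rewrite /coulomb inver enormE e sqrtr0 eqxx.
Qed.

Lemma coulomb_ge0 x y : (0 <= coulomb x y)%E.
Proof. by rewrite coulombE; case: ifP => // _; rewrite ?leey ?lee_fin ?rsqrt_ge0. Qed.

Lemma coulombC x y : coulomb x y = coulomb y x.
Proof.
have -> : norm2 (x - y) = norm2 (y - x) -> coulomb x y = coulomb y x by move=> e; rewrite !coulombE e.
by [].
by rewrite /norm2/=; ring.
Qed.

Lemma measurable_coulomb : measurable_fun [set: R3 R * R3 R] (fun z => coulomb z.1 z.2).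
Proof.
under eq_fun do rewrite coulombE.
apply: measurable_fun_ifT => //.
  by apply: measurable_fun_eqr => //; exact: measurable_norm2_sub.
by apply/measurable_EFinP; apply: measurable_fun_rsqrt; exact: measurable_norm2_sub.
Qed.

Lemma measurable_spherical : measurable_fun [set: R * R] (fun z : R * R => spherical 1 z.2 z.1).
Proof.
have msin := @measurable_sin R; have mcos := @measurable_cos R.
have m1 (f : R -> R) : measurable_fun [set: R] f -> measurable_fun [set: R * R] (fun z => f z.1).
  by move=> mf; apply: (measurableT_comp mf); exact: measurable_fst.
have m2 (f : R -> R) : measurable_fun [set: R] f -> measurable_fun [set: R * R] (fun z => f z.2).
  by move=> mf; apply: (measurableT_comp mf); exact: measurable_snd.
apply: measurable_fun_pair; [apply: measurable_fun_pair|].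
- apply: measurable_funM; last exact: m2.
  by apply: measurable_funM => //; exact: m1.
- apply: measurable_funM; last exact: m2.
  by apply: measurable_funM => //; exact: m1.
- by apply: measurable_funM => //; exact: m1.
Qed.

End sphere_geometry.

(** * The candidate measure and its potential on the sphere *)

Section equilibrium_measure.
Context (R : realType).
Local Notation leb := (@lebesgue_measure R).
Variables (q h al : R).
Hypotheses (params : (0 < q) /\ (0 < h)) (Hal : is_alpha0 q h al).
Implicit Types (v t phi : R).
Local Notation a := (hav al).
Local Notation abel_sol := (abel_sol q h a).

Let hyp : [/\ 0 < q, 0 < h, 0 < a & a < 1].
Proof. by case: params => q0 h0; exact: hyp_of_alpha0 q0 h0 Hal. Qed.

Let al0pi : 0 < al < pi. Proof. by case: Hal. Qed.

(** The density of the candidate as a function of [v = (1 - cos phi) / 2]. *)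
Definition rho v : R := fine (abel_sol v) / (2 * pi ^+ 2).

Lemma rho_ge0 v : 0 <= rho v.
Proof. by rewrite /rho divr_ge0 ?fine_ge0 ?(abel_sol_ge0 hyp)// mulr_ge0// sqr_ge0. Qed.

Lemma abel_sol_rho v : abel_sol v = (2 * pi ^+ 2 * rho v)%:E.
Proof.
have p0 : 2 * pi ^+ 2 != 0 :> R by rewrite mulf_neq0 ?expf_neq0 ?gt_eqF ?pi_gt0.
rewrite /rho mulrC divfK// fineK//.
have [va|av] := leP v a; first by rewrite abel_sol_eq0.
by rewrite (abel_solE hyp).
Qed.

Lemma rho_gt0 v : a < v -> 0 < rho v.
Proof.
move=> av; rewrite /rho (abel_solE hyp)//= divr_gt0 ?(abel_prim_gt0 hyp)// mulr_gt0// exprn_gt0// pi_gt0 //.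
Qed.

Lemma measurable_rho : measurable_fun [set: R] rho.
Proof.
apply: measurable_funM => //.
apply: (measurableT_comp (fine_measurable measurableT)).
exact: (measurable_abel_sol hyp).
Qed.

(** The weight in the plane of the angles; the coordinates are in the order of integration,
    polar angle first. *)
Definition cap_weight (z : R * R) : R :=
  if (al < z.1 < pi) && (0 < z.2 < 2 * pi) then rho (hav z.1) * sin z.1 else 0.

Lemma cap_weight_ge0 z : 0 <= cap_weight z.
Proof.
rewrite /cap_weight; case: ifPn => // /andP[/andP[h1 h2] _].
rewrite mulr_ge0 ?rho_ge0//; apply: sin_ge0_pi; have := al0pi; lra.
Qed.

Lemma measurable_cap_weight : measurable_fun [set: R * R] cap_weight.
Proof.
have mrs : measurable_fun [set: R] (fun phi => rho (hav phi) * sin phi).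
  apply: measurable_funM; first exact: (measurableT_comp measurable_rho (@measurable_hav R)).
  exact: measurable_sin.
apply: measurable_fun_ifT => //; last first.
  by apply: (measurableT_comp mrs); exact: measurable_fst.
have mf : measurable_fun [set: R * R] (fun z : R * R => z.1) by exact: measurable_fst.
have ms : measurable_fun [set: R * R] (fun z : R * R => z.2) by exact: measurable_snd.
by do 2?apply: measurable_and; apply: measurable_fun_ltr.
Qed.

Definition cap_measure : set (R3 R) -> \bar R :=
  weighted_image (leb \x leb)%E cap_weight_ge0 measurable_cap_weight (@measurable_spherical R).

HB.instance Definition _ := Measure.on cap_measure.

Lemma integral_cap_measure (g : R3 R -> \bar R) : (forall x, 0 <= g x)%E ->
  measurable_fun [set: R3 R] g ->
  (\int[cap_measure]_x g x = \int[leb]_(phi in `]al, pi[)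
    ((rho (hav phi) * sin phi)%:E *
     \int[leb]_(t in `]0%R, (2 * pi)%R[) g (spherical 1 t phi)))%E.
Proof.
move=> g0 mg; rewrite integral_weighted_image//.
have mgs : measurable_fun [set: R * R] (fun z : R * R => g (spherical 1 z.2 z.1)).
  exact: (measurableT_comp mg (@measurable_spherical R)).
rewrite fubini_tonelli1//; last 2 first.
- apply: emeasurable_funM => //; apply/measurable_EFinP; exact: measurable_cap_weight.
- by move=> z; rewrite mule_ge0// lee_fin cap_weight_ge0.
rewrite [RHS]integral_mkcond; apply: eq_integral => phi _.
rewrite /fubini_F/= patchE mem_setE in_itv/=.
case: ifPn => phia; last first.
  by rewrite integral0_eq// => t _; rewrite /cap_weight/= (negbTE phia) mul0e.
rewrite -ge0_integralZl_EFin//.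
- rewrite [RHS]integral_mkcond; apply: eq_integral => t _.
  rewrite patchE mem_setE in_itv/= /cap_weight/= phia/=.
  by case: ifP => // _; rewrite mul0e.
- apply: measurable_funTS.
  by apply: (measurableT_comp mgs (pair1_measurable phi)).
- rewrite mulr_ge0 ?rho_ge0//; apply: sin_ge0_pi; have := al0pi; lra.
Qed.

Lemma integral_hav (H : R -> \bar R) : (forall v, 0 <= H v)%E ->
  measurable_fun [set: R] H ->
  (\int[leb]_(phi in `]al, pi[) ((sin phi / 2)%:E * H (hav phi)) =
   \int[leb]_(v in `]a, 1%R[) H v)%E.
Proof.
have /andP[al0 alpi] := al0pi; move=> H0 mH.
have gc := @smooth_change_hav R al pi (ltW al0) (lexx _).
have := integral_change_of_variables alpi gc (@measurable_hav R) H0 mH.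
by rewrite hav_pi => ->.
Qed.

(** In the variable [v] the mass is the integral of [abel_sol], which [integral_abel_sol]
    expresses by its Abel transform. *)
Lemma cap_measure_setT : cap_measure [set: R3 R] = 1%E.
Proof.
have /andP[al0 alpi] := al0pi; have pi0 := @pi_gt0 R.
have -> : cap_measure [set: R3 R] = (\int[cap_measure]_x (cst 1 x))%E by rewrite integral_cst// mul1e.
rewrite integral_cap_measure//.
transitivity (\int[leb]_(phi in `]al, pi[) ((sin phi / 2)%:E * ((2 / pi)%:E * abel_sol (hav phi))))%E.
  apply: eq_integral => phi _.
  have -> : (\int[leb]_(t in `]0%R, (2 * pi)%R[) cst 1 (spherical 1 t phi) = (2 * pi)%:E)%E.
    rewrite integral_cst//= mul1e [LHS]lebesgue_measure_itv/= lte_fin mulr_gt0//=.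
    by rewrite oppr0 adde0.
  rewrite abel_sol_rho -!EFinM; congr EFin; move: (rho _) (sin _) => r s.
  by move: (@pi R) pi0 => p p0; field; rewrite gt_eqF.
rewrite (@integral_hav (fun v => (2 / pi)%:E * abel_sol v)%E); last 2 first.
- by move=> v; rewrite mule_ge0 ?(abel_sol_ge0 hyp)// lee_fin divr_ge0// ltW.
- by apply: measurable_funeM; exact: (measurable_abel_sol hyp).
rewrite ge0_integralZl_EFin//; last 3 first.
- by move=> v _; exact: (abel_sol_ge0 hyp).
- by apply: measurable_funTS; exact: (measurable_abel_sol hyp).
- by rewrite divr_ge0// ltW.
rewrite (integral_abel_sol hyp) integral_abel_density//; [|exact: params.1|exact: params.2].
rewrite -EFinM; congr EFin; move: (@pi R) pi0 => p p0; field; rewrite gt_eqF//.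
Qed.

HB.instance Definition _ := Measure_isProbability.Build _ _ _ cap_measure cap_measure_setT.

Definition cap_probability : probability (R3 R) R := cap_measure.

End equilibrium_measure.

Section equilibrium_potential_sphere.
Context (R : realType).
Local Notation leb := (@lebesgue_measure R).
Variables (q h al : R).
Hypotheses (params : (0 < q) /\ (0 < h)) (Hal : is_alpha0 q h al).
Implicit Types (v t phi : R) (x y : R3 R).
Local Notation a := (hav al).
Local Notation abel_sol := (abel_sol q h a).
Local Notation rho := (rho q h al).
Local Notation cap_prob := (cap_probability params Hal).

Let hyp : [/\ 0 < q, 0 < h, 0 < a & a < 1].
Proof. by case: params => q0 h0; exact: hyp_of_alpha0 q0 h0 Hal. Qed.

Let al0pi : 0 < al < pi. Proof. by case: Hal. Qed.

Lemma measurable_coulomb1 x : measurable_fun [set: R3 R] (coulomb x).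
Proof.
exact: (measurableT_comp (@measurable_coulomb R) (pair1_measurable x)).
Qed.

Lemma hav_inj phi phi' : 0 <= phi <= pi -> 0 <= phi' <= pi -> phi != phi' ->
  hav phi != hav phi'.
Proof.
move=> /andP[p0 p1] /andP[p0' p1']; rewrite neq_lt => /orP[lt|lt].
  by rewrite lt_eqF// hav_lt.
by rewrite gt_eqF// hav_lt.
Qed.

Lemma norm2_sub_neq0 t phi t' phi' : 0 <= phi <= pi -> 0 <= phi' <= pi -> phi != phi' ->
  norm2 (spherical 1 t phi - spherical 1 t' phi') != 0.
Proof.
move=> p p' pp'; have := hav_inj p p' pp'.
apply: contra_neq; rewrite /norm2 => e.
have /eqP : (spherical 1 t phi - spherical 1 t' phi').2 ^+ 2 = 0.
  apply/eqP; rewrite eq_le sqr_ge0 andbT -{1}e lerDr addr_ge0 ?sqr_ge0//.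
by rewrite sqrf_eq0 /spherical/= !mul1r subr_eq0 !hav_cos => /eqP; lra.
Qed.

Lemma circle_coulomb t phi t' phi' : 0 <= t <= 2 * pi -> 0 <= phi < pi -> 0 <= phi' < pi ->
  phi != phi' ->
  (\int[leb]_(s in `]0%R, (2 * pi)%R[) coulomb (spherical 1 t phi) (spherical 1 s phi') =
   kernel (hav phi') (hav phi))%E.
Proof.
move=> t2 /andP[p0 p1] /andP[p0' p1'] pp'.
have p : 0 <= phi <= pi by rewrite p0 ltW.
have p' : 0 <= phi' <= pi by rewrite p0' ltW.
rewrite /kernel -(@circle_average R (hav phi') (hav phi) t)//.
- apply: eq_integral => s _; rewrite coulomb_neq0 ?norm2_sub_neq0//.
  by rewrite norm2_spherical_sub.
- by have := hav_01 phi'; have := hav_lt p0' p1' (lexx _); rewrite hav_pi; lra.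
- by have := hav_01 phi; have := hav_lt p0 p1 (lexx _); rewrite hav_pi; lra.
- by rewrite eq_sym hav_inj.
Qed.

Lemma circle_coulomb_pi t phi' : 0 <= t <= 2 * pi -> 0 <= phi' < pi ->
  (\int[leb]_(s in `]0%R, (2 * pi)%R[) coulomb (spherical 1 t pi) (spherical 1 s phi') =
   (pi * rsqrt (1 - hav phi'))%:E)%E.
Proof.
move=> t2 /andP[p0' p1']; have pi0 := @pi_gt0 R.
have p' : 0 <= phi' <= pi by rewrite p0' ltW.
have p : 0 <= (pi : R) <= pi by rewrite lexx ltW.
have v1 : hav phi' < 1 by rewrite -(hav_pi R) hav_lt.
transitivity (\int[leb]_(s in `]0%R, (2 * pi)%R[) (cst (rsqrt (1 - hav phi') / 2)%:E s))%E.
  apply: eq_integral => s _; rewrite coulomb_neq0 ?norm2_sub_neq0 ?gt_eqF//.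
  rewrite norm2_spherical_sub// hav_pi subrr mulr0 sqrtr0 !(mulr0, mul0r) subr0 add0r mul1r.
  by rewrite mulrC (_ : 4 = 2 ^+ 2 :> R) ?rsqrt_sqrM ?subr_gt0//; ring.
rewrite integral_cst//= [X in (_ * X)%E]lebesgue_measure_itv/= lte_fin mulr_gt0//= oppr0 adde0.
by rewrite -EFinM; congr EFin; field.
Qed.

(** The exceptional angle [phi0] is there because [circle_average] does not cover the circle
    through the point at which the potential is taken. *)
Lemma integral_cap_measure_zonal (g : R3 R -> \bar R) (K : R -> \bar R) phi0 :
  (forall x, 0 <= g x)%E -> measurable_fun [set: R3 R] g ->
  (forall v, 0 <= K v)%E -> measurable_fun [set: R] K -> (forall v, 1 <= v -> K v = 0%E) ->
  (forall phi, al < phi < pi -> phi != phi0 ->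
    (\int[leb]_(s in `]0%R, (2 * pi)%R[) g (spherical 1 s phi) = K (hav phi))%E) ->
  (\int[cap_prob]_y g y = ((pi ^+ 2)^-1)%:E * \int[leb]_v (abel_sol v * K v))%E.
Proof.
move=> g0 mg K0 mK K1 gK; have pi0 := @pi_gt0 R; have /andP[al0 alpi] := al0pi.
have p2 : 0 <= (pi ^+ 2)^-1 :> R by rewrite invr_ge0 sqr_ge0.
rewrite integral_cap_measure//.
pose H v := (((pi ^+ 2)^-1)%:E * (abel_sol v * K v))%E.
have fK0 v : (0 <= abel_sol v * K v)%E by rewrite mule_ge0 ?(abel_sol_ge0 hyp).
have mfK : measurable_fun [set: R] (fun v => abel_sol v * K v)%E.
  by apply: emeasurable_funM => //; exact: (measurable_abel_sol hyp).
have H0 v : (0 <= H v)%E by rewrite mule_ge0// lee_fin.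
have mH : measurable_fun [set: R] H by exact: measurable_funeM.
have mD : measurable (`]al, pi[%classic `\ phi0 : set R).
  by apply: measurableD => //; exact: measurable_set1.
have mHs D : measurable_fun D (fun phi => (sin phi / 2)%:E * H (hav phi))%E.
  apply: measurable_funTS; apply: emeasurable_funM.
    apply/measurable_EFinP; apply: measurable_funM => //.
    exact: measurable_sin.
  exact: (measurableT_comp mH (@measurable_hav R)).
have E : {in `]al, pi[%classic `\ phi0, (fun phi => (sin phi / 2)%:E * H (hav phi))%E =1
   (fun phi => (rho (hav phi) * sin phi)%:E *
     \int[leb]_(t in `]0%R, (2 * pi)%R[) g (spherical 1 t phi))%E}.
  move=> phi /set_mem [] /=; rewrite in_itv/= => phia /eqP pn0.
  rewrite gK// /H !muleA; congr (_ * _)%E; rewrite abel_sol_rho// -!EFinM; congr EFin.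
  move: (rho _) (sin _) (@pi R) pi0 => r s p p0; field; rewrite gt_eqF//.
rewrite -(@integral_setD1 R _ phi0)//; last first.
  by apply: eq_measurable_fun E _; exact: mHs.
transitivity (\int[leb]_(phi in `]al, pi[%classic `\ phi0) ((sin phi / 2)%:E * H (hav phi)))%E.
  by apply: eq_integral => phi /E.
rewrite integral_setD1// (integral_hav Hal)//.
rewrite /H ge0_integralZl_EFin//; last first.
  exact: measurable_funTS.
congr (_ * _)%E; rewrite [RHS](@integral_supp R a 1)// => v [va|v1].
  by rewrite abel_sol_eq0// mul0e.
by rewrite K1// mule0.
Qed.

Lemma potential_spherical t phi' : 0 <= t <= 2 * pi -> 0 <= phi' < pi ->
  (\int[cap_prob]_y coulomb (spherical 1 t phi') y =
   ((pi ^+ 2)^-1)%:E * \int[leb]_v (abel_sol v * kernel v (hav phi')))%E.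
Proof.
move=> t2 phi'0; have /andP[al0 alpi] := al0pi.
apply: (@integral_cap_measure_zonal _ (fun v => kernel v (hav phi')) phi').
- by move=> y; exact: coulomb_ge0.
- exact: measurable_coulomb1.
- by move=> v; apply: integral_ge0 => w _; rewrite lee_fin !mulr_ge0 ?rsqrt_ge0.
- apply: (@measurable_fun_fubini_tonelli_F _ _ _ _ _ leb
    (fun z : R * R => (rsqrt z.2 * rsqrt (1 - z.2) * rsqrt (z.2 - z.1) * rsqrt (z.2 - hav phi'))%:E)).
    have mf : measurable_fun [set: R * R] (fun z : R * R => z.1) by exact: measurable_fst.
    have ms : measurable_fun [set: R * R] (fun z : R * R => z.2) by exact: measurable_snd.
    apply/measurable_EFinP.
    do 3?[apply: measurable_funM; last by apply: measurable_fun_rsqrt; exact: measurable_funB].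
    exact: measurable_fun_rsqrt.
  by move=> z; rewrite lee_fin !mulr_ge0 ?rsqrt_ge0.
- move=> v v1; rewrite /kernel integral0_eq// => w _.
  have [w1|w1] := leP 1 w; first by rewrite (@rsqrt_eq0 _ (1 - w)) ?mulr0 ?mul0r//; lra.
  by rewrite (@rsqrt_eq0 _ (w - v)) ?mulr0 ?mul0r//; lra.
- move=> phi /andP[alphi phipi] pn0; rewrite circle_coulomb//; last by rewrite eq_sym.
  by rewrite phipi andbT; lra.
Qed.

Lemma potential_spherical_pi t : 0 <= t <= 2 * pi ->
  (\int[cap_prob]_y coulomb (spherical 1 t pi) y =
   ((pi ^+ 2)^-1)%:E * \int[leb]_v (abel_sol v * (pi * rsqrt (1 - v))%:E))%E.
Proof.
move=> t2; have /andP[al0 alpi] := al0pi.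
apply: (@integral_cap_measure_zonal _ (fun v => (pi * rsqrt (1 - v))%:E) pi).
- by move=> y; exact: coulomb_ge0.
- exact: measurable_coulomb1.
- by move=> v; rewrite lee_fin mulr_ge0 ?rsqrt_ge0 ?pi_ge0.
- apply/measurable_EFinP; apply: measurable_funM => //.
  by apply: measurable_fun_rsqrt; exact: measurable_funB.
- by move=> v v1; rewrite rsqrt_eq0 ?mulr0// subr_le0.
- move=> phi /andP[alphi phipi] pn0; rewrite circle_coulomb_pi//.
  by rewrite phipi andbT; lra.
Qed.

Local Notation Q := (point_charge_field q h).
Local Notation cap_const := (cap_const q h a).

Lemma field_spherical t phi : Q (spherical 1 t phi) =
  if cdist2 h (hav phi) == 0 then +oo%E else (q * rsqrt (cdist2 h (hav phi)))%:E.
Proof.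
have [q0 h0 _ _] := hyp.
have NE : norm2 (spherical 1 t phi - (0, 0, h)) = cdist2 h (hav phi).
  have := norm2_spherical t phi; rewrite cdist2_hav /norm2 /spherical/= => n1.
  have -> : (1 * cos phi - h) ^+ 2 = (1 * cos phi) ^+ 2 + h ^+ 2 - 2 * h * cos phi by ring.
  by rewrite !subr0; lra.
have D0 : 0 <= cdist2 h (hav phi) by rewrite -NE norm2_ge0.
rewrite /point_charge_field enormE NE inver sqrtr_eq0.
have [Dz|Dn] := eqVneq (cdist2 h (hav phi)) 0.
  by rewrite Dz lexx gt0_muley// lte_fin.
by rewrite leNgt lt_neqAle eq_sym Dn D0/= -EFinM.
Qed.

Lemma coulomb_potential_ge0 x : (0 <= \int[cap_prob]_y coulomb x y)%E.
Proof. by apply: integral_ge0 => y _; exact: coulomb_ge0. Qed.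

Let total_potentialE t phi : 0 <= t <= 2 * pi -> 0 <= phi <= pi -> cdist2 h (hav phi) != 0 ->
  (\int[cap_prob]_y coulomb (spherical 1 t phi) y + Q (spherical 1 t phi) = ((pi ^+ 2)^-1)%:E *
    ((if phi == pi then \int[leb]_v (abel_sol v * (pi * rsqrt (1 - v))%:E)
      else \int[leb]_v (abel_sol v * kernel v (hav phi))) +
     (pi ^+ 2 * (q * rsqrt (cdist2 h (hav phi))))%:E))%E.
Proof.
have [q0 h0 a0 a1] := hyp; have pi0 := @pi_gt0 R.
move=> t2 /andP[p0 ppi] Dn.
have c0 : pi ^+ 2 != 0 :> R by rewrite gt_eqF// exprn_gt0.
rewrite field_spherical (negbTE Dn) ge0_muleDr; last 2 first.
- case: eqP => _; apply: integral_ge0 => v _; rewrite mule_ge0 ?(abel_sol_ge0 hyp)//.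
    by rewrite lee_fin mulr_ge0 ?pi_ge0 ?rsqrt_ge0.
  by apply: integral_ge0 => w _; rewrite lee_fin !mulr_ge0 ?rsqrt_ge0.
- by rewrite lee_fin !mulr_ge0 ?rsqrt_ge0// ltW.
rewrite -EFinM mulKf//; congr (_ + _)%E.
have [->|pn] := eqVneq phi pi; first exact: potential_spherical_pi.
by apply: potential_spherical => //; rewrite p0 lt_neqAle pn.
Qed.

Let cap_const_scaled : cap_const%:E = (((pi ^+ 2)^-1)%:E * (pi ^+ 2 * cap_const)%:E)%E.
Proof. by rewrite -EFinM mulKf// gt_eqF// exprn_gt0// pi_gt0. Qed.

(** At the charge itself, if it lies on the sphere, the field is infinite; elsewhere this is
    [potential_ge], or [potential_eq1] at the opposite pole. *)
Lemma total_potential_ge x : sphere2 x -> (cap_const%:E <= \int[cap_prob]_y coulomb x y + Q x)%E.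
Proof.
have [q0 h0 a0 a1] := hyp; have pi0 := @pi_gt0 R.
move=> /spherical_param [t [phi [t2 ph ->]]]; have /andP[p0 ppi] := ph.
have [Dz|Dn] := eqVneq (cdist2 h (hav phi)) 0.
  rewrite field_spherical Dz eqxx addey ?leey//.
  by rewrite -ltNye (lt_le_trans _ (coulomb_potential_ge0 _)).
have D0 : 0 < cdist2 h (hav phi).
  rewrite lt_neqAle eq_sym Dn/= /cdist2; have := hav_01 phi => v01.
  by rewrite addr_ge0 ?sqr_ge0// !mulr_ge0//; lra.
rewrite total_potentialE// cap_const_scaled; apply: lee_wpmul2l.
  by rewrite lee_fin invr_ge0 sqr_ge0.
have [->|pn] := eqVneq phi pi; first by rewrite hav_pi (potential_eq1 hyp).
have {}ppi : phi < pi by rewrite lt_neqAle pn.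
apply: (potential_ge hyp) => //.
by have := hav_01 phi; have := hav_lt p0 ppi (lexx _); rewrite hav_pi; lra.
Qed.

Lemma total_potential_eq t phi : 0 <= t <= 2 * pi -> al <= phi <= pi ->
  (\int[cap_prob]_y coulomb (spherical 1 t phi) y + Q (spherical 1 t phi) = cap_const%:E)%E.
Proof.
have /andP[al0 alpi] := al0pi; move=> t2 /andP[alp ppi].
have D0 : 0 < cdist2 h (hav phi) by apply: (cdist2_gt0 hyp); apply: hav_gt0; lra.
have ph : 0 <= phi <= pi by lra.
rewrite (total_potentialE t2 ph (lt0r_neq0 D0)) cap_const_scaled; congr (_ * _)%E.
have [->|pn] := eqVneq phi pi; first by rewrite hav_pi (potential_eq1 hyp).
have {}ppi : phi < pi by rewrite lt_neqAle pn.
apply: (potential_eq hyp).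
have := @hav_lt R phi pi _ ppi (lexx _); rewrite hav_pi => ->; last by lra.
rewrite andbT; move: alp; rewrite le_eqVlt => /predU1P[->//|alp].
by rewrite ltW// hav_lt//; lra.
Qed.

End equilibrium_potential_sphere.

(** * Positive definiteness of the energy *)

Section bounded_functionals.
Context d (T : measurableType d) (R : realType).
Variable (S : set T).
Hypothesis mS : measurable S.
Implicit Types (f g : T -> R) (mu nu : probability T R).

Definition bounded_meas f := measurable_fun S f /\ exists M : R, forall x, S x -> `|f x| <= M.

Definition mean (mu : probability T R) f : R := (\int[mu]_(x in S) f x)%R.

Lemma bm_integrable mu f : bounded_meas f -> mu.-integrable S (EFin \o f).
Proof.
move=> [mf [M fM]]; apply: measurable_bounded_integrable => //.
  by rewrite (le_lt_trans (probability_le1 _ _))// ltry.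
exists M; split; first exact: num_real.
by move=> y My x Sx /=; rewrite (le_trans (fM x Sx))// ltW.
Qed.

Lemma bm_cst (c : R) : bounded_meas (cst c).
Proof. by split; [exact: measurable_cst|exists `|c|]. Qed.

Lemma bmD f g : bounded_meas f -> bounded_meas g -> bounded_meas (fun x => f x + g x).
Proof.
move=> [mf [M fM]] [mg [N gN]]; split; first exact: measurable_funD.
exists (M + N) => x Sx; rewrite (le_trans (ler_normD _ _))// lerD//; [exact: fM|exact: gN].
Qed.

Lemma bmM f g : bounded_meas f -> bounded_meas g -> bounded_meas (fun x => f x * g x).
Proof.
move=> [mf [M fM]] [mg [N gN]]; split; first exact: measurable_funM.
by exists (M * N) => x Sx; rewrite normrM ler_pM//; [exact: fM|exact: gN].
Qed.

Lemma bmZ (c : R) f : bounded_meas f -> bounded_meas (fun x => c * f x).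
Proof. by move=> bf; apply: bmM => //; exact: bm_cst. Qed.

Lemma bm_sum (I : Type) (r : seq I) (F : I -> T -> R) :
  (forall i, bounded_meas (F i)) -> bounded_meas (fun x => \sum_(i <- r) F i x).
Proof.
move=> bF; elim: r => [|i r IH].
  rewrite (_ : (fun x => _) = cst 0); first exact: bm_cst.
  by apply/funext => x; rewrite big_nil.
rewrite (_ : (fun x => _) = fun x => F i x + \sum_(i <- r) F i x); first exact: bmD.
by apply/funext => x; rewrite big_cons.
Qed.

Lemma bm_prod (I : Type) (r : seq I) (F : I -> T -> R) :
  (forall i, bounded_meas (F i)) -> bounded_meas (fun x => \prod_(i <- r) F i x).
Proof.
move=> bF; elim: r => [|i r IH].
  rewrite (_ : (fun x => _) = cst 1); first exact: bm_cst.
  by apply/funext => x; rewrite big_nil.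
rewrite (_ : (fun x => _) = fun x => F i x * \prod_(i <- r) F i x); first exact: bmM.
by apply/funext => x; rewrite big_cons.
Qed.

Lemma meanZ mu (c : R) f : bounded_meas f -> mean mu (fun x => c * f x) = c * mean mu f.
Proof. by move=> bf; rewrite /mean RintegralZl//; exact: bm_integrable. Qed.

Lemma mean_sum mu (I : Type) (r : seq I) (F : I -> T -> R) :
  (forall i, bounded_meas (F i)) -> mean mu (fun x => \sum_(i <- r) F i x) = \sum_(i <- r) mean mu (F i).
Proof.
move=> bF; elim: r => [|i r IH].
  rewrite big_nil (_ : (fun x => _) = cst 0); last by apply/funext => x; rewrite big_nil.
  by rewrite /mean Rintegral_cst// mul0r.
rewrite big_cons -IH (_ : (fun x => _) = fun x => F i x + \sum_(i <- r) F i x).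
  by rewrite /mean RintegralD//; apply: bm_integrable => //; exact: bm_sum.
by apply/funext => x; rewrite big_cons.
Qed.

Lemma mean_approx mu f g (e : R) : 0 <= e -> bounded_meas f -> bounded_meas g ->
  (forall x, S x -> `|f x - g x| <= e) -> `|mean mu f - mean mu g| <= e.
Proof.
move=> e0 bf bg fg; have bd : bounded_meas (fun x => f x - g x).
  by rewrite (_ : (fun x => _) = fun x => f x + (-1) * g x);
    [apply: bmD => //; exact: bmZ|apply/funext => x; rewrite mulN1r].
have -> : mean mu f - mean mu g = mean mu (fun x => f x - g x).
  by rewrite /mean RintegralB//; exact: bm_integrable.
apply: (le_trans (le_normr_Rintegral mS (bm_integrable mu bd))).
have bn : bounded_meas (fun x => `|f x - g x|).
  case: bd => md [M dM]; split; first exact: measurableT_comp.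
  by exists M => x Sx; rewrite normr_id; exact: dM.
apply: (@le_trans _ _ (mean mu (cst e))).
  by apply: le_Rintegral => //; apply: bm_integrable => //; exact: bm_cst.
rewrite /mean Rintegral_cst// ler_piMr//.
have := probability_le1 mu mS; rewrite -[X in (_ <= X)%E]/(1%:E).
by move=> h; rewrite -lee_fin fineK// fin_num_measure.
Qed.

Lemma mean_ge0 mu f : (forall x, S x -> 0 <= f x) -> 0 <= mean mu f.
Proof. exact: Rintegral_ge0. Qed.

Section positive_definite.
Variables (W : nat -> finType) (m : forall n, W n -> T -> R) (a e : nat -> R).
Variable (k : T -> T -> R).
Hypotheses (bmm : forall n w, bounded_meas (@m n w)) (a0 : forall n, 0 <= a n)
  (e0 : forall N, 0 <= e N) (ecvg : e N @[N --> \oo] --> 0)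
  (bk : forall x, S x -> bounded_meas (k x))
  (ke : forall N x y, S x -> S y ->
    `|k x y - \sum_(n < N) a n * \sum_(w : W n) m w x * m w y| <= e N).

Definition double_mean mu1 mu2 : R := mean mu1 (fun x => mean mu2 (k x)).

Let p N x y := \sum_(n < N) a n * \sum_(w : W n) m w x * m w y.

Let bmp N (F : forall n, W n -> R) :
  bounded_meas (fun y => \sum_(n < N) a n * \sum_(w : W n) F n w * m w y).
Proof.
apply: bm_sum => n; apply: bmZ; apply: bm_sum => w.
exact: bmZ.
Qed.

Let Jp mu N (F : forall n, W n -> R) :
  mean mu (fun y => \sum_(n < N) a n * \sum_(w : W n) F n w * m w y) =
  \sum_(n < N) a n * \sum_(w : W n) F n w * mean mu (m w).
Proof.
rewrite mean_sum.
  apply: eq_bigr => n _; rewrite meanZ.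
    rewrite mean_sum; last by move=> w; exact: bmZ.
    by congr (_ * _); apply: eq_bigr => w _; rewrite meanZ.
  by apply: bm_sum => w; exact: bmZ.
by move=> n; apply: bmZ; apply: bm_sum => w; exact: bmZ.
Qed.

Let double_mean_approx mu1 mu2 N : bounded_meas (fun x => mean mu2 (k x)) ->
  `|double_mean mu1 mu2 - \sum_(n < N) a n * \sum_(w : W n) mean mu2 (m w) * mean mu1 (m w)| <= e N.
Proof.
move=> bJ; rewrite -(Jp mu1 N (fun n w => mean mu2 (@m n w))) /double_mean.
apply: mean_approx => //; first exact: (bmp N (fun n w => mean mu2 (@m n w))).
move=> x Sx.
rewrite (_ : \sum_(n < N) _ = mean mu2 (p N x)).
  apply: mean_approx => //; first exact: bk.
    exact: (bmp N (fun n w => m w x)).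
  by move=> y Sy; exact: ke.
rewrite /p (Jp mu2 N (fun n w => m w x)); apply: eq_bigr => n _; congr (_ * _).
by apply: eq_bigr => w _; rewrite mulrC.
Qed.

(** Truncated after [N] terms, the quadratic form of [k] on [mu - nu] is a sum of the
    nonnegative numbers [a i * (mean mu m - mean nu m)^2]; one of them is kept, and the
    truncation error tends to zero. *)
Lemma positive_definite_ge mu nu n (w : W n) :
  bounded_meas (fun x => mean mu (k x)) -> bounded_meas (fun x => mean nu (k x)) ->
  a n * (mean mu (m w) - mean nu (m w)) ^+ 2 + double_mean mu nu + double_mean nu mu <= double_mean mu mu +
    double_mean nu nu.
Proof.
move=> bmu bnu.
pose s N mu1 mu2 := \sum_(n < N) a n * \sum_(w : W n) mean mu2 (m w) * mean mu1 (m w).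
have step N : (n < N)%N ->
  a n * (mean mu (m w) - mean nu (m w)) ^+ 2 + double_mean mu nu + double_mean nu mu <= double_mean mu mu +
    double_mean nu nu + 4 * e N.
  move=> nN.
  have h1 := @double_mean_approx mu mu N bmu; have h2 := @double_mean_approx nu nu N bnu.
  have h3 := @double_mean_approx mu nu N bnu; have h4 := @double_mean_approx nu mu N bmu.
  rewrite !ler_norml in h1 h2 h3 h4.
  rewrite -/(s N mu mu) in h1; rewrite -/(s N nu nu) in h2; rewrite -/(s N mu nu) in h3;
    rewrite -/(s N nu mu) in h4.
  have : a n * (mean mu (m w) - mean nu (m w)) ^+ 2 <= s N mu mu + s N nu nu - s N mu nu - s N nu mu.
    have -> : s N mu mu + s N nu nu - s N mu nu - s N nu mu =
      \sum_(i < N) a i * \sum_(w : W i) (mean mu (m w) - mean nu (m w)) ^+ 2.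
      rewrite /s -big_split/= -!sumrB; apply: eq_bigr => i _.
      rewrite -mulrDr -!mulrBr -big_split/= -!sumrB; congr (_ * _).
      by apply: eq_bigr => w' _; ring.
    rewrite (bigD1 (Ordinal nN))//= (bigD1 w)//= mulrDr -addrA lerDl.
    apply: addr_ge0.
      by apply: mulr_ge0 => //; apply: sumr_ge0 => w' _; exact: sqr_ge0.
    apply: sumr_ge0 => i _; apply: mulr_ge0 => //.
    by apply: sumr_ge0 => w' _; exact: sqr_ge0.
  lra.
have cv : (double_mean mu mu + double_mean nu nu + 4 * e N) @[N --> \oo] --> double_mean mu mu + double_mean nu nu.
  rewrite -[X in _ --> X]addr0; apply: cvgD; first exact: cvg_cst.
  by rewrite -(mulr0 4); apply: cvgM => //; exact: cvg_cst.
apply: (ler_cvg_to (cvg_cst _) cv).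
by exists n.+1 => //= N nN; exact: step.
Qed.
End positive_definite.
End bounded_functionals.

Section sphere_kernel.
Context (R : realType).
Local Notation leb := (@lebesgue_measure R).
Local Notation S := (@sphere2 R).
Implicit Types (x y : R3 R) (mu nu : probability (R3 R) R) (t : R).

Let mx1 : measurable_fun [set: R3 R] (fun x : R3 R => x.1.1).
Proof. exact: (measurableT_comp (@measurable_fst _ _ _ _) (@measurable_fst _ _ _ _)). Qed.
Let mx2 : measurable_fun [set: R3 R] (fun x : R3 R => x.1.2).
Proof. exact: (measurableT_comp (@measurable_snd _ _ _ _) (@measurable_fst _ _ _ _)). Qed.
Let mx3 : measurable_fun [set: R3 R] (fun x : R3 R => x.2).
Proof. exact: measurable_snd. Qed.

Lemma measurable_sphere2 : measurable (S : set (R3 R)).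
Proof.
have -> : S = @norm2 R @^-1` [set 1] by apply/seteqP; split => x /sphere2P.
have mn : measurable_fun [set: R3 R] (@norm2 R).
  apply: measurable_funD; first apply: measurable_funD; apply: measurable_funX.
  - exact: mx1.
  - exact: mx2.
  - exact: mx3.
by rewrite -[X in measurable X]setTI; apply: mn => //; exact: measurable_set1.
Qed.

Lemma integral_sphere mu (g : R3 R -> \bar R) : mu S = 1%E ->
  (forall x, 0 <= g x)%E -> measurable_fun [set: R3 R] g ->
  (\int[mu]_(x in S) g x = \int[mu]_x g x)%E.
Proof.
move=> muS g0 mg; have mS := measurable_sphere2.
rewrite [RHS](@ge0_negligible_integral _ _ _ _ _ (~` S))//.
- by rewrite setTD setCK.
- exact: measurableC.
- by have := probability_setC mu mS; rewrite muS subee.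
Qed.

Definition coord (i : 'I_3) (x : R3 R) : R :=
  if i == 0%N :> nat then x.1.1 else if i == 1%N :> nat then x.1.2 else x.2.

Definition dot x y : R := \sum_(i < 3) coord i x * coord i y.

Definition monomial n (w : {ffun 'I_n -> 'I_3}) (x : R3 R) : R := \prod_(j < n) coord (w j) x.

Lemma dotE x y : dot x y = x.1.1 * y.1.1 + x.1.2 * y.1.2 + x.2 * y.2.
Proof. by rewrite /dot !big_ord_recl big_ord0/= addr0 addrA. Qed.

(** Powers of the scalar product are positive definite: multiplying out, they become sums of
    products of the same monomial in [x] and in [y].  A monomial is indexed by the word of
    its letters, not by its exponents, so that no multinomial coefficient occurs. *)
Lemma dot_expr n x y : dot x y ^+ n = \sum_(w : {ffun 'I_n -> 'I_3}) monomial w x * monomial w y.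
Proof.
have -> : dot x y ^+ n = \prod_(j < n) \sum_(i < 3) coord i x * coord i y.
  by rewrite big_const card_ord -Monoid.iteropE.
rewrite bigA_distr_bigA; apply: eq_bigr => w _.
by rewrite /monomial -big_split.
Qed.

Lemma norm2_sub_dot x y : S x -> S y -> norm2 (x - y) = 2 - 2 * dot x y.
Proof.
move=> /sphere2P + /sphere2P; rewrite /norm2 dotE/=.
by case: x => [[x1 x2] x3]; case: y => [[y1 y2] y3] /= h1 h2; lra.
Qed.

Lemma dot_le1 x y : S x -> S y -> `|dot x y| <= 1.
Proof.
move=> Sx Sy; rewrite ler_norml.
have := norm2_ge0 (x - y); rewrite norm2_sub_dot// => h1.
move: Sx Sy => /sphere2P + /sphere2P; rewrite /norm2 => Sx Sy.
have := sqr_ge0 (x.1.1 + y.1.1); have := sqr_ge0 (x.1.2 + y.1.2); have := sqr_ge0 (x.2 + y.2).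
by move: h1; rewrite !dotE; lra.
Qed.

Lemma coord_le1 i x : S x -> `|coord i x| <= 1.
Proof.
move=> /sphere2P; rewrite /norm2 => n1.
have : coord i x ^+ 2 <= 1.
  have := sqr_ge0 x.1.1; have := sqr_ge0 x.1.2; have := sqr_ge0 x.2.
  by rewrite /coord; case: ifP => _; last case: ifP => _; lra.
by move: (coord i x) => c c2; rewrite ler_norml; apply/andP; split; nra.
Qed.

Lemma bm_coord i : bounded_meas S (coord i).
Proof.
split; last by exists 1 => x; exact: coord_le1.
apply: measurable_funTS; rewrite /coord.
case: (nat_of_ord i == 0%N); last case: (nat_of_ord i == 1%N).
- exact: mx1.
- exact: mx2.
- exact: mx3.
Qed.

Lemma bm_monomial n (w : {ffun 'I_n -> 'I_3}) : bounded_meas S (monomial w).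
Proof. by apply: (@bm_prod _ _ _ _ _ _ (fun j => coord (w j))) => j; exact: bm_coord. Qed.

(** Bounded for [t < pi / 2], unlike the Coulomb kernel.  On the sphere it is
    [1 / (1 + s - 2 s dot x y)] with [s = sin t ^+ 2], a geometric series. *)
Definition mixed_kernel (t : R) x y : R := (cos t ^+ 2 + norm2 (x - y) * sin t ^+ 2)^-1.

Let den_ge t x y : t \in `]0, pi / 2[ -> 0 < cos t ^+ 2 <= cos t ^+ 2 + norm2 (x - y) * sin t ^+ 2.
Proof.
move=> /cos_gt0_pi2 c0; rewrite exprn_gt0//= lerDl mulr_ge0 ?sqr_ge0//.
exact: norm2_ge0.
Qed.

Lemma mixed_kernel_ge0 t x y : 0 <= mixed_kernel t x y.
Proof. by rewrite /mixed_kernel invr_ge0 addr_ge0 ?sqr_ge0// mulr_ge0 ?sqr_ge0// norm2_ge0. Qed.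

Lemma mixed_kernel_le t x y : t \in `]0, pi / 2[ -> mixed_kernel t x y <= (cos t ^+ 2)^-1.
Proof.
move=> t0; have /andP[h1 h2] := den_ge x y t0.
by rewrite /mixed_kernel lef_pV2// posrE// (lt_le_trans h1).
Qed.

(** This is [integral_trig] with [p = 1] and [r = |x - y|]; on the diagonal, monotone
    comparison with small [r] shows that the integral is infinite. *)
Lemma coulomb_mixture x y : (coulomb x y =
  \int[leb]_(t in `]0%R, (pi / 2)%R[) ((2 / pi) * mixed_kernel t x y)%:E)%E.
Proof.
have pi0 := @pi_gt0 R.
have mkt : measurable_fun [set: R] (fun t => 2 / pi * mixed_kernel t x y).
  apply: measurable_funM => //; apply: measurable_fun_inv; apply: measurable_funD.
    by apply: measurable_funX; exact: measurable_cos.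
  apply: measurable_funM => //.
  by apply: measurable_funX; exact: measurable_sin.
have main c : 0 < c ->
  (\int[leb]_(t in `]0%R, (pi / 2)%R[) ((2 / pi) * (cos t ^+ 2 + c ^+ 2 * sin t ^+ 2)^-1)%:E = (c^-1)%:E)%E.
  move=> c0.
  transitivity (\int[leb]_(t in `]0%R, (pi / 2)%R[) ((2 / pi / c)%:E *
     (1 * c / (1 ^+ 2 * cos t ^+ 2 + c ^+ 2 * sin t ^+ 2))%:E))%E.
    apply: eq_integral => t _; rewrite -EFinM expr1n !mul1r; congr EFin.
    by move: (_^-1) (@pi R) pi0 => X p p0; field; rewrite !gt_eqF.
  rewrite ge0_integralZl_EFin//.
  - rewrite integral_trig// -EFinM; congr EFin.
    by move: (@pi R) pi0 => p p0; field; rewrite !gt_eqF.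
  - by move=> t _; rewrite lee_fin divr_ge0 ?mul1r ?ltW// convex_pos// ?expr1n// exprn_gt0.
  - apply/measurable_EFinP; apply: measurable_funTS; apply: continuous_measurable => t.
    have H := lt0r_neq0 (convex_pos t (exprn_gt0 2 (@ltr01 R)) (exprn_gt0 2 c0)).
    by apply: is_derive_continuous.
  - by rewrite !divr_ge0// ltW.
rewrite coulombE; case: ifPn => [/eqP n0|n0]; last first.
  have n1 : 0 < norm2 (x - y) by rewrite lt_neqAle eq_sym n0 norm2_ge0.
  rewrite -[LHS]main ?sqrtr_gt0//; apply: eq_integral => t _.
  by rewrite /mixed_kernel sqr_sqrtr// norm2_ge0.
apply/esym/eqyP => A A0.
have c0 : 0 < (A + 1)^-1 by rewrite invr_gt0//; lra.
apply: (@le_trans _ _ (((A + 1)^-1)^-1)%:E).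
  by rewrite invrK lee_fin; lra.
rewrite -main//; apply: ge0_le_integral => //.
- move=> t _; rewrite lee_fin; apply: mulr_ge0; first by rewrite divr_ge0// ltW.
  by rewrite invr_ge0 addr_ge0 ?sqr_ge0// mulr_ge0 ?sqr_ge0.
- apply/measurable_EFinP; apply: measurable_funTS; apply: measurable_funM => //.
  apply: measurable_fun_inv; apply: measurable_funD.
    by apply: measurable_funX; exact: measurable_cos.
  apply: measurable_funM => //.
  by apply: measurable_funX; exact: measurable_sin.
- by apply/measurable_EFinP; apply: measurable_funTS; exact: mkt.
move=> t /= t0; rewrite lee_fin ler_wpM2l//; first by rewrite divr_ge0// ltW.
have cp := cos_gt0_pi2 t0.
rewrite /mixed_kernel n0 mul0r addr0 lef_pV2 ?posrE ?exprn_gt0//.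
  by rewrite lerDl mulr_ge0 ?sqr_ge0.
by apply: ltr_wpDr; [rewrite mulr_ge0 ?sqr_ge0|rewrite exprn_gt0].
Qed.

End sphere_kernel.

Section energy_inequality.
Context (R : realType).
Local Notation leb := (@lebesgue_measure R).
Local Notation S := (@sphere2 R).
Implicit Types (x y : R3 R) (mu nu : probability (R3 R) R) (t : R).

Definition mutual_energy mu nu : \bar R :=
  (\int[mu]_(x in S) \int[nu]_(y in S) coulomb x y)%E.

(** The integrand of [coulomb_mixture] as a function of all variables, for use with Fubini. *)
Let K (z : R * R3 R * R3 R) : R :=
  if 0 < z.1.1 < pi / 2 then 2 / pi * mixed_kernel z.1.1 z.1.2 z.2 else 0.

Let K_ge0 z : 0 <= K z.
Proof.
rewrite /K; case: ifP => // _; rewrite mulr_ge0 ?mixed_kernel_ge0//.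
by rewrite divr_ge0// pi_ge0.
Qed.

Let m11 : measurable_fun [set: R * R3 R * R3 R] (fun z : R * R3 R * R3 R => z.1.1).
Proof. exact: (measurableT_comp (@measurable_fst _ _ _ _) (@measurable_fst _ _ _ _)). Qed.

Let mkt3 : measurable_fun [set: R * R3 R * R3 R] (fun z : R * R3 R * R3 R => mixed_kernel z.1.1 z.1.2 z.2).
Proof.
have m12 : measurable_fun [set: R * R3 R * R3 R] (fun z : R * R3 R * R3 R => (z.1.2, z.2)).
  by apply: measurable_fun_pair;
    [exact: (measurableT_comp (@measurable_snd _ _ _ _) (@measurable_fst _ _ _ _))|exact: measurable_snd].
have mc := @measurable_cos R; have ms := @measurable_sin R.
apply: measurable_fun_inv; apply: measurable_funD.
  by apply: measurable_funX; exact: (measurableT_comp mc m11).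
apply: measurable_funM; first exact: (measurableT_comp (@measurable_norm2_sub R) m12).
by apply: measurable_funX; exact: (measurableT_comp ms m11).
Qed.

Let mK : measurable_fun [set: R * R3 R * R3 R] K.
Proof.
apply: measurable_fun_ifT.
- by apply: measurable_and; apply: measurable_fun_ltr.
- by apply: measurable_funM => //; exact: mkt3.
- exact: measurable_cst.
Qed.

Let G mu nu t : \bar R := (\int[mu]_x \int[nu]_y (K (t, x, y))%:E)%E.

Let mKE : measurable_fun [set: R * R3 R * R3 R] (EFin \o K).
Proof. by apply/measurable_EFinP; exact: mK. Qed.

Let mG1 nu : measurable_fun [set: R * R3 R] (fun z : R * R3 R => \int[nu]_y (K (z, y))%:E)%E.
Proof.
apply: (@measurable_fun_fubini_tonelli_F _ _ _ _ _ nu (EFin \o K)); first exact: mKE.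
by move=> z; rewrite lee_fin K_ge0.
Qed.

Let G1_ge0 nu z : (0 <= \int[nu]_y (K (z, y))%:E)%E.
Proof. by apply: integral_ge0 => y _; rewrite lee_fin K_ge0. Qed.

Let mG mu nu : measurable_fun [set: R] (G mu nu).
Proof.
apply: (@measurable_fun_fubini_tonelli_F _ _ _ _ _ mu (fun z : R * R3 R => \int[nu]_y (K (z, y))%:E)%E).
  exact: mG1.
by move=> z; exact: G1_ge0.
Qed.

Let G_ge0 mu nu t : (0 <= G mu nu t)%E.
Proof. by apply: integral_ge0 => x _; exact: G1_ge0. Qed.

Lemma measurable_potential nu : measurable_fun [set: R3 R] (fun x => \int[nu]_y coulomb x y)%E.
Proof.
apply: (@measurable_fun_fubini_tonelli_F _ _ _ _ _ nu (fun z : R3 R * R3 R => coulomb z.1 z.2)).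
  exact: measurable_coulomb.
by move=> z; exact: coulomb_ge0.
Qed.

Lemma potential_nonneg nu x : (0 <= \int[nu]_y coulomb x y)%E.
Proof. by apply: integral_ge0 => y _; exact: coulomb_ge0. Qed.

Lemma mutual_energyE mu nu : mu S = 1%E -> nu S = 1%E ->
  (mutual_energy mu nu = \int[mu]_x \int[nu]_y coulomb x y)%E.
Proof.
move=> muS nuS; rewrite /mutual_energy.
transitivity (\int[mu]_(x in S) \int[nu]_y coulomb x y)%E.
  apply: eq_integral => x _.
  by rewrite integral_sphere//; [move=> y; exact: coulomb_ge0|exact: measurable_coulomb1].
rewrite integral_sphere//; last exact: measurable_potential.
by move=> x; exact: potential_nonneg.
Qed.

Lemma mutual_energyC mu nu : mu S = 1%E -> nu S = 1%E ->
  mutual_energy mu nu = mutual_energy nu mu.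
Proof.
move=> muS nuS; rewrite !mutual_energyE//.
rewrite (@fubini_tonelli _ _ _ _ _ mu nu (fun z : R3 R * R3 R => coulomb z.1 z.2)).
- by apply: eq_integral => x _; apply: eq_integral => y _; rewrite coulombC.
- exact: measurable_coulomb.
- by move=> z; exact: coulomb_ge0.
Qed.

Let energy_G mu nu : mu S = 1%E -> nu S = 1%E ->
  (mutual_energy mu nu = \int[leb]_t G mu nu t)%E.
Proof.
move=> muS nuS; rewrite mutual_energyE//.
transitivity (\int[mu]_x \int[leb]_t \int[nu]_y (K (t, x, y))%:E)%E; last first.
  rewrite -(@fubini_tonelli _ _ _ _ _ leb mu (fun z : R * R3 R => \int[nu]_y (K (z, y))%:E)%E)//.
  exact: mG1.
apply: eq_integral => x _.
transitivity (\int[nu]_y \int[leb]_t (K (t, x, y))%:E)%E.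
  apply: eq_integral => y _; rewrite coulomb_mixture integral_mkcond; apply: eq_integral => t _.
  by rewrite patchE mem_setE in_itv/= /K/=; case: ifP.
have mz : measurable_fun [set: R * R3 R] (fun z : R * R3 R => (K (z.1, x, z.2))%:E).
  apply: (measurableT_comp mKE).
  apply: measurable_fun_pair; last exact: measurable_snd.
  by apply: measurable_fun_pair; [exact: measurable_fst|exact: measurable_cst].
rewrite -(@fubini_tonelli _ _ _ _ _ leb nu (fun z : R * R3 R => (K (z.1, x, z.2))%:E))//.
by move=> z; rewrite lee_fin K_ge0.
Qed.

Section pointwise.
Variable (t : R).
Hypothesis t0 : t \in `]0, pi / 2[.
Let c0 : 0 < (cos t ^+ 2)^-1.
Proof. by rewrite invr_gt0 exprn_gt0// cos_gt0_pi2. Qed.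

Lemma bm_mixed_kernel x : bounded_meas S (mixed_kernel t x).
Proof.
split.
  apply: measurable_funTS.
  exact: (measurableT_comp mkt3 (pair1_measurable (t, x))).
exists ((cos t ^+ 2)^-1) => y Sy; rewrite ger0_norm ?mixed_kernel_ge0//.
exact: mixed_kernel_le.
Qed.

Lemma integral_mixed_kernel nu x : nu S = 1%E ->
  (\int[nu]_y (K (t, x, y))%:E = (2 / pi * mean S nu (mixed_kernel t x))%:E)%E.
Proof.
move=> nuS; have t0' := t0; rewrite in_itv/= in t0'.
have bk := bm_integrable (@measurable_sphere2 R) nu (bm_mixed_kernel x).
rewrite -(@integral_sphere _ nu (fun y => (K (t, x, y))%:E))//; last 2 first.
- by move=> y; rewrite lee_fin K_ge0.
- exact: (measurableT_comp mKE (pair1_measurable (t, x))).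
transitivity (\int[nu]_(y in S) ((2 / pi)%:E * (mixed_kernel t x y)%:E))%E.
  by apply: eq_integral => y _; rewrite /K/= t0'.
rewrite integralZl//; last exact: measurable_sphere2.
rewrite [RHS]EFinM; congr (_ * _)%E; rewrite /mean /Rintegral fineK//.
by apply: integrable_fin_num => //; exact: measurable_sphere2.
Qed.

Lemma bm_mean_mixed_kernel nu : nu S = 1%E -> bounded_meas S (fun x => mean S nu (mixed_kernel t x)).
Proof.
move=> nuS; split.
  have m1 : measurable_fun [set: R3 R] (fun x => (pi / 2) * fine (\int[nu]_y (K (t, x, y))%:E)%E).
    apply: measurable_funM => //; apply: (measurableT_comp (fine_measurable measurableT)).
    exact: (measurableT_comp (mG1 nu) (pair1_measurable t)).
  rewrite (_ : (fun x => _) = (fun x => (pi / 2) * fine (\int[nu]_y (K (t, x, y))%:E)%E)).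
    exact: measurable_funTS.
  apply/funext => x; rewrite integral_mixed_kernel//=.
  by have := @pi_gt0 R; move: (mean _ _ _) (@pi R) => X p p0; field; rewrite gt_eqF.
exists ((cos t ^+ 2)^-1) => x Sx.
have -> : mean S nu (mixed_kernel t x) = mean S nu (mixed_kernel t x) - mean S nu (cst 0).
  by rewrite /mean Rintegral_cst ?mul0r ?subr0//; exact: measurable_sphere2.
apply: mean_approx; [exact: measurable_sphere2|exact: ltW|exact: bm_mixed_kernel|exact: bm_cst|].
by move=> y Sy; rewrite subr0 ger0_norm ?mixed_kernel_ge0// mixed_kernel_le.
Qed.

Lemma GE mu nu : mu S = 1%E -> nu S = 1%E -> G mu nu t = (2 / pi * double_mean S (mixed_kernel t) mu nu)%:E.
Proof.
move=> muS nuS; rewrite /G.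
transitivity (\int[mu]_x (2 / pi * mean S nu (mixed_kernel t x))%:E)%E.
  by apply: eq_integral => x _; rewrite integral_mixed_kernel.
have bJ := bm_integrable (@measurable_sphere2 R) mu (bm_mean_mixed_kernel nuS).
rewrite -integral_sphere//; last 2 first.
- move=> x; rewrite lee_fin mulr_ge0//; first by rewrite divr_ge0// pi_ge0.
  by apply: mean_ge0 => y _; exact: mixed_kernel_ge0.
- rewrite (_ : (fun x => _) = (fun x => \int[nu]_y (K (t, x, y))%:E)%E); last first.
    by apply/funext => x; rewrite integral_mixed_kernel.
  exact: (measurableT_comp (mG1 nu) (pair1_measurable t)).
under eq_integral do rewrite EFinM.
rewrite integralZl//; last exact: measurable_sphere2.
rewrite [RHS]EFinM; congr (_ * _)%E; rewrite /double_mean /mean /Rintegral fineK//.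
by apply: integrable_fin_num => //; exact: measurable_sphere2.
Qed.

Let sg := sin t ^+ 2.
Let kap := 2 * sg / (1 + sg).

Let sg01 : 0 < sg < 1.
Proof.
have := cos2Dsin2 t; have := exprn_gt0 2 (cos_gt0_pi2 t0); have := exprn_gt0 2 (sin_gt0_pi2 t0).
by rewrite -/sg; lra.
Qed.

Let kap01 : 0 < kap < 1.
Proof.
have s := sg01; apply/andP; split; first by rewrite divr_gt0//; lra.
by rewrite ltr_pdivrMr; lra.
Qed.

(** The geometric series of [mixed_kernel] has ratio [kap * dot x y] with [kap < 1] and
    [|dot x y| <= 1], hence converges uniformly on the sphere. *)
Lemma double_mean_ge mu nu n (w : {ffun 'I_n -> 'I_3}) : mu S = 1%E -> nu S = 1%E ->
  kap ^+ n / (1 + sg) * (mean S mu (monomial w) - mean S nu (monomial w)) ^+ 2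
   + double_mean S (mixed_kernel t) mu nu + double_mean S (mixed_kernel t) nu mu <=
     double_mean S (mixed_kernel t) mu mu + double_mean S (mixed_kernel t) nu nu.
Proof.
move=> muS nuS; have s := sg01; have k01 := kap01; have /andP[k0 k1] := k01.
have bmu := bm_mean_mixed_kernel muS; have bnu := bm_mean_mixed_kernel nuS; clear muS nuS.
apply: (@positive_definite_ge _ _ _ S (@measurable_sphere2 R) (fun n => {ffun 'I_n -> 'I_3})
  (@monomial R) (fun n => kap ^+ n / (1 + sg)) (fun N => kap ^+ N / (1 - sg)) (mixed_kernel t)).
- by move=> m' w'; exact: bm_monomial.
- by move=> m'; rewrite divr_ge0 ?exprn_ge0//; lra.
- by move=> N; rewrite divr_ge0 ?exprn_ge0//; lra.
- rewrite -(mul0r (1 - sg)^-1); apply: cvgM; last exact: cvg_cst.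
  by apply: cvg_expr; rewrite ger0_norm// ltW.
- by move=> x _; exact: bm_mixed_kernel.
- move=> N x y Sx Sy /=.
  have d1 := dot_le1 Sx Sy.
  pose u := kap * dot x y.
  have u1 : u < 1.
    have : dot x y <= 1 by move: d1; rewrite ler_norml => /andP[].
    by rewrite /u => d; apply: (@le_lt_trans _ _ kap) => //; rewrite ler_piMr// ltW.
  have ktE : mixed_kernel t x y = (1 + sg)^-1 / (1 - u).
    have kE : cos t ^+ 2 + (2 - 2 * dot x y) * sin t ^+ 2 = (1 + sg) * (1 - u).
      by rewrite cos2sin2 -/sg /u /kap; field; lra.
    by rewrite /mixed_kernel (norm2_sub_dot Sx Sy) kE invfM.
  rewrite (eq_bigr (fun i : 'I_N => (1 + sg)^-1 * u ^+ i)); last first.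
    by move=> i _; rewrite -dot_expr /u (exprMn _ kap); ring.
  rewrite -mulr_sumr.
  have -> : \sum_(i < N) u ^+ i = (1 - u ^+ N) / (1 - u).
    by apply: (@mulIf _ (1 - u)); rewrite ?divfK ?gt_eqF ?subr_gt0//; have := subrX1 u N; lra.
  have -> : mixed_kernel t x y - (1 + sg)^-1 * ((1 - u ^+ N) / (1 - u)) = (1 + sg)^-1 * (u ^+ N / (1 - u)).
    by rewrite ktE; field; rewrite !gt_eqF ?subr_gt0//; lra.
  have k1E : 1 - sg = (1 + sg) * (1 - kap) by rewrite /kap; field; lra.
  rewrite k1E invfM [leRHS]mulrCA normrM (@ger0_norm _ (1 + sg)^-1) ?invr_ge0; last by lra.
  rewrite ler_wpM2l ?invr_ge0//; first by lra.
  rewrite normrM normrX.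
  have uk : `|u| <= kap by rewrite /u normrM (ger0_norm (ltW k0)) ler_piMr// ltW.
  apply: ler_pM => //.
    by rewrite lerXn2r// nnegrE ltW.
  rewrite normfV ger0_norm; last by lra.
  rewrite lef_pV2 ?posrE; [|lra|lra].
  have uk' : u <= kap by exact: le_trans (ler_norm _) uk.
  by lra.
- exact: bmu.
- exact: bnu.
Qed.

End pointwise.

Let G_out mu nu t : t \notin `]0, pi / 2[ -> G mu nu t = 0%E.
Proof.
rewrite in_itv/= => t0; rewrite /G integral0_eq// => x _.
by rewrite integral0_eq// => y _; rewrite /K/= (negbTE t0).
Qed.

Let coef_ge t n : t \in `]pi / 4, pi / 2[ -> (2 / 3 : R) ^+ n / 2 <=
  (2 * sin t ^+ 2 / (1 + sin t ^+ 2)) ^+ n / (1 + sin t ^+ 2).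
Proof.
have pi0 := @pi_gt0 R.
rewrite in_itv/= => t4.
have c2 : cos (t *+ 2) < 0.
  by rewrite -(@cos_pihalf R) (mulr2n t) ltr_cos; rewrite ?in_itv/=; lra.
have s2 : sin t ^+ 2 <= 1 by have := cos2Dsin2 t; have := sqr_ge0 (cos t); lra.
have s1 : 1 / 2 <= sin t ^+ 2.
  by move: c2; rewrite cos_mulr2n cos2sin2 -mulr_natr; lra.
move: (sin t ^+ 2) s1 s2 => s s1 s2.
rewrite ler_pM ?exprn_ge0 ?invr_ge0//; last by rewrite lef_pV2 ?posrE; lra.
rewrite lerXn2r ?nnegrE//; first by rewrite divr_ge0//; lra.
by rewrite ler_pdivlMr; lra.
Qed.

(** [double_mean_ge] integrated over [t]; the term with the square is kept for
    [pi / 4 < t < pi / 2] only, where its coefficient is bounded below. *)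
Lemma energy_ge mu nu n (w : {ffun 'I_n -> 'I_3}) : mu S = 1%E -> nu S = 1%E ->
  exists2 C : R, 0 < C &
  ((C * (mean S mu (monomial w) - mean S nu (monomial w)) ^+ 2)%:E +
     (mutual_energy mu nu + mutual_energy nu mu) <=
   mutual_energy mu mu + mutual_energy nu nu)%E.
Proof.
move=> muS nuS; have pi0 := @pi_gt0 R.
pose c : R := (2 / 3) ^+ n / 2; have c0 : 0 < c by rewrite divr_gt0// exprn_gt0.
exists (c / 2); first by rewrite divr_gt0.
have bnd t : t \in `]0, pi / 2[ -> _ := fun ht => @double_mean_ge t ht mu nu n w muS nuS.
move: (mean S mu (monomial w) - mean S nu (monomial w)) bnd => d bnd.
pose D (t : R) : \bar R := (if pi / 4 < t < pi / 2 then 2 / pi * (c * d ^+ 2) else 0)%:E.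
have p2 : 0 <= 2 / pi :> R by rewrite divr_ge0// ltW.
have D0 t : (0 <= D t)%E.
  by rewrite lee_fin; case: ifP => // _; rewrite mulr_ge0// (mulr_ge0 (ltW c0))// sqr_ge0.
have mD : measurable_fun [set: R] D.
  apply/measurable_EFinP; apply: measurable_fun_ifT => //.
  by apply: measurable_and; apply: measurable_fun_ltr.
have intD : (\int[leb]_t D t = (c / 2 * d ^+ 2)%:E)%E.
  transitivity (\int[leb]_(t in `](pi / 4)%R, (pi / 2)%R[) (cst (2 / pi * (c * d ^+ 2))%:E t))%E.
    rewrite [RHS]integral_mkcond; apply: eq_integral => t _.
    by rewrite patchE mem_setE in_itv/= /D; case: ifP.
  rewrite integral_cst//= [X in (_ * X)%E]lebesgue_measure_itv/= lte_fin ifT; last by lra.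
  rewrite -EFinB -EFinM; congr EFin.
  by move: (@pi R) pi0 => p p0; field; rewrite gt_eqF.
have sumG mu1 nu1 mu2 nu2 : mu1 S = 1%E -> nu1 S = 1%E -> mu2 S = 1%E -> nu2 S = 1%E ->
  (mutual_energy mu1 nu1 + mutual_energy mu2 nu2 = \int[leb]_t (G mu1 nu1 t + G mu2 nu2 t))%E.
  by move=> ? ? ? ?; rewrite !energy_G// [RHS]ge0_integralD//; exact: mG.
rewrite -intD !sumG//.
have mGG : measurable_fun [set: R] (fun t => G mu nu t + G nu mu t)%E.
  exact: emeasurable_funD.
have GG0 t : [set: R] t -> (0 <= G mu nu t + G nu mu t)%E by move=> _; exact: adde_ge0.
have -> : (\int[leb]_t D t + \int[leb]_t (G mu nu t + G nu mu t) =
  \int[leb]_t (D t + (G mu nu t + G nu mu t)))%E.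
  by rewrite [RHS]ge0_integralD.
apply: ge0_le_integral.
- exact: measurableT.
- by move=> t _; apply: adde_ge0 => //; exact: GG0.
- exact: emeasurable_funD.
- by apply: emeasurable_funD; exact: mG.
move=> t _; have [t0|t0] := boolP (t \in `]0, pi / 2[); last first.
  rewrite !G_out// !adde0 lee_fin ifF//; apply/negbTE; apply: contra t0.
  by rewrite in_itv/=; lra.
rewrite !GE// /D; have := bnd t t0.
set A := double_mean _ _ mu nu; set B := double_mean _ _ nu mu; set C := double_mean _ _ mu mu;
  set E := double_mean _ _ nu nu.
move=> le.
rewrite -!EFinD lee_fin -!mulrDr; case: ifP => t4.
  rewrite -mulrDr ler_wpM2l// addrA (le_trans _ le)// lerD2r lerD2r.
  by rewrite ler_wpM2r ?sqr_ge0// coef_ge// in_itv.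
rewrite add0r ler_wpM2l//.
have [s0 k0] : 0 <= sin t ^+ 2 /\ 0 <= 1 + sin t ^+ 2 by have := sqr_ge0 (sin t); lra.
move: le; set X := _ * d ^+ 2; have : 0 <= X; last by lra.
by rewrite mulr_ge0 ?sqr_ge0// divr_ge0// exprn_ge0// divr_ge0// mulr_ge0.
Qed.

End energy_inequality.

(** * Measures on the sphere are determined by their moments *)

Section absolute_value_iteration.
Context (R : realType).
Implicit Types (x : R).

(** Polynomials in [x] without constant term which increase to [|x|] on [-1, 1]: the error is
    multiplied by [1 - (|x| + y) / 2] at each step, [y] being the current value. *)
Fixpoint abs_iter (n : nat) x : R :=
  if n is n'.+1 then abs_iter n' x + (x ^+ 2 - abs_iter n' x ^+ 2) / 2 else 0.

Lemma abs_iter_bound n x : `|x| <= 1 ->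
  0 <= abs_iter n x <= `|x| /\ `|x| - abs_iter n x <= (1 - `|x| / 2) ^+ n.
Proof.
move=> x1; have x0 := normr_ge0 x.
elim: n => [|n [/andP[y0 yx] ye]] /=; first by rewrite lexx x0 subr0 expr0.
have e : `|x| - (abs_iter n x + (x ^+ 2 - abs_iter n x ^+ 2) / 2) =
    (`|x| - abs_iter n x) * (1 - (`|x| + abs_iter n x) / 2).
  by rewrite -(real_normK (num_real x)); field.
have d0 : 0 <= (`|x| - abs_iter n x) * (1 - (`|x| + abs_iter n x) / 2).
  by apply: mulr_ge0; lra.
split.
  apply/andP; split; last by rewrite -subr_ge0 e.
  by rewrite -(real_normK (num_real x)); nra.
rewrite e exprSr ler_pM//; lra.
Qed.

Lemma abs_iter_cvg x : `|x| <= 1 -> abs_iter n x @[n --> \oo] --> `|x|.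
Proof.
move=> x1; have [->|x0] := eqVneq x 0.
  rewrite normr0 (_ : (fun n => _) = cst 0); first exact: cvg_cst.
  apply/funext => n /=; have [] := @abs_iter_bound n 0; rewrite normr0 ?ler01// => /andP[? ?] _.
  by apply/eqP; rewrite eq_le; apply/andP.
have xp : 0 < `|x| by rewrite normr_gt0.
have cv : (`|x| - (1 - `|x| / 2) ^+ n) @[n --> \oo] --> `|x|.
  rewrite -[X in _ --> X]subr0; apply: cvgB; first exact: cvg_cst.
  by apply: cvg_expr; rewrite ger0_norm; lra.
apply: (squeeze_cvgr _ cv (cvg_cst _)).
apply: nearW => n; have [/andP[y0 yx] ye] := abs_iter_bound n x1.
by apply/andP; split => //; lra.
Qed.

End absolute_value_iteration.

Section moments.
Context (R : realType).
Local Notation S := (@sphere2 R).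
Variables (mu nu : probability (R3 R) R).
Hypotheses (muS : mu S = 1%E) (nuS : nu S = 1%E).
Hypothesis moments : forall n (w : {ffun 'I_n -> 'I_3}), mean S mu (monomial w) = mean S nu (monomial w).
Implicit Types (f g : R3 R -> R) (fs : nat -> R3 R -> R) (M : R).
Local Notation mS := (@measurable_sphere2 R).

Lemma bm_lim fs f M : (forall n, bounded_meas S (fs n)) -> (forall n x, S x -> `|fs n x| <= M) ->
  (forall x, S x -> fs n x @[n --> \oo] --> f x) -> bounded_meas S f.
Proof.
move=> bf fM ff; split.
  apply/measurable_EFinP; apply: (@emeasurable_fun_cvg _ _ _ _ (fun n x => (fs n x)%:E)).
    by move=> n; apply/measurable_EFinP; exact: (bf n).1.
  by move=> x Sx; apply: cvg_EFin; [exact: nearW|exact: ff].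
exists M => x Sx.
apply: (ler_cvg_to (cvg_norm (ff x Sx)) (cvg_cst M)).
by apply: nearW => n; exact: fM.
Qed.

Let meanE (rh : probability (R3 R) R) f : bounded_meas S f ->
  (mean S rh f)%:E = (\int[rh]_(x in S) (f x)%:E)%E.
Proof.
move=> bf; rewrite /mean /Rintegral fineK//.
exact: (integrable_fin_num mS (bm_integrable mS rh bf)).
Qed.

Lemma mean_lim (rh : probability (R3 R) R) fs f M : (forall n, bounded_meas S (fs n)) ->
  (forall n x, S x -> `|fs n x| <= M) ->
  (forall x, S x -> fs n x @[n --> \oo] --> f x) ->
  mean S rh (fs n) @[n --> \oo] --> mean S rh f.
Proof.
move=> bf fM ff; have bfl := bm_lim bf fM ff.
apply: fine_cvg; rewrite meanE//.
apply: (@dominated_cvg _ _ _ rh S mS (fun n x => (fs n x)%:E) (EFin \o f) (cst M%:E)) => //.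
- by move=> n; apply/measurable_EFinP; exact: (bf n).1.
- by move=> x Sx; apply: cvg_EFin; [exact: nearW|exact: ff].
- exact: (bm_integrable mS rh (bm_cst S M)).
Qed.

(** The functions whose product with every monomial has the same mean under both measures. *)
Let P f := bounded_meas S f /\
  forall n (w : {ffun 'I_n -> 'I_3}), mean S mu (fun x => f x * monomial w x) =
    mean S nu (fun x => f x * monomial w x).

(** The multipliers of [P].  They contain the coordinates and are closed under products and
    under bounded pointwise limits, whereas [P] is not visibly closed under products. *)
Let Q f := bounded_meas S f /\ forall g, P g -> P (fun x => f x * g x).

Let P_lim fs f M : (forall n, P (fs n)) -> (forall n x, S x -> `|fs n x| <= M) ->
  (forall x, S x -> fs n x @[n --> \oo] --> f x) -> P f.
Proof.
move=> Pf fM ff; split; first exact: bm_lim (fun n => (Pf n).1) fM ff.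
move=> n w; have [_ [W Ww]] := @bm_monomial R n w.
have bfw k : bounded_meas S (fun x => fs k x * monomial w x) by apply: bmM; [exact: (Pf k).1|exact: bm_monomial].
have fwM k x : S x -> `|fs k x * monomial w x| <= M * W.
  by move=> Sx; rewrite normrM ler_pM//; [exact: fM|exact: Ww].
have fw x : S x -> fs k x * monomial w x @[k --> \oo] --> f x * monomial w x.
  by move=> Sx; apply: cvgM; [exact: ff|exact: cvg_cst].
have c1 := @mean_lim mu _ _ _ bfw fwM fw; have c2 := @mean_lim nu _ _ _ bfw fwM fw.
apply: (cvg_unique _ c1) => //; rewrite (_ : (fun k => _) =
  (fun k => mean S nu (fun x => fs k x * monomial w x)))//.
by apply/funext => k; exact: (Pf k).2.
Qed.

Let Q_lim fs f M : (forall n, Q (fs n)) -> (forall n x, S x -> `|fs n x| <= M) ->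
  (forall x, S x -> fs n x @[n --> \oo] --> f x) -> Q f.
Proof.
move=> Qf fM ff; split; first exact: bm_lim (fun n => (Qf n).1) fM ff.
move=> g Pg; have [_ [G gG]] := Pg.1.
apply: (@P_lim (fun n x => fs n x * g x) _ (M * G)).
- by move=> n; exact: (Qf n).2.
- by move=> n x Sx; rewrite normrM ler_pM//; [exact: fM|exact: gG].
- by move=> x Sx; apply: cvgM; [exact: ff|exact: cvg_cst].
Qed.

Let P_lin (a : R) f g : P f -> P g -> P (fun x => a * f x + g x).
Proof.
move=> [bf Pf] [bg Pg]; split; first by apply: bmD => //; exact: bmZ.
move=> n w.
have E : (fun x => (a * f x + g x) * monomial w x) = (fun x => a * (f x * monomial w x) + g x * monomial w x).
  by apply/funext => x; ring.
have b1 : bounded_meas S (fun x => f x * monomial w x) by apply: bmM => //; exact: bm_monomial.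
have b2 : bounded_meas S (fun x => g x * monomial w x) by apply: bmM => //; exact: bm_monomial.
have meanD rh : mean S rh (fun x => a * (f x * monomial w x) + g x * monomial w x) =
    a * mean S rh (fun x => f x * monomial w x) + mean S rh (fun x => g x * monomial w x).
  rewrite -(meanZ mS)// /mean RintegralD//; [exact: mS| |exact: (bm_integrable mS rh b2)].
  exact: (bm_integrable mS rh (bmZ a b1)).
by rewrite E !meanD Pf Pg.
Qed.

Let Q_lin (a : R) f g : Q f -> Q g -> Q (fun x => a * f x + g x).
Proof.
move=> [bf Qf] [bg Qg]; split; first by apply: bmD => //; exact: bmZ.
move=> u Pu; rewrite (_ : (fun x => _) = (fun x => a * (f x * u x) + g x * u x)).
  by apply: P_lin; [exact: Qf|exact: Qg].
by apply/funext => x; ring.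
Qed.

Let QM f g : Q f -> Q g -> Q (fun x => f x * g x).
Proof.
move=> [bf Qf] [bg Qg]; split; first exact: bmM.
move=> u Pu; rewrite (_ : (fun x => _) = (fun x => f x * (g x * u x))).
  by apply: Qf; exact: Qg.
by apply/funext => x; ring.
Qed.

Let P1 : P (cst 1).
Proof.
split; first exact: bm_cst.
move=> n w; rewrite (_ : (fun x => _) = monomial w); first exact: moments.
by apply/funext => x; rewrite mul1r.
Qed.

Let Q1 : Q (cst 1).
Proof.
split; first exact: bm_cst.
by move=> g Pg; rewrite (_ : (fun x => _) = g)//; apply/funext => x; rewrite mul1r.
Qed.

Let Qc (a : R) : Q (cst a).
Proof.
have Q0 : Q (fun=> (-1) * 1 + 1) := Q_lin (-1) Q1 Q1.
rewrite (_ : cst a = fun x : R3 R => a * 1 + ((-1) * 1 + 1)); first exact: Q_lin.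
by apply/funext => x /=; ring.
Qed.

Let Q_coord i : Q (coord i).
Proof.
split; first exact: bm_coord.
move=> g [bg Pg]; split; first by apply: bmM => //; exact: bm_coord.
move=> n w; pose w' : {ffun 'I_n.+1 -> 'I_3} := [ffun j => if unlift ord0 j is Some j' then w j' else i].
rewrite (_ : (fun x => _) = (fun x => g x * monomial w' x)); first exact: Pg.
apply/funext => x; rewrite /monomial big_ord_recl ffunE unlift_none mulrA [g x * _]mulrC.
by congr (_ * _); apply: eq_bigr => j _; rewrite ffunE liftK.
Qed.

Let QX f n : Q f -> Q (fun x => f x ^+ n).
Proof.
move=> Qf; elim: n => [|n IH]; first exact: Q1.
rewrite (_ : (fun x => _) = fun x => f x * f x ^+ n); first exact: QM.
by apply/funext => x; rewrite exprS.
Qed.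

Let Q_abs f : Q f -> (forall x, S x -> `|f x| <= 1) -> Q (fun x => `|f x|).
Proof.
move=> Qf f1; apply: (@Q_lim (fun n x => abs_iter n (f x)) _ 1).
- elim=> [|n IH]; first exact: Qc.
  rewrite (_ : (fun x => _) = fun x => (1 / 2) * f x ^+ 2 +
    ((- (1 / 2)) * (abs_iter n (f x)) ^+ 2 + abs_iter n (f x))).
    by apply: Q_lin; [exact: QX|apply: Q_lin => //; exact: QX].
  by apply/funext => x /=; field.
- move=> n x Sx; have [/andP[y0 yx] _] := abs_iter_bound n (f1 x Sx).
  by rewrite ger0_norm// (le_trans yx)// f1.
- by move=> x Sx; apply: abs_iter_cvg; exact: f1.
Qed.

(** If [v] is the positive part of [f], then [(1 - v)^n] tends to the indicator of [f <= 0]. *)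
Let Q_pos f : Q f -> (forall x, S x -> `|f x| <= 1) -> Q (\1_[set x | 0 < f x]).
Proof.
move=> Qf f1.
pose v x := (1 / 2) * `|f x| + ((1 / 2) * f x + 0).
have Qv : Q v by apply: Q_lin; [exact: Q_abs|apply: Q_lin => //; exact: Qc].
apply: (@Q_lim (fun n x => (-1) * ((-1) * v x + 1) ^+ n + 1) _ 1).
- by move=> n; apply: Q_lin => //; apply: QX; exact: Q_lin.
- move=> n x /f1 fx1; have v01 : 0 <= (-1) * v x + 1 <= 1.
    by rewrite /v; have := ler_norm (f x); have := ler_norm (- f x); rewrite normrN; lra.
  have /andP[v0 v1] := v01; have := exprn_ge0 n v0; have := exprn_ile1 n v0 v1.
  by move: (_ ^+ n) => y y1 y0; rewrite ger0_norm; lra.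
move=> x Sx; have fx1 := f1 x Sx; rewrite indicE.
have [fx0|fx0] := ltP 0 (f x).
  rewrite mem_set//= [X in _ --> X](_ : _ = (-1) * 0 + 1 :> R); last by ring.
  apply: cvgD; last exact: cvg_cst.
  apply: cvgM; first exact: cvg_cst.
  apply: cvg_expr; move: fx1; rewrite /v (gtr0_norm fx0) => h.
  by rewrite ger0_norm; lra.
rewrite memNset/=; last by rewrite ltNge fx0.
rewrite (_ : (fun n => _) = cst 0); first exact: cvg_cst.
apply/funext => n /=.
have e : (-1) * v x + 1 = 1 by rewrite /v ler0_norm//; lra.
by rewrite e expr1n; lra.
Qed.

Let QI A := Q (\1_A).

Let QI_C A : QI A -> QI (~` A).
Proof.
move=> QA; rewrite /QI (_ : \1_(~` A) = fun x => (-1) * \1_A x + 1); first exact: Q_lin.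
by apply/funext => x; rewrite !indicE in_setC; case: (x \in A) => /=; ring.
Qed.

Let QI_bigcup (F : (set (R3 R))^nat) : (forall n, QI (F n)) -> QI (\bigcup_n F n).
Proof.
move=> QF; pose p n (x : R3 R) := \prod_(i < n) ((-1) * \1_(F i) x + 1 : R).
have p01 n x : p n x = 0 \/ p n x = 1.
  elim: n => [|n IH]; first by right; rewrite /p big_ord0.
  rewrite /p big_ord_recr/= -/(p n x) indicE; case: (_ \in _) => /=.
    by left; ring.
  by case: IH => ->; [left|right]; ring.
apply: (@Q_lim (fun n x => (-1) * p n x + 1) _ 1).
- move=> n; apply: Q_lin => //; elim: n => [|n IH].
    rewrite (_ : p 0%N = cst 1)//; by apply/funext => x; rewrite /p big_ord0.
  rewrite (_ : p n.+1 = fun x => p n x * ((-1) * \1_(F n) x + 1)).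
    by apply: QM => //; apply: Q_lin => //; exact: QF.
  by apply/funext => x; rewrite /p big_ord_recr.
- by move=> n x _; case: (p01 n x) => ->; rewrite ?mulr0 ?mulr1 ?add0r ?addNr ?normr0 ?normr1.
move=> x _; rewrite indicE; have [/set_mem [k _ Fk]|nF] := boolP (x \in _).
  apply: cvg_near_cst; exists k.+1 => // n /= kn.
  have : p n x = 0 by apply/eqP; apply/prodf_eq0; exists (Ordinal kn) => //;
    rewrite indicE mem_set//= mulr1 addNr.
  by move=> ->; rewrite mulr0 add0r.
rewrite (_ : (fun n => _) = cst 0); first exact: cvg_cst.
apply/funext => n /=; rewrite /p big1 ?mulr1 ?addNr// => i _.
rewrite indicE memNset ?mulr0 ?add0r// => Fi; move/negP: nF; apply.
by apply/mem_set; exists i.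
Qed.

Let QI_coord i (B : set R) : measurable B -> QI (coord i @^-1` B).
Proof.
move=> mB; have : (@ocitv R).-sigma.-measurable B by exact: mB.
rewrite RGenOInfty.measurableE.
apply: (@smallest_sub _ _ _ [set C | QI (coord i @^-1` C)]); last first.
  move=> _ [a ->]; pose s : R := (1 + `|a|)^-1.
  have s0 : 0 < s by rewrite invr_gt0 ltr_pwDl.
  rewrite /= /QI (_ : coord i @^-1` _ = [set x | 0 < s * coord i x + - (s * a)]).
    apply: Q_pos; first by apply: Q_lin; [exact: Q_coord|exact: Qc].
    move=> x Sx; have -> : s * coord i x + - (s * a) = (coord i x - a) / (1 + `|a|).
      by rewrite -mulrBr mulrC.
    rewrite normrM (gtr0_norm s0) ler_pdivrMr ?mul1r ?ltr_pwDl//.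
    rewrite (le_trans (ler_normB _ _))// lerD2r.
    exact: coord_le1.
  apply/seteqP; split => x /=; rewrite in_itv/= andbT -mulrBr pmulr_rgt0// subr_gt0//.
split => /=.
- rewrite preimage_set0 /QI (_ : \1_set0 = cst 0); first exact: Qc.
  by apply/funext => x; rewrite indicE in_set0.
- by move=> A QA; rewrite setTD preimage_setC; exact: QI_C.
- by move=> F QF; rewrite preimage_bigcup; exact: QI_bigcup.
Qed.

Let QI_set0 : QI set0.
Proof.
rewrite /QI (_ : \1_set0 = cst 0); first exact: Qc.
by apply/funext => x; rewrite indicE in_set0.
Qed.

(** The sets whose indicator is in [Q] form a sigma-algebra, and it contains the half-spaces
    bounded by coordinate planes. *)
Lemma moments_determine (A : set (R3 R)) : measurable A -> mu A = nu A.
Proof.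
move=> mA; suff QA : QI A.
  have mI (rh : probability (R3 R) R) : rh S = 1%E -> rh A = (mean S rh (\1_A))%:E.
    move=> rhS; rewrite (meanE rh QA.1).
    rewrite integral_sphere//; first by rewrite integral_indic// setIT.
    by apply/measurable_EFinP; exact: measurable_indic.
  rewrite !mI//; congr EFin.
  have := (QA.2 _ P1).2 0%N [ffun=> ord0].
  rewrite (_ : (fun x => _) = \1_A)//.
  by apply/funext => x; rewrite /monomial big_ord0 !mulr1.
(* the sigma-algebra of the product is generated by the preimages under the projections *)
have pre2 (B : set (R * R)) : measurable B -> QI (fst @^-1` B).
  apply: (@smallest_sub _ _ _ [set C | QI (fst @^-1` C)]) => /=; last first.
    move=> _ [[C mC <-]|[C mC <-]]; rewrite setTI -comp_preimage.
      exact: (QI_coord (ord0 : 'I_3) mC).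
    exact: (QI_coord (lift ord0 ord0 : 'I_3) mC).
  split => /=.
  - by rewrite preimage_set0.
  - by move=> C QC; rewrite setTD preimage_setC; exact: QI_C.
  - by move=> F QF; rewrite preimage_bigcup; exact: QI_bigcup.
move: mA; apply: (@smallest_sub _ _ _ QI) => /=; last first.
  move=> _ [[C mC <-]|[C mC <-]]; rewrite setTI; first exact: pre2.
  exact: (QI_coord (ord_max : 'I_3) mC).
by split => // C QC; rewrite setTD; exact: QI_C.
Qed.

End moments.

(** * Existence and uniqueness of the equilibrium measure *)

Section equilibrium.
Context (R : realType).
Local Notation leb := (@lebesgue_measure R).
Local Notation S := (@sphere2 R).
Variables (q h al : R).
Hypotheses (params : (0 < q) /\ (0 < h)) (Hal : is_alpha0 q h al).
Implicit Types (t phi : R) (x y : R3 R) (mu : probability (R3 R) R).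
Local Notation a := (hav al).
Local Notation rho := (rho q h al).
Local Notation cap_prob := (cap_probability params Hal).
Local Notation Q := (point_charge_field q h).
Local Notation cap_const := (cap_const q h a).

Let al0pi : 0 < al < pi. Proof. by case: Hal. Qed.

Lemma field_coulomb x : Q x = (q%:E * coulomb (0%R, 0%R, h) x)%E.
Proof. by rewrite coulombC. Qed.

Lemma field_ge0 x : (0 <= Q x)%E.
Proof. by rewrite field_coulomb mule_ge0 ?coulomb_ge0// lee_fin ltW// params.1. Qed.

Lemma measurable_field : measurable_fun [set: R3 R] Q.
Proof.
rewrite (_ : Q = fun x => (q%:E * coulomb (0%R, 0%R, h) x)%E); last exact/funext/field_coulomb.
by apply: measurable_funeM; exact: measurable_coulomb1.
Qed.

Lemma eq_integral_cap_prob (f g : R3 R -> \bar R) : (forall x, 0 <= f x)%E -> (forall x, 0 <= g x)%E ->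
  measurable_fun [set: R3 R] f -> measurable_fun [set: R3 R] g ->
  (forall t phi, 0 < t < 2 * pi -> al < phi < pi -> f (spherical 1 t phi) = g (spherical 1 t phi)) ->
  (\int[cap_prob]_x f x = \int[cap_prob]_x g x)%E.
Proof.
move=> f0 g0 mf mg fg.
apply: (etrans (integral_cap_measure params Hal f0 mf)).
apply: (etrans _ (esym (integral_cap_measure params Hal g0 mg))).
apply: eq_integral => phi /set_mem; rewrite /= in_itv/= => hphi; congr (_ * _)%E.
by apply: eq_integral => t /set_mem; rewrite /= in_itv/= => ht; exact: fg.
Qed.

Lemma cap_prob_sphere : cap_prob S = 1%E.
Proof.
have mS := @measurable_sphere2 R.
transitivity (\int[cap_prob]_x (\1_S x)%:E)%E; first by rewrite integral_indic// setIT.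
transitivity (\int[cap_prob]_x (cst 1%E x))%E; last first.
  by rewrite integral_cst// mul1e; exact: (@probability_setT _ _ _ cap_prob).
apply: eq_integral_cap_prob.
- by move=> x; rewrite lee_fin.
- by [].
- by apply/measurable_EFinP; exact: measurable_indic.
- exact: measurable_cst.
- by move=> t phi _ _; rewrite indicE mem_set//; exact: sphere2_spherical.
Qed.

Let potential x := (\int[cap_prob]_y coulomb x y)%E.

Let cap_const_ge0 : 0 <= cap_const.
Proof.
have pi0 := @pi_gt0 R; have /andP[al0 alpi] := al0pi.
have e : (potential (spherical 1 0 al) + Q (spherical 1 0 al) = cap_const%:E)%E.
  by apply: total_potential_eq; lra.
by rewrite -lee_fin -e adde_ge0 ?field_ge0// potential_nonneg.
Qed.

Let total_eq : (mutual_energy cap_prob cap_prob + \int[cap_prob]_(x in S) Q x = cap_const%:E)%E.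
Proof.
rewrite mutual_energyE ?cap_prob_sphere// integral_sphere ?cap_prob_sphere//; last 2 first.
- exact: field_ge0.
- exact: measurable_field.
rewrite -ge0_integralD//; last 4 first.
- by move=> x _; exact: potential_nonneg.
- exact: measurable_potential.
- by move=> x _; exact: field_ge0.
- exact: measurable_field.
transitivity (\int[cap_prob]_x (cst cap_const%:E x))%E; last first.
  rewrite integral_cst// [X in (_ * X)%E](_ : _ = 1%E) ?mule1//.
  exact: (@probability_setT _ _ _ cap_prob).
apply: eq_integral_cap_prob.
- by move=> x; rewrite adde_ge0 ?field_ge0// potential_nonneg.
- by move=> x; rewrite lee_fin.
- by apply: emeasurable_funD; [exact: measurable_potential|exact: measurable_field].
- exact: measurable_cst.
move=> t phi /andP[t0 t1] /andP[p0 p1].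
by apply: total_potential_eq; rewrite !ltW.
Qed.

Let total_ge mu : mu S = 1%E ->
  (cap_const%:E <= mutual_energy mu cap_prob + \int[mu]_(x in S) Q x)%E.
Proof.
move=> muS.
have -> : mutual_energy mu cap_prob = (\int[mu]_(x in S) potential x)%E.
  apply: eq_integral => x _; rewrite /potential integral_sphere ?cap_prob_sphere//.
    by move=> y; exact: coulomb_ge0.
  exact: measurable_coulomb1.
have mS := @measurable_sphere2 R.
rewrite -ge0_integralD//; last 4 first.
- by move=> x _; exact: potential_nonneg.
- by apply: measurable_funTS; exact: measurable_potential.
- by move=> x _; exact: field_ge0.
- by apply: measurable_funTS; exact: measurable_field.
have -> : cap_const%:E = (\int[mu]_(x in S) (cst cap_const%:E x))%E.
  by rewrite integral_cst//; move: muS => /= ->; rewrite mule1.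
apply: ge0_le_integral => //.
- apply: measurable_funTS; apply: emeasurable_funD; [exact: measurable_potential|exact: measurable_field].
- by move=> x Sx; exact: total_potential_ge.
Qed.

Let weightedE mu : weighted_energy Q mu = (mutual_energy mu mu + 2%:E * \int[mu]_(x in S) Q x)%E.
Proof. by []. Qed.

Let mutual_ge0 mu mu' : (0 <= mutual_energy mu mu')%E.
Proof. by do 2?[apply: integral_ge0 => ? _]; exact: coulomb_ge0. Qed.

Let intQ_ge0 mu : (0 <= \int[mu]_(x in S) Q x)%E.
Proof. by apply: integral_ge0 => x _; exact: field_ge0. Qed.

(** The candidate has finite energy because potential plus field is constant on its support. *)
Let cap_prob_fin : mutual_energy cap_prob cap_prob \is a fin_num /\ (\int[cap_prob]_(x in S) Q x)%E \is a fin_num.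
Proof.
have : (mutual_energy cap_prob cap_prob + \int[cap_prob]_(x in S) Q x)%E \is a fin_num by rewrite total_eq.
by rewrite fin_numD => /andP.
Qed.

(** Integrating [total_potential_ge] against [mu] and [total_potential_eq] against the
    candidate turns the inequality [energy_ge] into one between weighted energies. *)
Lemma weighted_energy_ge mu n (w : {ffun 'I_n -> 'I_3}) : mu S = 1%E ->
  exists2 C : R, 0 < C &
  (weighted_energy Q cap_prob + (C * (mean S mu (monomial w) - mean S cap_prob (monomial w)) ^+ 2)%:E <=
   weighted_energy Q mu)%E.
Proof.
move=> muS; have eS := cap_prob_sphere.
have [C C0 ge] := energy_ge w muS eS; exists C => //.
rewrite !weightedE; move: ge.
have := total_ge muS; have := total_eq; have [E1 Q1] := cap_prob_fin.
rewrite (mutual_energyC eS muS).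
(* an infinite energy of mu makes the claim trivial; otherwise all terms are real, and the
   claim is a linear combination of the three relations *)
move: (C * _) => d.
move: E1 Q1; have := mutual_ge0 mu mu; have := mutual_ge0 mu cap_prob; have := intQ_ge0 mu.
case: (mutual_energy cap_prob cap_prob) => // e; case: (\int[cap_prob]_(x in S) Q x)%E => // k.
case: (mutual_energy mu mu) => [A| |]// + + + _ _.
  case: (\int[mu]_(x in S) Q x)%E => [K| |]//.
    case: (mutual_energy mu cap_prob) => [M| |]//.
      by rewrite -!EFinM -!EFinD !lee_fin => _ _ _ [eFQ] g1 g2; lra.
  by move=> _ _ _ _ _ _; rewrite gt0_muley ?lte_fin// addey// leey.
move=> _ _ _ _ _ _; rewrite addye ?leey//.
by rewrite -ltNye (lt_le_trans (ltNyr 0))// mule_ge0// lee_fin.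
Qed.

Let weighted_fin : weighted_energy Q cap_prob \is a fin_num.
Proof. by have [E1 Q1] := cap_prob_fin; rewrite weightedE fin_numD E1 fin_numM. Qed.

Lemma weighted_energy_min mu : mu S = 1%E -> (weighted_energy Q cap_prob <= weighted_energy Q mu)%E.
Proof.
move=> muS; have [C C0 +] := weighted_energy_ge ([ffun=> ord0] : {ffun 'I_0 -> 'I_3}) muS.
by apply: le_trans; rewrite leeDl// lee_fin mulr_ge0 ?sqr_ge0// ltW.
Qed.

Lemma cap_prob_is_equilibrium : is_equilibrium Q cap_prob.
Proof.
split; first exact: cap_prob_sphere.
apply/eqP; rewrite eq_le; apply/andP; split.
  by apply: le_ereal_inf_tmp => _ [mu muS <-]; exact: weighted_energy_min.
by apply: ereal_inf_lbound; exists cap_prob => //; exact: cap_prob_sphere.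
Qed.

Lemma equilibrium_unique mu (A : set (R3 R)) : is_equilibrium Q mu -> measurable A ->
  mu A = cap_prob A.
Proof.
move=> [muS muW] mA; apply: moments_determine => //; first exact: cap_prob_sphere.
move=> n w; have [C C0 +] := weighted_energy_ge w muS.
have -> : weighted_energy Q mu = weighted_energy Q cap_prob.
  by rewrite muW; have [_ ->] := cap_prob_is_equilibrium.
move: weighted_fin; case: (weighted_energy Q cap_prob) => // e _.
rewrite -EFinD lee_fin gerDl pmulr_rle0// => d0.
by apply/eqP; rewrite -subr_eq0 -sqrf_eq0 eq_le d0 sqr_ge0.
Qed.

End equilibrium.

(** * Density and support of the equilibrium measure *)

Section open_measurable.
Context (R : realType).

Let box (z : rat * rat * rat * rat) : set (R3 R) :=
  [set y | [/\ `|ratr z.1.1.1 - y.1.1| < ratr z.2, `|ratr z.1.1.2 - y.1.2| < ratr z.2 &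
     `|ratr z.1.2 - y.2| < ratr z.2]].

Let measurable_box z : measurable (box z).
Proof.
have mb (c r : R) (f : R3 R -> R) : measurable_fun [set: R3 R] f ->
    measurable [set y | `|c - f y| < r].
  move=> mf; rewrite [X in measurable X](_ : _ = f @^-1` (ball c r)).
    by rewrite -[X in measurable X]setTI; apply: mf => //; exact: measurable_ball.
  by apply/seteqP; split => y.
rewrite [X in measurable X](_ : _ =
  [set y | `|ratr z.1.1.1 - y.1.1| < ratr z.2] `&` [set y | `|ratr z.1.1.2 - y.1.2| < ratr z.2]
   `&` [set y | `|ratr z.1.2 - y.2| < ratr z.2]).
  apply: measurableI; first apply: measurableI; apply: mb.
  - exact: (measurableT_comp (@measurable_fst _ _ _ _) (@measurable_fst _ _ _ _)).
  - exact: (measurableT_comp (@measurable_snd _ _ _ _) (@measurable_fst _ _ _ _)).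
  - exact: measurable_snd.
by apply/seteqP; split => y /= => [[? ? ?]|[[? ?] ?]].
Qed.

(** Rational boxes form a countable base of the topology. *)
Lemma open_measurable_R3 (U : set (R3 R)) : open U -> measurable U.
Proof.
move=> oU; pose F z := if `[< box z `<=` U >] then box z else set0.
have -> : U = \bigcup_z F z; last first.
  apply: countable_bigcupT_measurable => // z; rewrite /F.
  by case: ifP.
apply/seteqP; split=> [x Ux|x [z _]]; last first.
  by rewrite /F; case: ifP => // /asboolP zU /zU.
have /nbhs_ballP[e /= e0 eU] : nbhs x U by move: oU; rewrite openE => /(_ _ Ux).
have /rat_in_itvoo[r] : 0 < e / 2 by rewrite divr_gt0.
rewrite in_itv/= => /andP[r0 re].
have pick (c : R) : exists p : rat, `|ratr p - c| < ratr r.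
  have /rat_in_itvoo[p] : c - ratr r < c + ratr r by lra.
  by rewrite in_itv/= => cp; exists p; rewrite ltr_norml; lra.
have [p1 h1] := pick x.1.1; have [p2 h2] := pick x.1.2; have [p3 h3] := pick x.2.
exists (p1, p2, p3, r) => //; rewrite /F ifT//.
apply/asboolP => y [/= y1 y2 y3]; apply: eU.
have tri (c u v : R) : `|c - u| < ratr r -> `|c - v| < ratr r -> `|u - v| < e.
  by move=> cu cv; rewrite (le_lt_trans (ler_distD c _ _))// (distrC u c); lra.
by split; first split; [exact: tri h1 y1|exact: tri h2 y2|exact: tri h3 y3].
Qed.

End open_measurable.

Section density_and_support.
Context (R : realType).
Local Notation leb := (@lebesgue_measure R).
Local Notation S := (@sphere2 R).
Variables (q h al : R).
Hypotheses (params : (0 < q) /\ (0 < h)) (Hal : is_alpha0 q h al).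
Implicit Types (t phi : R) (x y : R3 R).
Local Notation a := (hav al).
Local Notation rho := (rho q h al).
Local Notation cap_prob := (cap_probability params Hal).

Let al0pi : 0 < al < pi. Proof. by case: Hal. Qed.

Let hyp : [/\ 0 < q, 0 < h, 0 < a & a < 1].
Proof. by case: params => q0 h0; exact: hyp_of_alpha0 q0 h0 Hal. Qed.

Lemma equilibrium_density_rho phi : al < phi <= pi ->
  equilibrium_density q h al phi = rho (hav phi).
Proof.
move=> ph; have [q0 h0 _ _] := hyp; rewrite (equilibrium_density_abel_prim q0 h0 Hal ph).
have /andP[p0 p1] := ph; have /andP[al0 _] := al0pi.
by rewrite /rho (abel_solE hyp)// hav_lt// ltW.
Qed.

Let circle_meas (A : set (R3 R)) phi : (\bar R) :=
  (\int[leb]_(t in `]0%R, (2 * pi)%R[) (\1_A (spherical 1 t phi))%:E)%E.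

Let eqpE (A : set (R3 R)) : measurable A -> cap_prob A = (\int[leb]_(phi in `]al, pi[)
    ((rho (hav phi) * sin phi)%:E * circle_meas A phi))%E.
Proof.
move=> mA; rewrite -[LHS](_ : \int[cap_prob]_x (\1_A x)%:E = _)%E; last first.
  by rewrite integral_indic// setIT.
have mI : measurable_fun [set: R3 R] (fun x => (\1_A x : R)%:E).
  by apply/measurable_EFinP; exact: measurable_indic.
by apply: (etrans (integral_cap_measure params Hal _ mI)) => // x; rewrite lee_fin.
Qed.

Let mIs (A : set (R3 R)) : measurable A ->
  measurable_fun [set: R * R] (fun z : R * R => (\1_A (spherical 1 z.2 z.1) : R)%:E).
Proof.
move=> mA; apply/measurable_EFinP.
exact: (measurableT_comp (@measurable_indic _ _ R setT A mA) (@measurable_spherical R)).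
Qed.

Let mcircle (A : set (R3 R)) : measurable A -> measurable_fun [set: R] (circle_meas A).
Proof.
move=> mA.
rewrite (_ : circle_meas A = fun phi => \int[leb]_t
   ((\1_(`]0, 2 * pi[%classic : set R) t)%:E * (\1_A (spherical 1 t phi) : R)%:E))%E.
  apply: (@measurable_fun_fubini_tonelli_F _ _ _ _ _ leb (fun z : R * R =>
    ((\1_(`]0, 2 * pi[%classic : set R) z.2)%:E * (\1_A (spherical 1 z.2 z.1) : R)%:E)%E)).
    apply: emeasurable_funM; last exact: mIs.
    apply/measurable_EFinP.
    exact: (measurableT_comp (@measurable_indic _ _ R setT _ (measurable_itv `]0, 2 * pi[))
      (@measurable_snd _ _ _ _)).
  by move=> z; rewrite -EFinM lee_fin.
apply/funext => phi; rewrite /circle_meas integral_mkcond; apply: eq_integral => t _.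
by rewrite patchE -EFinM /indic; case: (t \in _); rewrite ?mul1r ?mul0r.
Qed.

Let mweight (D : set R) : measurable_fun D (fun phi => (rho (hav phi) * sin phi)%:E).
Proof.
apply: measurable_funTS; apply/measurable_EFinP; apply: measurable_funM.
  exact: (measurableT_comp (measurable_rho params Hal) (@measurable_hav R)).
exact: measurable_sin.
Qed.

Let mslice (A : set (R3 R)) (D : set R) : measurable A ->
  measurable_fun D (fun phi => (rho (hav phi) * sin phi)%:E * circle_meas A phi)%E.
Proof.
move=> mA; apply: emeasurable_funM; first exact: mweight.
by apply: measurable_funTS; exact: mcircle.
Qed.

Lemma cap_prob_has_density : has_density_on_cap cap_prob al (equilibrium_density q h al).
Proof.
move=> A mA; have /andP[al0 alpi] := al0pi; have pi0 := @pi_gt0 R.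
have inner phi : al < phi < pi ->
  (\int[leb]_(t in `[0%R, (2 * pi)%R])
    (equilibrium_density q h al phi * sin phi * \1_A (spherical 1 t phi))%:E)%E =
  ((rho (hav phi) * sin phi)%:E * circle_meas A phi)%E.
  move=> /andP[p0 p1].
  have mA1 (D : set R) : measurable_fun D (fun t => (\1_A (spherical 1 t phi) : R)%:E).
    apply: measurable_funTS.
    exact: (measurableT_comp (mIs mA) (pair1_measurable phi)).
  have s0 : 0 <= sin phi by rewrite ltW// sin_gt0_pi//; lra.
  rewrite equilibrium_density_rho ?p0 ?ltW// integral_itv_bndoo; last first.
    apply/measurable_EFinP; apply: measurable_funM => //.
    by apply/measurable_EFinP; exact: mA1.
  rewrite /circle_meas -ge0_integralZl_EFin//.
  - exact: mA1.
  - by rewrite mulr_ge0// (rho_ge0 params Hal).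
rewrite eqpE// [RHS]integral_itv_bndoo; last first.
  apply: (eq_measurable_fun _ _ (mslice (D := `]al, pi[%classic) mA)) => phi /set_mem.
  by rewrite /= in_itv/= => /inner.
by apply: eq_integral => phi /set_mem; rewrite /= in_itv/= => /inner ->.
Qed.

Lemma spherical_capP x : spherical_cap al x <-> S x /\ x.2 <= cos al.
Proof.
have /andP[al0 alpi] := al0pi; split.
  move=> [t [phi [_ /andP[p0 p1] ->]]]; split; first exact: sphere2_spherical.
  by rewrite /spherical/= mul1r leNgt ltr_cos; rewrite ?in_itv/=; lra.
move=> [/spherical_param[t [phi [t2 ph ->]]]] c.
have {}c : cos phi <= cos al by move: c; rewrite /spherical/= mul1r.
have /andP[p0 p1] := ph.
exists t, phi; split=> //; rewrite p1 andbT leNgt; move: c; apply: contraL => phia.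
by rewrite -ltNge ltr_cos; rewrite ?in_itv/=; lra.
Qed.

Let continuous_coord : [/\ continuous (fun x : R3 R => x.1.1),
   continuous (fun x : R3 R => x.1.2) & continuous (fun x : R3 R => x.2)].
Proof.
split=> x.
- apply: (@continuous_comp _ _ _ fst fst); exact: cvg_fst.
- by apply: (@continuous_comp _ _ _ fst snd); [exact: cvg_fst|exact: cvg_snd].
- exact: cvg_snd.
Qed.

Lemma open_cap_setC : open (~` spherical_cap al).
Proof.
have [c1 c2 c3] := continuous_coord.
have cn : continuous (@norm2 R).
  by move=> x; rewrite /norm2; apply: cvgD; first apply: cvgD; rewrite expr2; apply: cvgM;
    [exact: c1|exact: c1|exact: c2|exact: c2|exact: c3|exact: c3].
have -> : ~` spherical_cap al = (@norm2 R @^-1` (~` [set 1])) `|` ((fun x => x.2) @^-1` `]cos al, +oo[%classic).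
  apply/seteqP; split => x /=.
    move=> nc; have [n1|n1] := eqVneq (norm2 x) 1; last by left; apply/eqP.
    right; rewrite in_itv/= andbT ltNge; apply/negP => xc.
    by apply: nc; apply/spherical_capP; split=> //; apply/sphere2P.
  rewrite in_itv/= andbT => -[n1|xc] /spherical_capP[/sphere2P // _].
  by rewrite leNgt xc.
apply: openU; apply: open_comp => //.
by rewrite openC; exact: closed_eq.
Qed.

Lemma cap_prob_cap_setC : cap_prob (~` spherical_cap al) = 0%E.
Proof.
have /andP[al0 alpi] := al0pi.
have mcap : measurable (~` spherical_cap al).
  by apply: open_measurable_R3; exact: open_cap_setC.
rewrite eqpE// integral0_eq// => phi /=; rewrite in_itv/= => /andP[p0 p1].
rewrite [X in (_ * X)%E]integral0_eq ?mule0// => t /=; rewrite in_itv/= => /andP[t0 t1].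
rewrite indicE memNset//= => nc; apply: nc; exists t, phi; split => //; last by rewrite !ltW.
by rewrite !ltW.
Qed.

Let subinterval (b c u e : R) : b < c -> b <= u <= c -> 0 < e ->
  exists b' c', [/\ b' < c', b <= b', c' <= c & forall z, b' < z < c' -> `|u - z| < e].
Proof.
move=> bc /andP[bu uc] e0; exists (Num.max b (u - e)), (Num.min c (u + e)); split.
- by rewrite lt_min !gt_max; lra.
- by rewrite le_max lexx.
- by rewrite ge_min lexx.
- by move=> z; rewrite gt_max lt_min ltr_norml; lra.
Qed.

Lemma spherical_continuous (t phi : R) (U : set (R3 R)) : open U -> U (spherical 1 t phi) ->
  exists2 e : R, 0 < e &
    forall t' phi', `|t - t'| < e -> `|phi - phi'| < e -> U (spherical 1 t' phi').
Proof.
move=> oU Ux.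
have cF : {for (t, phi), continuous (fun z : R * R => spherical 1 z.1 z.2)}.
  have c1 (f g : R -> R) : continuous f -> continuous g ->
      {for (t, phi), continuous (fun z : R * R => 1 * f z.2 * g z.1)}.
    move=> cf cg; apply: cvgM; last first.
      by apply: (@continuous_comp _ _ _ fst g); [exact: cvg_fst|exact: cg].
    apply: cvgM; first exact: cvg_cst.
    by apply: (@continuous_comp _ _ _ snd f); [exact: cvg_snd|exact: cf].
  have H1 := c1 _ _ (@continuous_sin R) (@continuous_cos R).
  have H2 := c1 _ _ (@continuous_sin R) (@continuous_sin R).
  have H3 : {for (t, phi), continuous (fun z : R * R => 1 * cos z.2)}.
    apply: cvgM; first exact: cvg_cst.
    by apply: (@continuous_comp _ _ _ snd cos); [exact: cvg_snd|exact: continuous_cos].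
  exact: (cvg_pair (cvg_pair H1 H2) H3).
have /cF/nbhs_ballP[e /= e0 eU] : nbhs (spherical 1 t phi) U.
  by move: oU; rewrite openE => /(_ _ Ux).
by exists e => // t' phi' tt' pp'; apply: (eU (t', phi')); split.
Qed.

(** The density is positive inside the cap, and a neighbourhood of a point of the cap
    contains the image of a rectangle of angles of positive measure, even if the point
    is on the boundary of the cap. *)
Lemma cap_prob_open_gt0 x (U : set (R3 R)) : spherical_cap al x -> open U -> U x -> (0 < cap_prob U)%E.
Proof.
have /andP[al0 alpi] := al0pi; have pi0 := @pi_gt0 R.
move=> [t [phi [t2 ph ->]]] oU Ux.
have mU := open_measurable_R3 oU.
have [e e0 eU] := spherical_continuous oU Ux.
have [c1 [d1 [cd1 ac1 dpi1 h1]]] := subinterval alpi ph e0.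
have [|c2 [d2 [cd2 ac2 dpi2 h2]]] := @subinterval 0 (2 * pi) t e _ t2 e0.
  by rewrite mulr_gt0.
have circ phi' : c1 < phi' < d1 -> (0 < circle_meas U phi')%E.
  move=> hp; apply: (@lt_le_trans _ _ (d2 - c2)%:E); first by rewrite lte_fin subr_gt0.
  have -> : (d2 - c2)%:E = (\int[leb]_(s in `]c2, d2[) (cst 1%E s))%E.
    by rewrite integral_cst//= mul1e [RHS]lebesgue_measure_itv/= lte_fin cd2 EFinB.
  have mI : measurable_fun [set: R] (fun s => (\1_U (spherical 1 s phi') : R)%:E).
    exact: (measurableT_comp (mIs mU) (pair1_measurable phi')).
  apply: (@le_trans _ _ (\int[leb]_(s in `]c2, d2[) (\1_U (spherical 1 s phi') : R)%:E)%E).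
    apply: ge0_le_integral => //.
    - exact: measurable_funTS.
    - move=> s /=; rewrite in_itv/= => hs.
      by rewrite indicE mem_set//; apply: eU; [exact: h2|exact: h1].
  apply: ge0_subset_integral => //.
  - exact: measurable_funTS.
  - by move=> s /=; rewrite !in_itv/=; lra.
have D0 phi' : `]al, pi[%classic phi' ->
    (0 <= (rho (hav phi') * sin phi')%:E * circle_meas U phi')%E.
  rewrite /= in_itv/= => hp; rewrite mule_ge0//.
    by rewrite lee_fin mulr_ge0 ?(rho_ge0 params Hal)// ltW// sin_gt0_pi//; lra.
  by apply: integral_ge0 => s _; rewrite lee_fin.
rewrite lt0e measure_ge0 andbT; apply/eqP => U0.
have : (\int[leb]_(phi' in `]al, pi[)
    `|(rho (hav phi') * sin phi')%:E * circle_meas U phi'|)%E = 0%E.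
  rewrite -U0 eqpE//; apply: eq_integral => phi' /set_mem hp.
  by rewrite gee0_abs// D0.
move=> /(proj1 (@ae_eq_integral_abs _ _ _ leb _ (measurable_itv `]al, pi[) _ (mslice mU))).
move=> [N [mN N0 sub]].
have : (leb `]c1, d1[%classic <= leb N)%E.
  apply: le_measure; rewrite ?inE//; apply: subset_trans sub => phi' /=.
  rewrite in_itv/= => hp; apply/not_implyP; rewrite in_itv/=; split; first by lra.
  apply/eqP; rewrite gt_eqF// mule_gt0 ?circ// lte_fin mulr_gt0//.
    apply: (rho_gt0 params Hal); apply: hav_lt; lra.
  by apply: sin_gt0_pi; lra.
rewrite N0 lebesgue_measure_itv/= lte_fin cd1 -EFinB lee_fin; lra.
Qed.

Lemma cap_prob_support : measure_support cap_prob = spherical_cap al.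
Proof.
apply/seteqP; split=> x; last by move=> Sx U oU Ux; exact: (cap_prob_open_gt0 Sx oU Ux).
move=> Sx; apply: contrapT => nSx.
by have := Sx _ open_cap_setC nSx; rewrite cap_prob_cap_setC ltxx.
Qed.

End density_and_support.

Theorem theorem2p6 (R : realType) (q : R) (hq : 0 < q) :
  (exists! h_plus : R, is_h_plus q h_plus) /\
  (exists! h_minus : R, is_h_minus q h_minus) /\
  (forall h_plus h_minus h : R,
     is_h_plus q h_plus -> is_h_minus q h_minus ->
     0 < h -> h_minus < h < h_plus ->
     (exists! alpha0 : R, is_alpha0 q h alpha0) /\
     (exists mu : probability (R3 R) R,
        is_equilibrium (point_charge_field q h) mu) /\
     (forall (alpha0 : R) (mu_Q : probability (R3 R) R),
        is_alpha0 q h alpha0 ->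
        is_equilibrium (point_charge_field q h) mu_Q ->
        has_density_on_cap mu_Q alpha0 (equilibrium_density q h alpha0) /\
        measure_support mu_Q = spherical_cap alpha0)).
Proof.
have up := exists_unique_h_plus hq; have um := exists_unique_h_minus hq.
split=> //; split=> // hp hm h Hp Hm h0 hh.
have params : 0 < q /\ 0 < h by [].
have ua := exists_unique_alpha0 hq Hp Hm h0 hh.
split=> //; split.
  case: ua => al [Hal _]; exists (cap_probability params Hal).
  exact: cap_prob_is_equilibrium.
move=> al mu Hal Hmu.
have E (A : set (R3 R)) : measurable A -> mu A = cap_probability params Hal A.
  exact: equilibrium_unique Hmu.
split.
  by move=> A mA; rewrite E//; exact: cap_prob_has_density.
rewrite -(cap_prob_support params Hal); apply/seteqP; split=> x Hx U oU Ux.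
  by rewrite -E; [exact: Hx|exact: open_measurable_R3].
by rewrite E; [exact: Hx|exact: open_measurable_R3].
Qed.
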